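(* Let $G\in\mathfrak{R}H^\infty_{m\times p}$ and $K\in\mathfrak{R}H^\infty_{m\times q}$ be given by the minimal (observable and controllable) realization \[ \begin{bmatrix} G(z)&K(z)\end{bmatrix}=\begin{bmatrix}D_1&D_2\end{bmatrix}+zC(I_n-zA)^{-1}\begin{bmatrix}B_1&B_2\end{bmatrix}, \] with $A$ stable $n\times n$. Let $R(z)=G(z)G^*(z)-K(z)K^*(z)$, which equals $zC(I_n-zA)^{-1}\Gamma+R_0+\Gamma^*(zI_n-A^* )^{-1}C^*$ with $R_0=D_1D_1^*-D_2D_2^*+C(P_1-P_2)C^*$ and $\Gamma=B_1D_1^*-B_2D_2^*+A(P_1-P_2)C^*$, where $P_j$ is the controllability Gramian of $\{A,B_j\}$. Then $T_GT_G^*-T_KT_K^*$ is nonnegative if and only if the following two conditions hold: (i) $R(\zeta)\ge0$ for all $\zeta\in\mathbb{T}$, or equivalently $R$ has an outer spectral factor $\Phi\in\mathfrak{R}H^\infty_{r\times m}$ for some $r\le m$; (ii) the matrix $\Delta+P_2-P_1$ is nonnegative, where $\Delta$ is defined (when $R$ is not identically zero) as follows: $\mathcal{X}_\Phi=\{x\in\mathbb{C}^n:W_{obs}x\in\operatorname{Im}T_\Phi^*\}$; $C_\Phi$ is an $r\times n$ matrix with $\Phi(z)=\Phi(0)+zC_\Phi(I_n-zA)^{-1}\Gamma$ and $W_{obs}x=T_\Phi^*W_{\Phi,obs}x$ for all $x\in\mathcal{X}_\Phi$; $Q_\Phi$ is the observability Gramian of $\{C_\Phi,A\}$; $\Omega_\Phi=E_{\mathcal{X}_\Phi}^*Q_\Phi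 E_{\mathcal{X}_\Phi}$ (an invertible map on $\mathcal{X}_\Phi$); and $\Delta=E_{\mathcal{X}_\Phi}\Omega_\Phi^{-1}E_{\mathcal{X}_\Phi}^*$. In the special case when $R$ is identically zero, condition (i) is automatically fulfilled (with $r=0$) and condition (ii) is to be read with $\Delta=0$.
   Context: $\mathbb{T}$ is the unit circle; a stable matrix has all eigenvalues in the open unit disc. $\mathfrak{R}H^\infty_{k\times l}$: $k\times l$ rational matrix functions without poles in the closed unit disc. $\Omega^*(z)=\Omega(1/\bar z)^*$. $\ell^2_+(\mathbb{C}^k)$: square summable $\mathbb{C}^k$-valued sequences indexed by $j\ge0$; $T_\Omega$: block Toeplitz operator with $(i,j)$ block $\Omega_{i-j}$ ($\Omega_j$ Fourier coefficients). $W_{obs}=\operatorname{col}(CA^j)_{j\ge0}$, $W_{\Phi,obs}=\operatorname{col}(C_\Phi A^j)_{j\ge0}$, $P_j=\sum_{\nu\ge0}A^\nu B_jB_j^*(A^* )^\nu$, $Q_\Phi=\sum_{\nu\ge0}(A^* )^\nu C_\Phi^*C_\Phi A^\nu$. An outer spectral factor of $R$ is $\Phi\in\mathfrak{R}H^\infty_{r\times m}$ with $R=\Phi^*\Phi$ and $T_\Phi$ of dense range. $E_{\mathcal{X}_\Phi}:\mathcal{X}_\Phi\to\mathbb{C}^n$ is the canonical embedding. (Such $\Phi$, $C_\Phi$ exist under (i), and $\Delta$ does not depend on the choices made.) *)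

(* Defs.v *)
From HB Require Import structures.
From mathcomp Require Import all_boot all_order all_algebra.
From mathcomp Require Import complex.
From mathcomp Require Import boolp classical_sets reals topology normedtype sequences.
Set Implicit Arguments.
Unset Strict Implicit.
Unset Printing Implicit Defensive.
Import Order.TTheory GRing.Theory Num.Theory.
Import numFieldTopology.Exports numFieldNormedType.Exports.
Local Open Scope classical_set_scope.
Local Open Scope ring_scope.

Section Defs.
Variable R : realType.
Local Notation CC := R[i].

Definition mxadj (a b : nat) (M : 'M[CC]_(a, b)) : 'M[CC]_(b, a) :=
  map_mx Num.conj (trmx M).

Definition cabs2 (z : CC) : R := complex.Re z ^+ 2 + complex.Im z ^+ 2.
Definition vnorm2 (k : nat) (v : 'cV[CC]_k) : R := \sum_(i < k) cabs2 (v i 0).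

Definition l2 (k : nat) (x : nat -> 'cV[CC]_k) : Prop :=
  cvg (series (fun i => vnorm2 (x i)) @ \oo).
Definition l2norm2 (k : nat) (x : nat -> 'cV[CC]_k) : R :=
  limn (series (fun i => vnorm2 (x i))).

Definition csum_to (f : nat -> CC) (s : CC) : Prop :=
  (series (fun t => complex.Re (f t)) @ \oo --> complex.Re s) /\
  (series (fun t => complex.Im (f t)) @ \oo --> complex.Im s).
Definition csum (f : nat -> CC) : CC :=
  Complex (limn (series (fun t => complex.Re (f t))))
          (limn (series (fun t => complex.Im (f t)))).
Definition mxseries (a b : nat) (F : nat -> 'M[CC]_(a, b)) : 'M[CC]_(a, b) :=
  \matrix_(i, j) csum (fun t => F t i j).

(* Block Toeplitz operator T_Omega with (i,j) block Omega_{i-j}, for an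
   H^infty function Omega with Fourier coefficients coef j (j >= 0),
   Omega_j = 0 for j < 0:  (T x)_i = sum_{j <= i} Omega_{i-j} x_j. *)
Definition toeplitz (k l : nat) (coef : nat -> 'M[CC]_(k, l))
  (x : nat -> 'cV[CC]_l) : nat -> 'cV[CC]_k :=
  fun i => \sum_(j < i.+1) coef (i - j)%N *m x j.

(* u = T_Omega^H y, where T_Omega^H has (j,i) block Omega_{i-j}^H:
   (T^H y)_j = sum_{t >= 0} Omega_t^H y_{j+t}  (convergent series). *)
Definition toeplitz_adj_is (k l : nat) (coef : nat -> 'M[CC]_(k, l))
  (y : nat -> 'cV[CC]_k) (u : nat -> 'cV[CC]_l) : Prop :=
  forall (j : nat) (a : 'I_l),
    csum_to (fun t => (mxadj (coef t) *m y (j + t)%N) a 0) (u j a 0).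

Definition dense_range (k l : nat) (coef : nat -> 'M[CC]_(k, l)) : Prop :=
  forall y : nat -> 'cV[CC]_k, l2 y ->
  forall e : R, 0 < e ->
  exists x : nat -> 'cV[CC]_l, l2 x /\
    l2norm2 (fun i => toeplitz coef x i - y i) < e.

(* Realization  F(z) = D + z Cm (I_n - z A)^{-1} B  and its Taylor/Fourier
   coefficients F_0 = D, F_{j+1} = Cm A^j B. *)
Definition realize (a b n : nat) (D : 'M[CC]_(a, b)) (Cm : 'M[CC]_(a, n))
  (A : 'M[CC]_n) (B : 'M[CC]_(n, b)) (z : CC) : 'M[CC]_(a, b) :=
  D + z *: (Cm *m invmx (1%:M - z *: A) *m B).
Definition rcoef (a b n : nat) (D : 'M[CC]_(a, b)) (Cm : 'M[CC]_(a, n))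
  (A : 'M[CC]_n) (B : 'M[CC]_(n, b)) (j : nat) : 'M[CC]_(a, b) :=
  if j is j'.+1 then Cm *m (A ^+ j') *m B else D.

Definition Wobs (a n : nat) (Cm : 'M[CC]_(a, n)) (A : 'M[CC]_n) (x : 'cV[CC]_n)
  : nat -> 'cV[CC]_a := fun j => Cm *m (A ^+ j) *m x.

Definition ctrl_gram (n b : nat) (A : 'M[CC]_n) (B : 'M[CC]_(n, b)) : 'M[CC]_n :=
  mxseries (fun nu => (A ^+ nu) *m B *m mxadj B *m ((mxadj A) ^+ nu)).
Definition obs_gram (a n : nat) (Cm : 'M[CC]_(a, n)) (A : 'M[CC]_n) : 'M[CC]_n :=
  mxseries (fun nu => ((mxadj A) ^+ nu) *m mxadj Cm *m Cm *m (A ^+ nu)).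

Definition psd (k : nat) (M : 'M[CC]_k) : Prop :=
  forall v : 'cV[CC]_k, 0 <= (mxadj v *m M *m v) 0 0.

Definition stable (n : nat) (A : 'M[CC]_n) : Prop :=
  forall l : CC, eigenvalue A l -> `|l| < 1.
Definition observable (a n : nat) (Cm : 'M[CC]_(a, n)) (A : 'M[CC]_n) : Prop :=
  forall x : 'cV[CC]_n, (forall j, Cm *m (A ^+ j) *m x = 0) -> x = 0.
Definition controllable (n b : nat) (A : 'M[CC]_n) (B : 'M[CC]_(n, b)) : Prop :=
  forall y : 'rV[CC]_n, (forall j, y *m (A ^+ j) *m B = 0) -> y = 0.

Section Data.
Variables (m p q n : nat) (A : 'M[CC]_n) (B1 : 'M[CC]_(n, p)) (B2 : 'M[CC]_(n, q))
  (Cm : 'M[CC]_(m, n)) (D1 : 'M[CC]_(m, p)) (D2 : 'M[CC]_(m, q)).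

Definition Gfun := realize D1 Cm A B1.
Definition Kfun := realize D2 Cm A B2.
(* R(zeta) = G(zeta) G(zeta)^H - K(zeta) K(zeta)^H on the unit circle
   (there G^H(zeta) = G(zeta)^H) *)
Definition Rfun (z : CC) : 'M[CC]_m :=
  Gfun z *m mxadj (Gfun z) - Kfun z *m mxadj (Kfun z).
Definition P1 := ctrl_gram A B1.
Definition P2 := ctrl_gram A B2.
Definition Gamma : 'M[CC]_(n, m) :=
  B1 *m mxadj D1 - B2 *m mxadj D2 + A *m (P1 - P2) *m mxadj Cm.

(* T_G T_G^H - T_K T_K^H >= 0 on ell^2_+(C^m):
   <(T_G T_G^H - T_K T_K^H) x, x> = ||T_G^H x||^2 - ||T_K^H x||^2 >= 0 *)
Definition toeplitz_diff_nonneg : Prop :=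
  forall x : nat -> 'cV[CC]_m, l2 x ->
  forall (u : nat -> 'cV[CC]_p) (v : nat -> 'cV[CC]_q),
    toeplitz_adj_is (rcoef D1 Cm A B1) x u ->
    toeplitz_adj_is (rcoef D2 Cm A B2) x v ->
    l2norm2 v <= l2norm2 u.

Definition cond_i : Prop := forall z : CC, `|z| = 1 -> psd (Rfun z).

Definition R_zero : Prop := forall z : CC, `|z| = 1 -> Rfun z = 0.

Definition Phicoef (r : nat) (DPhi : 'M[CC]_(r, m)) (CPhi : 'M[CC]_(r, n)) :=
  rcoef DPhi CPhi A Gamma.

Definition XPhi (r : nat) (DPhi : 'M[CC]_(r, m)) (CPhi : 'M[CC]_(r, n))
  (x : 'cV[CC]_n) : Prop :=
  exists y : nat -> 'cV[CC]_r, l2 y /\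
    toeplitz_adj_is (Phicoef DPhi CPhi) y (Wobs Cm A x).

(* (r, Phi(0) = DPhi, C_Phi = CPhi) is an admissible choice: Phi is an outer
   spectral factor of R (r <= m), and C_Phi satisfies W_obs x = T_Phi^H W_{Phi,obs} x
   on X_Phi. *)
Definition admissible (r : nat) (DPhi : 'M[CC]_(r, m)) (CPhi : 'M[CC]_(r, n)) : Prop :=
  [/\ (r <= m)%N,
      (forall z : CC, `|z| = 1 ->
         Rfun z = mxadj (realize DPhi CPhi A Gamma z) *m realize DPhi CPhi A Gamma z),
      dense_range (Phicoef DPhi CPhi) &
      (forall x, XPhi DPhi CPhi x ->
         toeplitz_adj_is (Phicoef DPhi CPhi) (Wobs CPhi A x) (Wobs Cm A x))].

(* E : 'M_(n,d) has orthonormal columns spanning X_Phi; it is the matrix of the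
   canonical embedding E_{X_Phi} (w.r.t. an orthonormal basis of X_Phi). *)
Definition onb_of (d : nat) (E : 'M[CC]_(n, d)) (X : 'cV[CC]_n -> Prop) : Prop :=
  mxadj E *m E = 1%:M /\
  (forall x : 'cV[CC]_n, X x <-> exists c : 'cV[CC]_d, x = E *m c).

Definition Delta (r : nat) (CPhi : 'M[CC]_(r, n)) (d : nat) (E : 'M[CC]_(n, d))
  : 'M[CC]_n :=
  E *m invmx (mxadj E *m obs_gram CPhi A *m E) *m mxadj E.

Definition cond_ii : Prop :=
  (R_zero -> psd (P2 - P1)) /\
  (~ R_zero ->
     forall (r : nat) (DPhi : 'M[CC]_(r, m)) (CPhi : 'M[CC]_(r, n)),
       admissible DPhi CPhi ->
       forall (d : nat) (E : 'M[CC]_(n, d)), onb_of E (XPhi DPhi CPhi) ->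
         psd (Delta CPhi E + P2 - P1)).

End Data.
End Defs.

(* Main.v *)
(* On finitely supported inputs h, write w = W_obs^* h and let tau h be the
   quadratic form of the Toeplitz operator T_R. The Lyapunov equations of the
   Gramians give |T_G^* h|^2 - |T_K^* h|^2 = tau h - w^*(P1 - P2)w, so the operator
   inequality says tau h >= w^*(P1 - P2)w. Positivity of R on the circle is
   equivalent to tau >= 0, by sampling at roots of unity in one direction and by
   exponential inputs in the other.

   The functional J(x, h) = 2 Re w^* x - tau h is the payoff of a linear-quadratic
   control problem. If tau >= 0, the states x with J(x, .) bounded form an
   A-invariant subspace containing Im Gamma; there the Riccati iteration increases
   to a matrix Q with sup_h J(x, h) = x^* Q x, and Q yields an outer factor Phi with
   Gramian Q and with that subspace as X_Phi. Evaluating J at x = Delta w gives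
   tau h >= w^* Delta w, hence sufficiency of (ii).

   Conversely, for any outer factor and any vector y, the infimum s of
   tau h = |T_Phi h|^2 over w = y is attained in the closure by some z orthogonal to
   T_Phi g whenever W_obs^* g = 0. Hence T_Phi^* z = W_obs x with x in X_Phi, y^* x = s and
   x^* Q x <= s, so that y^*(P1 - P2)y <= s <= y^* Delta y. *)
Require Import Defs.
From HB Require Import structures.
From mathcomp Require Import all_boot all_order all_algebra.
From mathcomp Require Import complex.
From mathcomp Require Import boolp classical_sets reals topology normedtype sequences.
From mathcomp Require Import cyclic separable cyclotomic ring lra.
Set Implicit Arguments.
Unset Strict Implicit.
Unset Printing Implicit Defensive.
Import Order.TTheory GRing.Theory Num.Theory.
Import numFieldTopology.Exports numFieldNormedType.Exports.
Local Open Scope classical_set_scope.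
Local Open Scope ring_scope.

(** The obstacle is that [R] may vanish or lose rank on the circle: [T_R] need not be invertible,
    [T_Phi] need not have closed range, and [sup_h J(x, h)] can be infinite for some states. Hence
    the passage to bounded states before the Riccati iteration, a Riccati equation with a possibly
    singular weight, and a closure in the projection argument. Condition (ii) quantifies over all
    admissible factors: sufficiency tests it on one factor built by hand, while necessity treats
    each admissible factor directly, density of its range serving to bound the Gramian by a minimal
    norm. Finitely supported inputs turn operators into finite recursions and identities into
    inductions; boundedness of the Toeplitz forms, itself deduced from positivity on the circle,
    carries the results over to square summable sequences. *)

Local Notation "M ^H" := (mxadj M) (at level 8, format "M ^H").

(** * Adjoints, real inner products and norms *)

Section Adjoint.
Variable R : realType.
Local Notation CC := R[i].

Lemma mxadjE a b (M : 'M[CC]_(a, b)) i j : M^H i j = Num.conj (M j i).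
Proof. by rewrite !mxE. Qed.

Lemma mxadjK a b (M : 'M[CC]_(a, b)) : M^H^H = M.
Proof. by apply/matrixP=> i j; rewrite !mxadjE conjCK. Qed.

Lemma mxadjD a b (M N : 'M[CC]_(a, b)) : (M + N)^H = M^H + N^H.
Proof. by apply/matrixP=> i j; rewrite !(mxadjE, mxE) rmorphD. Qed.

Lemma mxadjN a b (M : 'M[CC]_(a, b)) : (- M)^H = - M^H.
Proof. by apply/matrixP=> i j; rewrite !(mxadjE, mxE) rmorphN. Qed.

Lemma mxadjB a b (M N : 'M[CC]_(a, b)) : (M - N)^H = M^H - N^H.
Proof. by rewrite mxadjD mxadjN. Qed.

Lemma mxadjZ a b (c : CC) (M : 'M[CC]_(a, b)) :
  (c *: M)^H = Num.conj c *: M^H.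
Proof. by apply/matrixP=> i j; rewrite !(mxadjE, mxE) rmorphM. Qed.

Lemma mxadjM a b c (M : 'M[CC]_(a, b)) (N : 'M[CC]_(b, c)) :
  (M *m N)^H = N^H *m M^H.
Proof. by rewrite /mxadj trmx_mul map_mxM. Qed.

Lemma mxadj0 a b : (0 : 'M[CC]_(a, b))^H = 0.
Proof. by rewrite /mxadj trmx0 map_mx0. Qed.

Lemma mxadj1 a : (1%:M : 'M[CC]_a)^H = 1%:M.
Proof. by rewrite /mxadj trmx1 map_mx1. Qed.

Lemma mxadjX a (M : 'M[CC]_a) k : (M ^+ k)^H = M^H ^+ k.
Proof.
elim: k => [|k IH]; first by rewrite !expr0 mxadj1.
by rewrite exprS exprSr mxadjM IH.
Qed.

Lemma mxadj_inv a (M : 'M[CC]_a) : (invmx M)^H = invmx M^H.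
Proof. by rewrite /mxadj trmx_inv map_invmx. Qed.

Lemma mulmxB a b c (M : 'M[CC]_(a, b)) (u v : 'M[CC]_(b, c)) :
  M *m (u - v) = M *m u - M *m v.
Proof. exact: mulmxBr. Qed.

Lemma mulmxO a b c (M : 'M[CC]_(a, b)) (u : 'M[CC]_(b, c)) :
  M *m (- u) = - (M *m u).
Proof. exact: mulmxN. Qed.

Lemma mulmxZ a b c (z : CC) (M : 'M[CC]_(a, b)) (u : 'M[CC]_(b, c)) :
  M *m (z *: u) = z *: (M *m u).
Proof. by rewrite -scalemxAr. Qed.

Lemma mulZmx a b c (z : CC) (M : 'M[CC]_(a, b)) (u : 'M[CC]_(b, c)) :
  (z *: M) *m u = z *: (M *m u).
Proof. by rewrite -scalemxAl. Qed.

Lemma mulBmx a b c (M N : 'M[CC]_(a, b)) (u : 'M[CC]_(b, c)) :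
  (M - N) *m u = M *m u - N *m u.
Proof. exact: mulmxBl. Qed.

(** Hermitian forms and payoffs are real, so the underlying real inner product suffices and keeps
    every estimate within [ring] and [lra]; [rdot_adj] still moves complex matrices across. *)
Definition rdot k (u v : 'cV[CC]_k) : R := complex.Re ((u^H *m v) 0 0).

Lemma ReD (x y : CC) : complex.Re (x + y) = complex.Re x + complex.Re y.
Proof. by case: x y => [? ?] []. Qed.
Lemma ImD (x y : CC) : complex.Im (x + y) = complex.Im x + complex.Im y.
Proof. by case: x y => [? ?] []. Qed.
Lemma ReN (x : CC) : complex.Re (- x) = - complex.Re x.
Proof. by case: x. Qed.
Lemma ImN (x : CC) : complex.Im (- x) = - complex.Im x.
Proof. by case: x. Qed.
Lemma ReM (x y : CC) : complex.Re (x * y) =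
  complex.Re x * complex.Re y - complex.Im x * complex.Im y.
Proof. by case: x y => [? ?] []. Qed.
Lemma ImM (x y : CC) : complex.Im (x * y) =
  complex.Re x * complex.Im y + complex.Im x * complex.Re y.
Proof. by case: x y => [? ?] []. Qed.
Lemma Re_conj (x : CC) : complex.Re (Num.conj x) = complex.Re x.
Proof. by case: x. Qed.
Lemma Im_conj (x : CC) : complex.Im (Num.conj x) = - complex.Im x.
Proof. by case: x. Qed.
Lemma Re_sum I (r : seq I) (P : pred I) (F : I -> CC) :
  complex.Re (\sum_(i <- r | P i) F i) = \sum_(i <- r | P i) complex.Re (F i).
Proof. by apply: (big_morph _ ReD). Qed.
Lemma Im_sum I (r : seq I) (P : pred I) (F : I -> CC) :
  complex.Im (\sum_(i <- r | P i) F i) = \sum_(i <- r | P i) complex.Im (F i).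
Proof. by apply: (big_morph _ ImD). Qed.
Lemma eqC (x y : CC) :
  complex.Re x = complex.Re y -> complex.Im x = complex.Im y -> x = y.
Proof. by case: x y => [? ?] [? ?] /= -> ->. Qed.

Lemma rdotE k (u v : 'cV[CC]_k) :
  rdot u v = \sum_i complex.Re (Num.conj (u i 0) * v i 0).
Proof. by rewrite /rdot mxE Re_sum; apply: eq_bigr => i _; rewrite mxadjE. Qed.

Lemma rdotC k (u v : 'cV[CC]_k) : rdot u v = rdot v u.
Proof.
rewrite !rdotE; apply: eq_bigr => i _.
by rewrite !ReM !Re_conj !Im_conj; ring.
Qed.

Lemma rdotDl k (u v w : 'cV[CC]_k) : rdot (u + v) w = rdot u w + rdot v w.
Proof. by rewrite /rdot mxadjD mulmxDl mxE ReD. Qed.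
Lemma rdotDr k (u v w : 'cV[CC]_k) : rdot w (u + v) = rdot w u + rdot w v.
Proof. by rewrite /rdot mulmxDr mxE ReD. Qed.
Lemma rdotNl k (u w : 'cV[CC]_k) : rdot (- u) w = - rdot u w.
Proof. by rewrite /rdot mxadjN mulNmx mxE ReN. Qed.
Lemma rdotNr k (u w : 'cV[CC]_k) : rdot w (- u) = - rdot w u.
Proof. by rewrite /rdot mulmxN mxE ReN. Qed.
Lemma rdot0l k (w : 'cV[CC]_k) : rdot 0 w = 0.
Proof. by rewrite /rdot mxadj0 mul0mx mxE. Qed.
Lemma rdot0r k (w : 'cV[CC]_k) : rdot w 0 = 0.
Proof. by rewrite /rdot mulmx0 mxE. Qed.
Lemma rdotZr k (t : R) (u w : 'cV[CC]_k) :
  rdot w (real_complex R t *: u) = t * rdot w u.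
Proof. by rewrite /rdot -scalemxAr mxE ReM /= mul0r subr0. Qed.
Lemma rdotZl k (t : R) (u w : 'cV[CC]_k) :
  rdot (real_complex R t *: u) w = t * rdot u w.
Proof. by rewrite rdotC rdotZr rdotC. Qed.

Lemma rdotZZ k (c : CC) (u v : 'cV[CC]_k) :
  rdot (c *: u) (c *: v) = cabs2 c * rdot u v.
Proof.
rewrite /rdot mxadjZ -scalemxAl -scalemxAr scalerA mxE mulrC ReM.
have -> : Num.conj c * c = real_complex R (cabs2 c).
  by apply: eqC; rewrite ?ReM ?ImM Re_conj Im_conj /=; rewrite /cabs2; ring.
by rewrite /= mulr0 subr0 mulrC.
Qed.

Definition rdotlin := (rdotDl, rdotDr, rdotNl, rdotNr, rdotZl, rdotZr).

Lemma rdot_adj a b (M : 'M[CC]_(a, b)) u v :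
  rdot u (M *m v) = rdot (M^H *m u) v.
Proof. by rewrite /rdot mxadjM mxadjK mulmxA. Qed.

Lemma rdot_adjl a b (M : 'M[CC]_(a, b)) u v :
  rdot (M *m v) u = rdot v (M^H *m u).
Proof. by rewrite rdot_adj mxadjK. Qed.

Lemma rdot_unit k (c : CC) (u v : 'cV[CC]_k) :
  `|c| = 1 -> rdot (c *: u) (c *: v) = rdot u v.
Proof.
move=> c1; rewrite /rdot mxadjZ -scalemxAl -scalemxAr scalerA mulrC.
by rewrite -normCK c1 expr1n scale1r.
Qed.

Lemma vnorm2E k (v : 'cV[CC]_k) : vnorm2 v = rdot v v.
Proof.
rewrite rdotE; apply: eq_bigr => i _.
by rewrite /cabs2 ReM Re_conj Im_conj; ring.
Qed.

Lemma cabs2_ge0 (z : CC) : 0 <= cabs2 z.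
Proof. by rewrite addr_ge0 ?sqr_ge0. Qed.

Lemma rdot_ge0 k (v : 'cV[CC]_k) : 0 <= rdot v v.
Proof. by rewrite -vnorm2E sumr_ge0 // => i _; apply: cabs2_ge0. Qed.

Lemma vnorm2_ge0 k (v : 'cV[CC]_k) : 0 <= vnorm2 v.
Proof. by rewrite vnorm2E rdot_ge0. Qed.

Lemma rdot_eq0 k (v : 'cV[CC]_k) : rdot v v = 0 -> v = 0.
Proof.
rewrite -vnorm2E => /eqP; rewrite psumr_eq0 => [|i _]; last exact: cabs2_ge0.
move=> /allP v0; apply/matrixP => i j; rewrite ord1 mxE.
have := v0 i; rewrite mem_index_enum => /(_ isT) /implyP /(_ isT).
rewrite /cabs2 paddr_eq0 ?sqr_ge0 // !sqrf_eq0 => /andP[/eqP a /eqP b].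
by apply: eqC.
Qed.

Lemma rdot_inj k (u v : 'cV[CC]_k) : (forall h, rdot h u = rdot h v) -> u = v.
Proof.
move=> uv; apply/eqP; rewrite -subr_eq0; apply/eqP/rdot_eq0.
by rewrite !rdotlin !uv; ring.
Qed.

Lemma rdot_sub_sqr k (u v : 'cV[CC]_k) : 2 * rdot u v <= rdot u u + rdot v v.
Proof.
have := rdot_ge0 (u - v); rewrite !rdotlin (rdotC v u); lra.
Qed.

Definition herm k (M : 'M[CC]_k) := M^H = M.

Lemma rdot_herm k (M : 'M[CC]_k) u v :
  herm M -> rdot u (M *m v) = rdot v (M *m u).
Proof. by move=> hM; rewrite rdot_adj hM rdotC. Qed.

Lemma herm_rdot_eq0 k (M : 'M[CC]_k) :
  herm M -> (forall v, rdot v (M *m v) = 0) -> M = 0.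
Proof.
(* Polarisation with [u + v] alone suffices: for Hermitian [M] the two real cross terms coincide. *)
move=> hM M0; have pol u v : rdot u (M *m v) = 0.
  have := M0 (u + v); rewrite mulmxDr !rdotlin !M0 (rdot_herm v u hM); lra.
have Mv0 (v : 'cV_k) : M *m v = 0.
  by apply: rdot_inj => h; rewrite pol rdot0r.
apply/matrixP => i j; have /matrixP/(_ i 0) := Mv0 (delta_mx j 0).
by rewrite -colE !mxE.
Qed.

Lemma herm_ext k (M N : 'M[CC]_k) : herm M -> herm N ->
  (forall v, rdot v (M *m v) = rdot v (N *m v)) -> M = N.
Proof.
move=> hM hN e; apply/eqP; rewrite -subr_eq0; apply/eqP/herm_rdot_eq0.
  by rewrite /herm mxadjB hM hN.
by move=> v; rewrite mulmxBl !rdotlin e; lra.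
Qed.

(** The order on [R[i]] also demands a zero imaginary part; this is where [herm M] is used. *)
Lemma psdP k (M : 'M[CC]_k) : herm M ->
  psd M <-> (forall v, 0 <= rdot v (M *m v)).
Proof.
move=> hM; split=> [p v | p v].
  by have := p v; rewrite lecE => /andP[_]; rewrite /rdot mulmxA.
rewrite lecE; apply/andP; split; last by have := p v; rewrite /rdot mulmxA.
have : (v^H *m M *m v)^H = v^H *m M *m v.
  by rewrite !mxadjM mxadjK hM mulmxA.
move=> /matrixP/(_ 0 0); rewrite mxadjE => /(congr1 (@complex.Im R)).
by rewrite Im_conj => e; apply/eqP => /=; lra.
Qed.

Lemma hermD k (M N : 'M[CC]_k) : herm M -> herm N -> herm (M + N).
Proof. by rewrite /herm mxadjD => -> ->. Qed.
Lemma hermN k (M : 'M[CC]_k) : herm M -> herm (- M).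
Proof. by rewrite /herm mxadjN => ->. Qed.
Lemma hermB k (M N : 'M[CC]_k) : herm M -> herm N -> herm (M - N).
Proof. by move=> a b; apply: hermD => //; apply: hermN. Qed.
Lemma herm_conj k l (M : 'M[CC]_k) (N : 'M[CC]_(k, l)) :
  herm M -> herm (N^H *m M *m N).
Proof. by rewrite /herm !mxadjM mxadjK mulmxA => ->. Qed.
Lemma herm_conjr k l (M : 'M[CC]_k) (N : 'M[CC]_(l, k)) :
  herm M -> herm (N *m M *m N^H).
Proof. by rewrite /herm !mxadjM mxadjK mulmxA => ->. Qed.
Lemma herm_sq k l (N : 'M[CC]_(l, k)) : herm (N^H *m N).
Proof. by rewrite /herm !mxadjM mxadjK. Qed.
Lemma herm_sqr k l (N : 'M[CC]_(l, k)) : herm (N *m N^H).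
Proof. by rewrite /herm !mxadjM mxadjK. Qed.

Definition nrmc (z : CC) : R := complex.Re `|z|.

Lemma nrmcE z : `|z| = real_complex R (nrmc z).
Proof. by apply: eqC => //=; apply: ger0_Im. Qed.
Lemma nrmc_ge0 z : 0 <= nrmc z.
Proof. by have := normr_ge0 z; rewrite lecE => /andP[]. Qed.
Lemma nrmcM x y : nrmc (x * y) = nrmc x * nrmc y.
Proof. by rewrite /nrmc normrM nrmcE (nrmcE y) /= mulr0 subr0. Qed.
Lemma nrmcD x y : nrmc (x + y) <= nrmc x + nrmc y.
Proof. by have := ler_normD x y; rewrite lecE ReD => /andP[]. Qed.
Lemma nrmc0 : nrmc 0 = 0.
Proof. by rewrite /nrmc normr0. Qed.
Lemma nrmc1 z : `|z| = 1 -> nrmc z = 1.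
Proof. by rewrite /nrmc => ->. Qed.
Lemma nrmcJ z : nrmc (Num.conj z) = nrmc z.
Proof. by rewrite /nrmc norm_conjC. Qed.
Lemma nrmc_sqr z : nrmc z ^+ 2 = cabs2 z.
Proof.
rewrite /cabs2; apply: (@complexI R).
by rewrite add_Re2_Im2 nrmcE -rmorphXn.
Qed.
Lemma Re_le_nrmc z : `|complex.Re z| <= nrmc z.
Proof.
rewrite -(@ler_pXn2r _ 2) ?nnegrE ?normr_ge0 ?nrmc_ge0 //.
by rewrite nrmc_sqr real_normK ?num_real // lerDl sqr_ge0.
Qed.
Lemma Im_le_nrmc z : `|complex.Im z| <= nrmc z.
Proof.
rewrite -(@ler_pXn2r _ 2) ?nnegrE ?normr_ge0 ?nrmc_ge0 //.
by rewrite nrmc_sqr real_normK ?num_real // lerDr sqr_ge0.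
Qed.

(** The entrywise sum is submultiplicative for rectangular products and invariant under [^H]; it
    serves for convergence estimates, while sharp inequalities go through [vnorm2]. *)
Definition nrm a b (M : 'M[CC]_(a, b)) : R := \sum_i \sum_j nrmc (M i j).

Lemma nrm_ge0 a b (M : 'M[CC]_(a, b)) : 0 <= nrm M.
Proof. by apply: sumr_ge0 => i _; apply: sumr_ge0 => j _; apply: nrmc_ge0. Qed.
Lemma nrm0 a b : nrm (0 : 'M[CC]_(a, b)) = 0.
Proof.
by rewrite /nrm big1 // => i _; rewrite big1 // => j _; rewrite mxE nrmc0.
Qed.
Lemma nrmD a b (M N : 'M[CC]_(a, b)) : nrm (M + N) <= nrm M + nrm N.
Proof.
rewrite /nrm -big_split; apply: ler_sum => i _.
by rewrite -big_split; apply: ler_sum => j _; rewrite mxE nrmcD.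
Qed.
Lemma nrmZ a b c (M : 'M[CC]_(a, b)) : nrm (c *: M) = nrmc c * nrm M.
Proof.
rewrite /nrm mulr_sumr; apply: eq_bigr => i _; rewrite mulr_sumr.
by apply: eq_bigr => j _; rewrite mxE nrmcM.
Qed.
Lemma nrm_adj a b (M : 'M[CC]_(a, b)) : nrm M^H = nrm M.
Proof.
rewrite /nrm exchange_big; apply: eq_bigr => i _; apply: eq_bigr => j _.
by rewrite mxadjE nrmcJ.
Qed.
Lemma nrmc_sum I (r : seq I) (F : I -> CC) :
  nrmc (\sum_(i <- r) F i) <= \sum_(i <- r) nrmc (F i).
Proof.
elim/big_ind2: _ => [|x1 x2 y1 y2 h1 h2|//]; first by rewrite nrmc0.
by apply: le_trans (nrmcD _ _) _; apply: lerD.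
Qed.
Lemma nrm_sum a b I (r : seq I) (F : I -> 'M[CC]_(a, b)) :
  nrm (\sum_(i <- r) F i) <= \sum_(i <- r) nrm (F i).
Proof.
elim/big_ind2: _ => [|x1 x2 y1 y2 h1 h2|//]; first by rewrite nrm0.
by apply: le_trans (nrmD _ _) _; apply: lerD.
Qed.
Lemma entry_le_nrm a b (M : 'M[CC]_(a, b)) i j : nrmc (M i j) <= nrm M.
Proof.
rewrite /nrm (bigD1 i) //= (bigD1 j) //= -addrA lerDl addr_ge0 //.
  by apply: sumr_ge0 => *; apply: nrmc_ge0.
by apply: sumr_ge0 => *; apply: sumr_ge0 => *; apply: nrmc_ge0.
Qed.
Lemma nrmM a b c (M : 'M[CC]_(a, b)) (N : 'M[CC]_(b, c)) :
  nrm (M *m N) <= nrm M * nrm N.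
Proof.
rewrite /nrm mulr_suml; apply: ler_sum => i _.
have le1 j : nrmc ((M *m N) i j) <= \sum_k nrmc (M i k) * nrmc (N k j).
  rewrite mxE; apply: le_trans (nrmc_sum _ _) _.
  by apply: ler_sum => k _; rewrite nrmcM.
apply: le_trans (ler_sum _ (fun j _ => le1 j)) _.
rewrite exchange_big mulr_suml; apply: ler_sum => k _.
rewrite -mulr_sumr; apply: ler_wpM2l; first exact: nrmc_ge0.
rewrite (bigD1 k) //= lerDl.
by apply: sumr_ge0 => *; apply: sumr_ge0 => *; apply: nrmc_ge0.
Qed.
Lemma rdot_le_nrm k (u v : 'cV[CC]_k) : `|rdot u v| <= nrm u * nrm v.
Proof.
apply: le_trans (Re_le_nrmc _) _; apply: le_trans (entry_le_nrm _ _ _) _.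
by apply: le_trans (nrmM _ _) _; rewrite nrm_adj.
Qed.

End Adjoint.

(** * Orthonormal bases, square roots and bounded quadratic functions *)

Section LinearAlgebra.
Variable R : realType.
Local Notation CC := R[i].

Definition subspace k (X : 'cV[CC]_k -> Prop) :=
  X 0 /\ forall (a : CC) x y, X x -> X y -> X (a *: x + y).

(** A maximal orthonormal family inside [X] spans it, since the normalised residual of a missed
    vector could be appended; ranks bound the size of such families by [k]. *)
Lemma orthonormal_basis k (X : 'cV[CC]_k -> Prop) : subspace X ->
  exists d (E : 'M[CC]_(k, d)), (d <= k)%N /\ onb_of E X.
Proof.
move=> [X0 Xlin].
pose P d := `[< exists E : 'M[CC]_(k, d), E^H *m E = 1%:M /\
  forall c : 'cV_d, X (E *m c) >].
have P0 : exists d, P d.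
  exists 0; apply/asboolP; exists 0; split.
    by apply/matrixP => -[].
  by move=> c; rewrite mul0mx.
have Ple d : P d -> (d <= k)%N.
  move=> /asboolP[E [EE _]]; rewrite -(mxrank1 CC d) -EE.
  by apply: leq_trans (mxrankM_maxl _ _) _; apply: rank_leq_col.
case: (ex_maxnP P0 Ple) => d Pd dmax; have dk := Ple _ Pd.
move: Pd => /asboolP[E [EE XE]].
exists d, E; split=> //; split=> // x; split=> [Xx|[c ->]//].
exists (E^H *m x); apply/eqP; rewrite -subr_eq0; apply/negPn/negP => ne0.
set e := x - _ in ne0.
have Xe : X e.
  rewrite /e addrC -scaleN1r; apply: Xlin => //.
have Ee : E^H *m e = 0 by rewrite /e mulmxBr !mulmxA EE mul1mx subrr.
have e_gt0 : 0 < rdot e e.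
  rewrite lt_neqAle rdot_ge0 andbT; apply/eqP => /esym/rdot_eq0 e0.
  by rewrite e0 eqxx in ne0.
have eeE : e^H *m e = (real_complex R (rdot e e))%:M.
  apply/matrixP => i j; rewrite !ord1 [RHS]mxE eqxx mulr1n.
  apply: eqC => //=; have /matrixP/(_ 0 0) : (e^H *m e)^H = e^H *m e.
    by rewrite mxadjM mxadjK.
  by rewrite mxadjE => /(congr1 (@complex.Im R)); rewrite Im_conj => h; lra.
pose c := real_complex R (Num.sqrt (rdot e e))^-1.
pose E' : 'M_(k, d + 1) := row_mx E (c *: e).
suff : (d + 1 <= d)%N by rewrite addn1 ltnn.
apply: dmax; apply/asboolP; exists E'; split; last first.
  move=> v; rewrite -[v]vsubmxK mul_row_col addrC -scalemxAl.
  rewrite [dsubmx v]mx11_scalar mul_mx_scalar scalerA; exact: Xlin.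
have -> : E'^H = col_mx E^H (c *: e)^H by rewrite /mxadj tr_row_mx map_col_mx.
rewrite mul_col_row EE -scalemxAr Ee scaler0.
have -> : (c *: e)^H *m E = 0.
  have /(congr1 (@mxadj R _ _)) : E^H *m (c *: e) = 0.
    by rewrite -scalemxAr Ee scaler0.
  by rewrite mxadjM mxadjK mxadj0.
rewrite mxadjZ -scalemxAl -scalemxAr scalerA eeE.
suff -> : (Num.conj c * c) *: (real_complex R (rdot e e))%:M = 1%:M :> 'M[CC]_1.
  by rewrite -scalar_mx_block.
rewrite scale_scalar_mx; congr (_ %:M); apply: eqC; rewrite /c /=; last by ring.
rewrite !(mulr0, oppr0, mul0r, subr0, addr0) -invfM -expr2 sqr_sqrtr ?ltW //.
by rewrite mulVf // gt_eqF.
Qed.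

Lemma ortho_decomp k (X : 'cV[CC]_k -> Prop) v : subspace X ->
  exists2 e, X e & forall x, X x -> rdot x (v - e) = 0.
Proof.
move=> /orthonormal_basis[d [E [_ [EE XE]]]].
exists (E *m (E^H *m v)); first by apply/XE; eexists.
move=> x /XE[c ->]; rewrite rdot_adjl mulmxBr (mulmxA E^H E) EE mul1mx subrr.
exact: rdot0r.
Qed.

Lemma mulmx_choose a b c (M : 'M[CC]_(a, b)) (N : 'M[CC]_(a, c)) :
  (forall x : 'cV[CC]_c, exists e, N *m x = M *m e) -> exists S, N = M *m S.
Proof.
move=> h; have /choice[f fE] : forall j : 'I_c, exists e, col j N = M *m e.
  by move=> j; have [e] := h (delta_mx j 0); rewrite -colE => ?; exists e.
exists (\matrix_(i, j) f j i 0); apply/matrixP => i j.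
have /matrixP/(_ i 0) := fE j; rewrite !mxE => ->.
by apply: eq_bigr => l _; rewrite mxE.
Qed.

Lemma psd_factor k (M : 'M[CC]_k) : herm M ->
  (forall v, 0 <= rdot v (M *m v)) -> exists D : 'M[CC]_k, M = D^H *m D.
Proof.
move=> hM pM.
have nM : M \is spectral.normalmx.
  by apply/spectral.normalmxP; rewrite -/(mxadj M) hM.
have /spectral.orthomx_spectralP := nM.
set P := spectral.spectralmx M; set sp := spectral.spectral_diag M => ME.
have uP : P \is spectral.unitarymx by apply: spectral.spectral_unitarymx.
have PP : P *m P^H = 1%:M by apply/spectral.unitarymxP.
have MP : M = P^H *m diag_mx sp *m P.
  by rewrite {1}ME spectral.invmx_unitary.
have sp_ge0 i : 0 <= sp 0 i.
  have /(psdP hM)/(_ (P^H *m delta_mx i 0)) := pM.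
  rewrite MP mxadjM mxadjK.
  rewrite !mulmxA -(mulmxA _ P P^H) PP mulmx1.
  rewrite -!mulmxA (mulmxA P P^H) PP mul1mx -colE.
  by rewrite mxE (bigD1 i) //= big1 => [|j ji]; rewrite !mxE ?eqxx ?(negPf ji)
    ?mulr1n ?conjC1 ?conjC0 ?mul1r ?mul0r ?addr0.
exists (diag_mx (\row_i sqrtC (sp 0 i)) *m P).
rewrite MP mxadjM !mulmxA; congr (_ *m _); rewrite -mulmxA; congr (_ *m _).
apply/matrixP => i j.
rewrite mul_mx_diag !mxE; case: (eqVneq j i) => [->|ji]; last first.
  by rewrite !mulr0n conjC0 mul0r.
rewrite !mulr1n conj_Creal ?ger0_real ?sqrtC_ge0 //.
by rewrite -expr2 sqrtCK.
Qed.

(** The square root is compressed to its range. Surjectivity of [D] is what later makes the spectral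
    factor outer: the first entry of [T_Phi f] can be prescribed. *)
Lemma psd_factor_onto k (M : 'M[CC]_k) : herm M ->
  (forall v, 0 <= rdot v (M *m v)) ->
  exists r (D : 'M[CC]_(r, k)), [/\ (r <= k)%N, M = D^H *m D &
    forall c : 'cV[CC]_r, exists v, c = D *m v].
Proof.
move=> hM /(psd_factor hM)[D MD].
have [|r [E [rk [EE XE]]]] := @orthonormal_basis k (fun x => exists v, x = D *m v).
  split; first by exists 0; rewrite mulmx0.
  move=> a _ _ [v ->] [w ->]; exists (a *: v + w).
  by rewrite mulmxDr scalemxAr.
have EED : E *m (E^H *m D) = D.
  apply/matrixP => i j.
  have [c cE] : exists c, D *m (delta_mx j 0 : 'cV_k) = E *m c.
    by apply/XE; exists (delta_mx j 0).
  have : E *m (E^H *m D) *m delta_mx j 0 = D *m delta_mx j 0 :> 'cV_k.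
    by rewrite -!mulmxA cE (mulmxA E^H) EE mul1mx.
  by rewrite -!colE => /matrixP/(_ i 0); rewrite [LHS]mxE [RHS]mxE => ->.
exists r, (E^H *m D); split=> //.
  by rewrite mxadjM mxadjK -mulmxA EED.
move=> c; have /XE[v vE] : exists c', E *m c = E *m c' by exists c.
by exists v; rewrite -mulmxA -vE mulmxA EE mul1mx.
Qed.

Lemma eq0_of_linear_bound (a c : R) : (forall t : R, t * a <= c) -> a = 0.
Proof.
move=> h; apply/eqP/negPn/negP => a0.
have := h ((c + 1) / a); rewrite -mulrA mulVf //; lra.
Qed.

(** On each line through 0 the bound concerns a real quadratic polynomial: its leading coefficient
    cannot be positive, and along the kernel of [M] the linear term must vanish. So [v] is
    orthogonal to the kernel, that is, in the range. *)
Lemma quad_bounded k (M : 'M[CC]_k) (v : 'cV[CC]_k) (c : R) : herm M ->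
  (forall u, 2 * rdot u v - rdot u (M *m u) <= c) ->
  (forall u, 0 <= rdot u (M *m u)) /\ exists e, v = M *m e.
Proof.
move=> hM h.
have ht u (t : R) : 2 * t * rdot u v - t ^+ 2 * rdot u (M *m u) <= c.
  have := h (real_complex R t *: u); rewrite -scalemxAr !rdotlin.
  by rewrite expr2 !mulrA.
split.
  move=> u; rewrite leNgt; apply/negP => neg.
  have neg' : 0 < - rdot u (M *m u) by rewrite oppr_gt0.
  suff /eqP : - rdot u (M *m u) = 0 by rewrite oppr_eq0; apply/negP; rewrite lt_eqF.
  apply: (@eq0_of_linear_bound _ ((c - rdot u (M *m u)) / 2)) => t.
  (* Adding the bounds at [t] and [- t] cancels the linear term; [(t - 1)^2 >= 0] then trades [t^2]
     for [t], as [eq0_of_linear_bound] requires. *)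
  have := mulr_ge0 (ltW neg' : 0 <= - rdot u (M *m u)) (sqr_ge0 (t - 1)).
  rewrite (_ : _ * (t - 1) ^+ 2 = - rdot u (M *m u) * t ^+ 2
     + 2 * (t * rdot u (M *m u)) - rdot u (M *m u)); last ring.
  by have := ht u t; have := ht u (- t); rewrite sqrrN; lra.
have [|e [w eE] eo] := @ortho_decomp k (fun x => exists w, x = M *m w) v.
  split; first by exists 0; rewrite mulmx0.
  move=> a _ _ [x ->] [y ->]; exists (a *: x + y).
  by rewrite mulmxDr scalemxAr.
set d := v - e in eo.
have Md : M *m d = 0.
  apply: rdot_eq0; rewrite rdot_adjl hM.
  by rewrite rdotC; apply: eo; eexists.
have dv : rdot d v = 0.
  apply: (@eq0_of_linear_bound _ (c / 2)) => t.
  by have := ht d t; rewrite Md rdot0r; lra.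
have : rdot d d = 0.
  rewrite {2}/d rdotDr rdotNr dv (rdotC d e) eo ?subrr //; by exists w.
by move/rdot_eq0/eqP; rewrite subr_eq0 => /eqP ->; exists w.
Qed.

End LinearAlgebra.

(** * Limits and Gramians *)

Section Limits.
Variable R : realType.
Local Notation CC := R[i].

Lemma cvgnP (u : nat -> R) (l : R) : u @ \oo --> l <->
  forall e, 0 < e -> exists N, forall k, (N <= k)%N -> `|u k - l| <= e.
Proof.
split=> [/cvgrPdist_le h e e0|h].
  have [N _ hN] := h e e0; exists N => k Nk.
  by rewrite distrC; apply: hN.
apply/cvgrPdist_le => e e0; have [N hN] := h e e0.
by exists N => // k /= Nk; rewrite distrC; apply: hN.
Qed.

Lemma cvgn_dom (u e : nat -> R) (l c : R) :
  (forall k, `|u k - l| <= c * e k) -> e @ \oo --> (0 : R) -> u @ \oo --> l.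
Proof.
move=> h /cvgnP e0; apply/cvgnP => eps eps0.
have c0 : 0 < `|c| + 1 by rewrite ltr_wpDl.
have [|N hN] := e0 (eps / (`|c| + 1)); first by rewrite divr_gt0.
exists N => k /hN; rewrite subr0 => ek; apply: le_trans (h k) _.
apply: le_trans (ler_norm _) _; rewrite normrM.
apply: le_trans (_ : (`|c| + 1) * (eps / (`|c| + 1)) <= _); last first.
  by rewrite mulrCA divff ?mulr1 // gt_eqF.
by apply: ler_pM => //; lra.
Qed.

Lemma cvgn_le (u v : nat -> R) (l l' : R) N : u @ \oo --> l -> v @ \oo --> l' ->
  (forall k, (N <= k)%N -> u k <= v k) -> l <= l'.
Proof. by move=> ul vl h; apply: (ler_cvg_to ul vl); exists N. Qed.

Lemma cvgn_uniq (u : nat -> R) (l l' : R) :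
  u @ \oo --> l -> u @ \oo --> l' -> l = l'.
Proof. by move=> ul ul'; apply/eqP; rewrite eq_le !(cvgn_le (N := 0) ul ul', cvgn_le (N := 0) ul' ul). Qed.

Lemma cvgn_lim (u : nat -> R) (l : R) : u @ \oo --> l -> limn u = l.
Proof. by move=> h; apply/cvg_lim. Qed.

Lemma cvgn_mono (u : nat -> R) (c : R) :
  (forall k, u k <= u k.+1) -> (forall k, u k <= c) -> exists l : R, u @ \oo --> l.
Proof.
move=> h hc; exists (limn u); apply: nondecreasing_is_cvgn.
  by apply: homo_leq => // ? ? ?; apply: le_trans.
by exists c => _ [k _ <-].
Qed.

Lemma cvgn_mono_le (u : nat -> R) (l : R) :
  (forall k, u k <= u k.+1) -> u @ \oo --> l -> forall k, u k <= l.
Proof.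
move=> h ul k; apply: (cvgn_le (N := k) (u := fun=> u k) _ ul); first exact: cvg_cst.
have /(_ k) hu : {homo u : i j / (i <= j)%N >-> i <= j}.
  by apply: homo_leq => // ? ? ?; apply: le_trans.
exact: hu.
Qed.

Lemma cvgnS (u : nat -> R) (l : R) :
  (fun k => u k.+1) @ \oo --> l <-> u @ \oo --> l.
Proof. by rewrite -[X in _ <-> X]cvg_shiftS. Qed.

Lemma cvgnDn (u : nat -> R) (l : R) N :
  (fun k => u (N + k)%N) @ \oo --> l <-> u @ \oo --> l.
Proof.
elim: N u => [u|N IH u] //.
exact: iff_trans (IH (fun k => u k.+1)) (cvgnS u l).
Qed.

Lemma cvgn_sum (I : Type) (r : seq I) (F : I -> nat -> R) (l : I -> R) :
  (forall i, F i @ \oo --> l i) ->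
  (fun k => \sum_(i <- r) F i k) @ \oo --> \sum_(i <- r) l i.
Proof.
move=> h; elim: r => [|i r IH].
  under eq_fun do rewrite big_nil; rewrite big_nil; exact: cvg_cst.
under eq_fun do rewrite big_cons; rewrite big_cons; exact: cvgD.
Qed.

Lemma cvg_series_of_bound (u : nat -> R) (c : R) : (forall k, 0 <= u k) ->
  (forall K, \sum_(k < K) u k <= c) -> exists l : R, series u @ \oo --> l.
Proof.
move=> u0 uc; apply: (@cvgn_mono _ c) => k; last by rewrite /series /= big_mkord.
by rewrite seriesSr lerDl.
Qed.

Lemma cvg_series_abs (u v : nat -> R) (c : R) : (forall k, `|u k| <= v k) ->
  (forall K, \sum_(k < K) v k <= c) -> exists l : R, series u @ \oo --> l.
Proof.
move=> uv vc; exists (limn (series u)); apply: normed_cvg.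
apply: (@series_le_cvg _ (fun k => `|u k|) v) => [k|k|k|] //.
  exact: le_trans (uv k).
by have [l hl] := cvg_series_of_bound (fun k => le_trans (normr_ge0 _) (uv k)) vc; apply: cvgP hl.
Qed.

Definition mxlim a b (F : nat -> 'M[CC]_(a, b)) (L : 'M[CC]_(a, b)) :=
  (fun k => nrm (F k - L)) @ \oo --> (0 : R).

Lemma mxlim_dom a b (F : nat -> 'M[CC]_(a, b)) L (e : nat -> R) c :
  (forall k, nrm (F k - L) <= c * e k) -> e @ \oo --> (0 : R) -> mxlim F L.
Proof.
by move=> h; apply: cvgn_dom => k; rewrite subr0 ger0_norm ?nrm_ge0 //; apply: h.
Qed.

Lemma mxlimMl a b c (M : 'M[CC]_(a, b)) (F : nat -> 'M[CC]_(b, c)) L :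
  mxlim F L -> mxlim (fun k => M *m F k) (M *m L).
Proof. by move=> h; apply: (mxlim_dom (c := nrm M)) h => k; rewrite -mulmxBr nrmM. Qed.

Lemma mxlimMr a b c (M : 'M[CC]_(b, c)) (F : nat -> 'M[CC]_(a, b)) L :
  mxlim F L -> mxlim (fun k => F k *m M) (L *m M).
Proof. by move=> h; apply: (mxlim_dom (c := nrm M)) h => k; rewrite -mulmxBl mulrC nrmM. Qed.

Lemma mxlimDl a b (M : 'M[CC]_(a, b)) (F : nat -> 'M[CC]_(a, b)) L :
  mxlim F L -> mxlim (fun k => M + F k) (M + L).
Proof.
move=> h; apply: (mxlim_dom (c := 1)) h => k.
by rewrite opprD addrACA subrr add0r mul1r.
Qed.

Lemma mxlimS a b (F : nat -> 'M[CC]_(a, b)) L :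
  mxlim (fun k => F k.+1) L <-> mxlim F L.
Proof. exact: (cvgnS (fun k => nrm (F k - L))). Qed.

Lemma mxlim_rdot k l (F : nat -> 'M[CC]_(k, l)) L (u : 'cV[CC]_k) v :
  mxlim F L -> (fun n => rdot u (F n *m v)) @ \oo --> rdot u (L *m v).
Proof.
move=> h; apply: (cvgn_dom (c := nrm u * nrm v)) h => j.
rewrite -rdotNr -rdotDr -mulmxBl; apply: le_trans (rdot_le_nrm _ _) _.
rewrite -mulrA; apply: ler_wpM2l; first exact: nrm_ge0.
by rewrite mulrC nrmM.
Qed.

Lemma mxlim_uniq a b (F : nat -> 'M[CC]_(a, b)) L L' :
  mxlim F L -> mxlim F L' -> L = L'.
Proof.
move=> h h'; apply/matrixP => i j.
have e (v : 'cV_b) : L *m v = L' *m v.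
  apply: rdot_inj => u; by apply: (@cvgn_uniq (fun n => rdot u (F n *m v))); apply: mxlim_rdot.
by have /matrixP/(_ i 0) := e (delta_mx j 0); rewrite -!colE !mxE.
Qed.

Lemma mxlim_Re a b (F : nat -> 'M[CC]_(a, b)) L i j : mxlim F L ->
  (fun k => complex.Re (F k i j)) @ \oo --> complex.Re (L i j).
Proof.
move=> h; apply: (cvgn_dom (c := 1)) h => k; rewrite mul1r -ReN -ReD.
apply: le_trans (Re_le_nrmc _) _.
by apply: le_trans (entry_le_nrm _ i j); rewrite !mxE.
Qed.

Lemma mxlim_Im a b (F : nat -> 'M[CC]_(a, b)) L i j : mxlim F L ->
  (fun k => complex.Im (F k i j)) @ \oo --> complex.Im (L i j).
Proof.
move=> h; apply: (cvgn_dom (c := 1)) h => k; rewrite mul1r -ImN -ImD.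
apply: le_trans (Im_le_nrmc _) _.
by apply: le_trans (entry_le_nrm _ i j); rewrite !mxE.
Qed.

Lemma nrmc_le z : nrmc z <= `|complex.Re z| + `|complex.Im z| :> R.
Proof.
rewrite -(@ler_pXn2r _ 2) ?nnegrE ?nrmc_ge0 ?addr_ge0 // nrmc_sqr /cabs2.
set x := complex.Re z; set y := complex.Im z.
have := mulr_ge0 (normr_ge0 x) (normr_ge0 y).
rewrite sqrrD !real_normK ?num_real // -mulr_natr; lra.
Qed.

Lemma mxlim_entries a b (F : nat -> 'M[CC]_(a, b)) (L : 'M[CC]_(a, b)) :
  (forall i j, (fun k => complex.Re (F k i j)) @ \oo --> complex.Re (L i j)) ->
  (forall i j, (fun k => complex.Im (F k i j)) @ \oo --> complex.Im (L i j)) ->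
  mxlim F L.
Proof.
move=> hRe hIm.
pose e k := \sum_i \sum_j (`|complex.Re (F k i j) - complex.Re (L i j)| +
  `|complex.Im (F k i j) - complex.Im (L i j)|).
apply: (@mxlim_dom _ _ _ _ e 1) => [k|].
  rewrite mul1r; apply: ler_sum => i _; apply: ler_sum => j _.
  apply: le_trans (nrmc_le _) _.
  by rewrite !mxE ReD ReN ImD ImN.
have nc (u : nat -> R) (l : R) :
  u @ \oo --> l -> (fun k => `|u k - l|) @ \oo --> (0 : R).
  by move=> /cvgnP h; apply/cvgnP => eps /h[N hN]; exists N => k /hN; rewrite subr0 normr_id.
rewrite -(_ : \sum_(i < a) \sum_(j < b) (0 + 0) = 0 :> R); last first.
  by rewrite big1 // => i _; rewrite big1 // => j _; rewrite addr0.
apply: cvgn_sum => i; apply: cvgn_sum => j.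
by apply: cvgD; apply: nc.
Qed.

Lemma mxlim_csum a b (F : nat -> 'M[CC]_(a, b)) (L : 'M[CC]_(a, b)) :
  mxlim (fun K => \sum_(t < K) F t) L <->
  forall i j, csum_to (fun t => F t i j) (L i j).
Proof.
have eRe i j : (fun K => complex.Re ((\sum_(t < K) F t) i j)) =
    series (fun t => complex.Re (F t i j)).
  apply/funext => K; rewrite /series /= big_mkord summxE Re_sum //.
have eIm i j : (fun K => complex.Im ((\sum_(t < K) F t) i j)) =
    series (fun t => complex.Im (F t i j)).
  apply/funext => K; rewrite /series /= big_mkord summxE Im_sum //.
split=> [h i j|h].
  split; first by rewrite -eRe; apply: mxlim_Re.
  by rewrite -eIm; apply: mxlim_Im.
apply: mxlim_entries => i j; rewrite ?eRe ?eIm; by have [] := h i j.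
Qed.

(** [mxseries] is defined through [limn], which is meaningful only for a convergent series; a
    summable bound on the norms provides convergence. *)
Lemma mxseries_lim a b (F : nat -> 'M[CC]_(a, b)) (v : nat -> R) c :
  (forall k, nrm (F k) <= v k) -> (forall K, \sum_(k < K) v k <= c) ->
  mxlim (fun K => \sum_(t < K) F t) (mxseries F).
Proof.
move=> Fv vc; apply/mxlim_csum => i j; rewrite mxE; split=> /=.
- have [l hl] : exists l : R, series (fun t => complex.Re (F t i j)) @ \oo --> l.
    apply: cvg_series_abs vc => k; apply: le_trans (Fv k).
    by apply: le_trans (Re_le_nrmc _) (entry_le_nrm _ _ _).
  by rewrite (cvgn_lim hl).
- have [l hl] : exists l : R, series (fun t => complex.Im (F t i j)) @ \oo --> l.
    apply: cvg_series_abs vc => k; apply: le_trans (Fv k).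
    by apply: le_trans (Im_le_nrmc _) (entry_le_nrm _ _ _).
  by rewrite (cvgn_lim hl).
Qed.

Lemma mxlim_herm k (F : nat -> 'M[CC]_k) L :
  mxlim F L -> (forall j, herm (F j)) -> herm L.
Proof.
move=> h hF; apply: (mxlim_uniq (F := F)) => //.
by apply: (mxlim_dom (c := 1)) (h) => j; rewrite -{1}(hF j) -mxadjB nrm_adj mul1r.
Qed.

(** Monotone bounded forms converge pointwise, polarisation passes this to the bilinear form, and
    the test vectors [d i] and [i * d i] read off the real and imaginary parts of the entries. *)
Lemma herm_mono_lim k (F : nat -> 'M[CC]_k) :
  (forall j, herm (F j)) ->
  (forall j x, rdot x (F j *m x) <= rdot x (F j.+1 *m x)) ->
  (forall x, exists c, forall j, rdot x (F j *m x) <= c) ->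
  exists L, mxlim F L.
Proof.
move=> hF mono bd.
have q x : exists l : R, (fun j => rdot x (F j *m x)) @ \oo --> l.
  by have [c hc] := bd x; apply: (cvgn_mono (mono ^~ x) hc).
have p x y : exists l : R, (fun j => rdot x (F j *m y)) @ \oo --> l.
  have [l1 h1] := q (x + y); have [l2 h2] := q (x - y).
  exists (4^-1 * (l1 - l2)).
  rewrite [X in X @ _ --> _](_ : _ = fun j => 4^-1 *
    (rdot (x + y) (F j *m (x + y)) - rdot (x - y) (F j *m (x - y)))).
    by apply: cvgM; [exact: cvg_cst|exact: cvgB].
  apply/funext => j; rewrite mulmxBr mulmxDr !rdotlin (rdot_herm y x (hF j)); lra.
pose d (i : 'I_k) : 'cV[CC]_k := delta_mx i 0.
have dE (M : 'M[CC]_k) (c : CC) i j :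
    rdot (c *: d i) (M *m d j) = complex.Re (Num.conj c * M i j).
  rewrite rdotE (bigD1 i) //= big1 => [|l li].
    by rewrite addr0 -colE !mxE !eqxx mulr1.
  by rewrite -colE !mxE (negPf li) mulr0 conjC0 mul0r.
have /choice[lr hr] : forall ij : 'I_k * 'I_k, exists l : R,
    (fun n => complex.Re (F n ij.1 ij.2)) @ \oo --> l.
  move=> [i j]; have [l hl] := p (1 *: d i) (d j); exists l.
  by move: hl; under eq_fun do rewrite dE conjC1 mul1r.
have /choice[li hi] : forall ij : 'I_k * 'I_k, exists l : R,
    (fun n => complex.Im (F n ij.1 ij.2)) @ \oo --> l.
  move=> [i j]; have [l hl] := p (Complex 0 1 *: d i) (d j); exists l.
  move: hl; under eq_fun do rewrite dE ReM Re_conj Im_conj /= mul0r sub0r mulN1r opprK.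
  by [].
exists (\matrix_(i, j) Complex (lr (i, j)) (li (i, j))).
apply: mxlim_entries => i j; rewrite mxE /=; [exact: (hr (i, j))|exact: (hi (i, j))].
Qed.

End Limits.

(** * Summable powers, resolvents and Lyapunov equations *)

Section Powers.
Variable R : realType.
Local Notation CC := R[i].

(** The form in which stability enters all estimates; it passes to the adjoint and to the
    compression [A *m P] by direct estimates. *)
Definition psum n (A : 'M[CC]_n) :=
  exists S : R, forall K, \sum_(k < K) nrm (A ^+ k) <= S.

Lemma scalar_mx_mul n (z : CC) (A : 'M[CC]_n) : z%:M * A = z *: A.
Proof. by rewrite -[_ * _]/(_ *m _) mul_scalar_mx. Qed.

(* By Cayley-Hamilton [A] is killed by a product of factors [A - z], and each
   factor with [|z| < 1] preserves summability of the powers. *)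
Lemma stable_psum n (A : 'M[CC]_n) : stable A -> psum A.
Proof.
case: n A => [|n] A stA.
  by exists 0 => K; rewrite big1 // => k _; rewrite /nrm big_ord0.
have key (s : seq CC) : (forall z, z \in s -> nrmc z < 1) ->
    forall B : 'M[CC]_n.+1, horner_mx A (\prod_(z <- s) ('X - z%:P)) * B = 0 ->
    exists S : R, forall K, \sum_(k < K) nrm (A ^+ k * B) <= S.
  elim: s => [|z s IH] hs B.
    rewrite big_nil rmorph1 mul1r => ->.
    by exists 0 => K; rewrite big1 // => k _; rewrite mulr0 nrm0.
  rewrite big_cons mulrC rmorphM -mulrA => /IH[w ws|S hS].
    by apply: hs; rewrite inE ws orbT.
  have z1 : nrmc z < 1 by apply: hs; rewrite inE eqxx.
  have z1' : 0 < 1 - nrmc z by rewrite subr_gt0.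
  have z0 := nrmc_ge0 z.
  (* From [A = z + (A - z)] the partial sums satisfy [T_{K+1} <= nrm B + nrmc z * T_K + S]; the
     witness is the fixed point of this recursion. *)
  exists ((nrm B + S) / (1 - nrmc z)).
  elim=> [|K IHK].
    rewrite big_ord0 divr_ge0 ?(ltW z1') // addr_ge0 ?nrm_ge0 //.
    by have := hS 0; rewrite big_ord0.
  rewrite big_ord_recl expr0 mul1r.
  set T := \sum_(k < K) nrm (A ^+ k * B) in IHK.
  have : \sum_(i < K) nrm (A ^+ lift ord0 i * B) <= nrmc z * T + S.
    apply: le_trans (lerD (lexx _) (hS K)).
    rewrite mulr_sumr -big_split; apply: ler_sum => i _ /=.
    rewrite -nrmZ; apply: le_trans (nrmD _ _).
    rewrite rmorphB /= horner_mx_X horner_mx_C mulrBl mulrBr mulrA -exprSr.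
    by rewrite scalar_mx_mul -scalerAr addrC subrK.
  have := ler_wpM2l z0 IHK; set c := nrm B + S => hT h.
  apply: (@le_trans _ _ (c + nrmc z * (c / (1 - nrmc z)))).
    by rewrite /c in hT *; lra.
  rewrite le_eqVlt; apply/orP; left; apply/eqP; field.
  by rewrite gt_eqF.
have [s Es] := closed_field_poly_normal (char_poly A).
have Es' : char_poly A = \prod_(z <- s) ('X - z%:P).
  by rewrite {1}Es (monicP (char_poly_monic A)) scale1r.
have [z zs||S hS] := key s _ 1.
- have : root (char_poly A) z by rewrite Es' root_prod_XsubC.
  rewrite -eigenvalue_root_char => /stA; rewrite ltcE => /andP[_].
  by [].
- by rewrite -Es' Cayley_Hamilton mul0r.
by exists S => K; apply: le_trans (hS K); rewrite le_eqVlt; apply/orP; left;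
  apply/eqP/eq_bigr => k _; rewrite mulr1.
Qed.

Lemma psum_lim0 n (A : 'M[CC]_n) : psum A ->
  (fun k => nrm (A ^+ k)) @ \oo --> (0 : R).
Proof.
move=> [S hS]; have [l hl] := cvg_series_of_bound (fun k => nrm_ge0 (A ^+ k)) hS.
by apply: cvg_series_cvg_0; apply: cvgP hl.
Qed.

Lemma psum_bound n (A : 'M[CC]_n) S : (forall K, \sum_(k < K) nrm (A ^+ k) <= S) ->
  forall k, nrm (A ^+ k) <= S.
Proof.
move=> hS k; apply: le_trans (hS k.+1); rewrite big_ord_recr lerDr.
by apply: sumr_ge0 => *; apply: nrm_ge0.
Qed.

Lemma psum_vec_lim0 n (A : 'M[CC]_n) (x : 'cV[CC]_n) : psum A ->
  (fun k => nrm (A ^+ k *m x)) @ \oo --> (0 : R).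
Proof.
move=> /psum_lim0 h; apply: (cvgn_dom (c := nrm x)) h => k.
by rewrite subr0 ger0_norm ?nrm_ge0 // mulrC nrmM.
Qed.

Lemma psum_adj n (A : 'M[CC]_n) : psum A -> psum A^H.
Proof.
move=> [S hS]; exists S => K; apply: le_trans (hS K).
by apply: ler_sum => k _; rewrite -mxadjX nrm_adj.
Qed.

Lemma inj_unitmx n (M : 'M[CC]_n) :
  (forall v : 'cV[CC]_n, M *m v = 0 -> v = 0) -> M \in unitmx.
Proof.
move=> h; rewrite -unitmx_tr -row_free_unit; apply: inj_row_free => v.
move=> /(congr1 trmx); rewrite trmx_mul trmxK trmx0 => /h.
by move=> /(congr1 trmx); rewrite trmxK trmx0.
Qed.

(** A kernel vector satisfies [v = z^k A^k v] for every [k], and the right side tends to 0. *)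
Lemma resolvent_unit n (A : 'M[CC]_n) z : psum A -> `|z| = 1 ->
  1%:M - z *: A \in unitmx.
Proof.
move=> hA z1; apply: inj_unitmx => v; rewrite mulmxBl mul1mx => /eqP.
rewrite subr_eq0 => /eqP vE.
have vk k : v = z ^+ k *: (A ^+ k *m v).
  elim: k => [|k IH]; first by rewrite expr0 scale1r mul1mx.
  rewrite {1}vE -scalemxAl {1}IH -scalemxAr scalerA -exprS mulmxA.
  by rewrite [A ^+ k.+1]exprS.
have nv : nrm v <= 0.
  apply: (cvgn_le (N := 0) (u := fun=> nrm v) _ (psum_vec_lim0 v hA)).
    exact: cvg_cst.
  by move=> k _; rewrite {1}(vk k) nrmZ nrmc1 ?mul1r // normrX z1 expr1n.
apply: rdot_eq0; apply/eqP; rewrite eq_le rdot_ge0 andbT.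
apply: le_trans (ler_norm _) _; apply: le_trans (rdot_le_nrm _ _) _.
by rewrite mulr_ge0_le0 // nrm_ge0.
Qed.

(** The Neumann series is cut at a fixed [K] with [nrm (A ^+ K) <= 1/2]; the remainder is absorbed
    into the left side, uniformly in [z]. *)
Lemma resolvent_bound n (A : 'M[CC]_n) : psum A ->
  exists b : R, forall z, `|z| = 1 -> nrm (invmx (1%:M - z *: A)) <= b.
Proof.
move=> hA; have [S hS] := hA.
have /cvgnP/(_ 2^-1) [|K hK] := psum_lim0 hA; first by rewrite invr_gt0.
have := hK K (leqnn K); rewrite subr0 ger0_norm ?nrm_ge0 // => {}hK.
exists (2 * S) => z z1; set Z := invmx _.
have ZE : Z = 1%:M + z *: (A *m Z).
  have := mulmxV (resolvent_unit hA z1); rewrite -/Z mulmxBl mul1mx => /eqP.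
  by rewrite subr_eq -scalemxAl => /eqP.
have ZK L : Z = \sum_(k < L) z ^+ k *: A ^+ k + z ^+ L *: (A ^+ L *m Z).
  elim: L => [|L IH]; first by rewrite big_ord0 add0r !expr0 scale1r mul1mx.
  rewrite big_ord_recr /= -addrA {1}IH; congr (_ + _).
  rewrite {1}ZE mulmxDr mulmx1 scalerDr; congr (_ + _).
  by rewrite -scalemxAr scalerA mulmxA -exprSr [A ^+ L.+1]exprSr.
have zk k : nrmc (z ^+ k) = 1 by apply: nrmc1; rewrite normrX z1 expr1n.
have : nrm Z <= S + 2^-1 * nrm Z.
  rewrite {1}(ZK K); apply: le_trans (nrmD _ _) _; apply: lerD.
    apply: le_trans (nrm_sum _ _) _; apply: le_trans (hS K).
    by apply: ler_sum => k _; rewrite nrmZ zk mul1r.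
  rewrite nrmZ zk mul1r; apply: le_trans (nrmM _ _) _.
  by apply: ler_wpM2r; rewrite ?nrm_ge0.
lra.
Qed.

Lemma obs_gram_lim a n (C : 'M[CC]_(a, n)) (A : 'M[CC]_n) : psum A ->
  mxlim (fun K => \sum_(t < K) (A^H ^+ t *m C^H *m C *m A ^+ t)) (obs_gram C A).
Proof.
move=> [S hS].
apply: (@mxseries_lim _ _ _ _ (fun k => S * nrm C ^+ 2 * nrm (A ^+ k))
   (S * nrm C ^+ 2 * S)) => [k|K].
  have h1 : nrm (A^H ^+ k *m C^H) <= S * nrm C.
    apply: le_trans (nrmM _ _) _; rewrite -mxadjX !nrm_adj.
    by apply: ler_wpM2r; rewrite ?nrm_ge0 ?(psum_bound hS).
  apply: le_trans (nrmM _ _) _; apply: ler_wpM2r; first exact: nrm_ge0.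
  apply: le_trans (nrmM _ _) _; rewrite expr2 mulrA.
  by apply: ler_wpM2r; rewrite ?nrm_ge0.
rewrite -mulr_sumr; apply: ler_wpM2l => //.
rewrite mulr_ge0 ?sqr_ge0 //; apply: le_trans (hS 0).
by rewrite big_ord0.
Qed.

Lemma obs_gram_herm a n (C : 'M[CC]_(a, n)) (A : 'M[CC]_n) :
  psum A -> herm (obs_gram C A).
Proof.
move=> /(obs_gram_lim C) h; apply: (mxlim_herm h) => K.
rewrite /herm; elim/big_rec: _ => [|t M _ IH]; first exact: mxadj0.
by rewrite mxadjD IH !mxadjM !mxadjX !mxadjK !mulmxA.
Qed.

Lemma obs_gram_lyap a n (C : 'M[CC]_(a, n)) (A : 'M[CC]_n) : psum A ->
  obs_gram C A = C^H *m C + A^H *m obs_gram C A *m A.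
Proof.
move=> hA; have h := obs_gram_lim C hA.
have h1 := mxlimDl (C^H *m C) (mxlimMr A (mxlimMl A^H h)).
apply: (mxlim_uniq _ h1); have := (mxlimS _ _).2 h; congr mxlim; apply/funext => K.
rewrite big_ord_recl /= !expr0 mul1mx mulmx1; congr (_ + _).
rewrite mulmx_sumr mulmx_suml; apply: eq_bigr => i _.
by rewrite /bump /= ?add1n exprS exprSr -[A^H * _]/(A^H *m _) -[_ * A]/(_ *m A) !mulmxA.
Qed.

Lemma ctrl_gramE n b (A : 'M[CC]_n) (B : 'M[CC]_(n, b)) :
  ctrl_gram A B = obs_gram B^H A^H.
Proof. by rewrite /ctrl_gram /obs_gram !mxadjK. Qed.

Lemma ctrl_gram_herm n b (A : 'M[CC]_n) (B : 'M[CC]_(n, b)) :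
  psum A -> herm (ctrl_gram A B).
Proof. by rewrite ctrl_gramE => /psum_adj; apply: obs_gram_herm. Qed.

Lemma ctrl_gram_lyap n b (A : 'M[CC]_n) (B : 'M[CC]_(n, b)) : psum A ->
  ctrl_gram A B = B *m B^H + A *m ctrl_gram A B *m A^H.
Proof.
rewrite ctrl_gramE => /psum_adj h.
by have := obs_gram_lyap B^H h; rewrite !mxadjK.
Qed.

End Powers.

(** * The control functional *)

Definition complex_semiring (R : realType) : pzSemiRingType := R[i].

(* The same product [M *m v] may carry different canonical ring structures, and
   [ring] and [lra] compare atoms up to conversion: unify the structures and
   abstract the [rdot] terms first. *)
Ltac gen_rdot :=
  repeat match goal with
  | |- context [@mulmx ?S ?a ?b ?c ?M ?N] =>
    lazymatch S with
    | complex_semiring _ => fail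
    | _ => match goal with |- context [@rdot ?R _ _ _] =>
        change (@mulmx S a b c M N) with (@mulmx (complex_semiring R) a b c M N)
      end
    end
  end;
  repeat match goal with
  |- context [@rdot ?R ?k ?a ?b] => generalize (@rdot R k a b); intro end.

Section Control.
Variable R : realType.
Local Notation CC := R[i].

Definition shift T (h : nat -> T) : nat -> T := fun i => h i.+1.

Definition prepend k (u : 'cV[CC]_k) (h : nat -> 'cV[CC]_k) i :=
  if i is i'.+1 then h i' else u.

Definition fin k N (h : nat -> 'cV[CC]_k) := forall i, (N <= i)%N -> h i = 0.

Lemma fin_shift k N (h : nat -> 'cV[CC]_k) : fin N.+1 h -> fin N (shift h).
Proof. by move=> hh i iN; apply: hh. Qed.

Section System.
Variables (m n : nat) (A : 'M[CC]_n) (Gam : 'M[CC]_(n, m)) (C : 'M[CC]_(m, n))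
  (R0 : 'M[CC]_m).

(* On inputs supported in [0, N), [wst] is [W_obs^*], [tau] is the quadratic form
   of the Toeplitz operator with symbol [R0 + z C (1 - z A)^-1 Gam + adjoint], and
   [J] is the payoff of the control problem [x+ = A x - Gam u] with stage payoff
   [2 Re u^* C x - u^* R0 u] (see [J_rec]). *)
Fixpoint wst N (h : nat -> 'cV[CC]_m) : 'cV[CC]_n :=
  if N is N'.+1 then C^H *m h 0%N + A^H *m wst N' (shift h) else 0.

Fixpoint tau N (h : nat -> 'cV[CC]_m) : R :=
  if N is N'.+1 then rdot (h 0%N) (R0 *m h 0%N)
    + 2 * rdot (wst N' (shift h)) (Gam *m h 0%N) + tau N' (shift h) else 0.

Definition J (x : 'cV[CC]_n) N (h : nat -> 'cV[CC]_m) := 2 * rdot (wst N h) x - tau N h.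

(** Dynamic programming: the cross term of [tau] between the first input and the later ones is
    exactly what replacing [A x] by [A x - Gam u] absorbs. *)
Lemma J_rec x N (h : nat -> 'cV[CC]_m) : J x N.+1 h = 2 * rdot (h 0%N) (C *m x)
  - rdot (h 0%N) (R0 *m h 0%N) + J (A *m x - Gam *m h 0%N) N (shift h).
Proof.
rewrite /J /= !rdotlin (rdot_adjl C^H) (rdot_adjl A^H) !mxadjK; gen_rdot; ring.
Qed.

Lemma J0 N (h : nat -> 'cV[CC]_m) : J 0 N h = - tau N h.
Proof. by rewrite /J rdot0r mulr0 sub0r. Qed.

Lemma wst_ext N (h g : nat -> 'cV[CC]_m) : (forall i, (i < N)%N -> h i = g i) -> wst N h = wst N g.
Proof.
elim: N h g => [//|N IH] h g e /=; rewrite (e 0%N isT).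
by rewrite (IH _ (shift g)) // => i iN; apply: e.
Qed.

Lemma tau_ext N (h g : nat -> 'cV[CC]_m) : (forall i, (i < N)%N -> h i = g i) -> tau N h = tau N g.
Proof.
elim: N h g => [//|N IH] h g e /=; rewrite (e 0%N isT).
have e' i : (i < N)%N -> shift h i = shift g i by move=> iN; apply: e.
by rewrite (wst_ext e') (IH _ _ e').
Qed.

Lemma wst0 N (h : nat -> 'cV[CC]_m) : fin 0 h -> wst N h = 0.
Proof.
elim: N h => //= N IH h h0; rewrite h0 // mulmx0 add0r IH ?mulmx0 //.
by move=> i _; apply: h0.
Qed.

Lemma tau0 N (h : nat -> 'cV[CC]_m) : fin 0 h -> tau N h = 0.
Proof.
elim: N h => //= N IH h h0; rewrite h0 // !mulmx0 !rdot0r mulr0 !add0r IH //.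
by move=> i _; apply: h0.
Qed.

Lemma wst_pad N M (h : nat -> 'cV[CC]_m) : fin N h -> (N <= M)%N -> wst M h = wst N h.
Proof.
elim: N M h => [M h h0 _|N IH [//|M] h hh NM /=]; first exact: wst0.
by rewrite IH //; apply: fin_shift.
Qed.

Lemma tau_pad N M (h : nat -> 'cV[CC]_m) : fin N h -> (N <= M)%N -> tau M h = tau N h.
Proof.
elim: N M h => [M h h0 _|N IH [//|M] h hh NM /=]; first exact: tau0.
by rewrite IH ?(@wst_pad N) //; apply: fin_shift.
Qed.

Lemma J_pad x N M (h : nat -> 'cV[CC]_m) : fin N h -> (N <= M)%N -> J x M h = J x N h.
Proof. by move=> hh NM; rewrite /J (wst_pad hh) // (tau_pad hh). Qed.

Lemma wst_lin N (a : CC) (h g : nat -> 'cV[CC]_m) :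
  wst N (fun i => a *: h i + g i) = a *: wst N h + wst N g.
Proof.
elim: N h g => [|N IH] h g /=; first by rewrite scaler0 addr0.
rewrite /shift IH !mulmxDr -!scalemxAr scalerDr.
by rewrite -!addrA; congr (_ + _); rewrite addrCA.
Qed.

Lemma wstD N (h g : nat -> 'cV[CC]_m) : wst N (fun i => h i + g i) = wst N h + wst N g.
Proof.
rewrite -[wst N h]scale1r -wst_lin; apply: wst_ext => i _.
by rewrite scale1r.
Qed.

Lemma wstZ N (a : CC) (h : nat -> 'cV[CC]_m) : wst N (fun i => a *: h i) = a *: wst N h.
Proof.
rewrite -[RHS]addr0 -(@wst0 N (fun=> 0)) // -wst_lin; apply: wst_ext => i _.
by rewrite addr0.
Qed.

Lemma wst_sum N (h : nat -> 'cV[CC]_m) : wst N h = \sum_(t < N) A^H ^+ t *m C^H *m h t.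
Proof.
elim: N h => [|N IH] h /=; first by rewrite big_ord0.
rewrite big_ord_recl expr0 mul1mx IH mulmx_sumr; congr (_ + _).
apply: eq_bigr => i _.
by rewrite /shift /bump /= ?add1n exprS -[A^H * _]/(A^H *m _) !mulmxA.
Qed.

Lemma rdot_wst N (h : nat -> 'cV[CC]_m) x :
  rdot (wst N h) x = \sum_(t < N) rdot (h t) (Wobs C A x t).
Proof.
elim: N h x => [|N IH] h x /=; first by rewrite rdot0l big_ord0.
rewrite rdotDl big_ord_recl (rdot_adjl C^H) (rdot_adjl A^H) !mxadjK IH.
congr (_ + _); first by rewrite /Wobs expr0 mulmx1.
apply: eq_bigr => i _.
by rewrite /shift /Wobs /bump /= ?add1n exprSr -[_ * A]/(_ *m A) !mulmxA.
Qed.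

Lemma tau_par N (h g : nat -> 'cV[CC]_m) : tau N (fun i => h i + g i) + tau N (fun i => h i - g i)
  = 2 * tau N h + 2 * tau N g.
Proof.
elim: N h g => [|N IH] h g /=; first by ring.
have := IH (shift h) (shift g).
have -> : wst N (shift (fun i => h i + g i)) = wst N (shift h) + wst N (shift g).
  exact: wstD.
have -> : wst N (shift (fun i => h i - g i)) = wst N (shift h) - wst N (shift g).
  rewrite -scaleN1r -wstZ -wstD; apply: wst_ext => i _.
  by rewrite scaleN1r.
rewrite !mulmxB !mulmxDr !rdotlin; gen_rdot.
have -> : tau N (shift (fun i => h i + g i)) =
  tau N (fun i => shift h i + shift g i) by [].
have -> : tau N (shift (fun i => h i - g i)) =
  tau N (fun i => shift h i - shift g i) by [].
lra.
Qed.

Lemma tauZ N (c : CC) (h : nat -> 'cV[CC]_m) :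
  tau N (fun i => c *: h i) = cabs2 c * tau N h.
Proof.
elim: N h => [|N IH] h /=; first by rewrite mulr0.
have -> : wst N (shift (fun i => c *: h i)) = c *: wst N (shift h).
  exact: wstZ.
by rewrite [tau N _]IH !mulmxZ !rdotZZ; gen_rdot; ring.
Qed.

End System.

Lemma toeplitz0 k l (coef : nat -> 'M[CC]_(k, l)) (h : nat -> 'cV[CC]_l) :
  toeplitz coef h 0 = coef 0%N *m h 0%N.
Proof. by rewrite /toeplitz big_ord_recl big_ord0 addr0. Qed.

Lemma toeplitzS k l (coef : nat -> 'M[CC]_(k, l)) (h : nat -> 'cV[CC]_l) i :
  toeplitz coef h i.+1 = coef i.+1 *m h 0%N + toeplitz coef (shift h) i.
Proof.
by rewrite /toeplitz big_ord_recl; congr (_ + _).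
Qed.

Lemma toeplitz_eq0 k l (coef : nat -> 'M[CC]_(k, l)) (h : nat -> 'cV[CC]_l) i :
  fin 0 h -> toeplitz coef h i = 0.
Proof. by move=> h0; rewrite /toeplitz big1 // => j _; rewrite h0 // mulmx0. Qed.

Lemma toeplitz_lin k l (coef : nat -> 'M[CC]_(k, l)) (a : CC) (h g : nat -> 'cV[CC]_l) i :
  toeplitz coef (fun j => a *: h j + g j) i =
  a *: toeplitz coef h i + toeplitz coef g i.
Proof.
rewrite /toeplitz scaler_sumr -big_split; apply: eq_bigr => j _.
by rewrite mulmxDr scalemxAr.
Qed.

Lemma toeplitzD k l (coef : nat -> 'M[CC]_(k, l)) (h g : nat -> 'cV[CC]_l) i :
  toeplitz coef (fun j => h j + g j) i = toeplitz coef h i + toeplitz coef g i.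
Proof.
rewrite -[X in X + _]scale1r -toeplitz_lin; apply: eq_bigr => j _.
by rewrite scale1r.
Qed.

Lemma toeplitzN k l (coef : nat -> 'M[CC]_(k, l)) (h : nat -> 'cV[CC]_l) i :
  toeplitz coef (fun j => - h j) i = - toeplitz coef h i.
Proof. by rewrite /toeplitz -sumrN; apply: eq_bigr => j _; rewrite mulmxN. Qed.

Lemma toeplitzB k l (coef : nat -> 'M[CC]_(k, l)) (h g : nat -> 'cV[CC]_l) i :
  toeplitz coef (fun j => h j - g j) i = toeplitz coef h i - toeplitz coef g i.
Proof. by rewrite (toeplitzD coef h (fun j => - g j)) toeplitzN. Qed.

Lemma cvg_series_ext (u v : nat -> R) (l : R) : (forall k, u k = v k) ->
  series u @ \oo --> l -> series v @ \oo --> l.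
Proof. by move=> /funext ->. Qed.

Lemma cvg_seriesS (u : nat -> R) (l : R) :
  series (shift u) @ \oo --> l <-> series u @ \oo --> u 0%N + l.
Proof.
have E : (fun k => series u k.+1) = (fun k => u 0%N + series (shift u) k).
  by apply/funext => k; rewrite /series /= !big_mkord big_ord_recl.
split=> h.
  by apply/cvgnS; rewrite E; apply: cvgD => //; exact: cvg_cst.
rewrite (_ : series _ = fun k => - u 0%N + (u 0%N + series (shift u) k)).
  rewrite -[X in _ --> X](addKr (u 0%N)); apply: cvgD; first exact: cvg_cst.
  by rewrite -E; apply/cvgnS.
by apply/funext => k; rewrite addKr.
Qed.

Section Factor.
Variables (m n r : nat) (A : 'M[CC]_n) (Gam : 'M[CC]_(n, m)) (CP : 'M[CC]_(r, n))
  (D : 'M[CC]_(r, m)) (Q : 'M[CC]_n).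
Hypotheses (hQ : herm Q) (lyap : Q = CP^H *m CP + A^H *m Q *m A).

(** With [Q] the Gramian of [CP], these are the coefficients of [Phi^* Phi] for
    [Phi = D + z CP (1 - z A)^-1 Gam], written as [RF + z CF (1 - z A)^-1 Gam + adjoint]. *)
Definition CF := D^H *m CP + Gam^H *m Q *m A.
Definition RF := D^H *m D + Gam^H *m Q *m Gam.

Lemma lyap_quad (x y : 'cV[CC]_n) : rdot x (Q *m y) =
  rdot (CP *m x) (CP *m y) + rdot (A *m x) (Q *m (A *m y)).
Proof. by rewrite {1}lyap mulmxDl -!mulmxA rdotDr !(rdot_adj _^H) !mxadjK. Qed.

Lemma CF_quad (u : 'cV[CC]_m) (x : 'cV[CC]_n) : rdot u (CF *m x) =
  rdot (D *m u) (CP *m x) + rdot (Gam *m u) (Q *m (A *m x)).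
Proof. by rewrite /CF mulmxDl -!mulmxA rdotDr !(rdot_adj _^H) !mxadjK. Qed.

Lemma RF_quad (u v : 'cV[CC]_m) : rdot u (RF *m v) =
  rdot (D *m u) (D *m v) + rdot (Gam *m u) (Q *m (Gam *m v)).
Proof. by rewrite /RF mulmxDl -!mulmxA rdotDr !(rdot_adj _^H) !mxadjK. Qed.

Hypothesis pA : psum A.

Lemma obs_norm_partial (x : 'cV[CC]_n) K : \sum_(k < K) vnorm2 (Wobs CP A x k) =
  rdot x (Q *m x) - rdot (A ^+ K *m x) (Q *m (A ^+ K *m x)).
Proof.
elim: K => [|K IH]; first by rewrite big_ord0 expr0 mul1mx subrr.
rewrite big_ord_recr IH (lyap_quad (A ^+ K *m x)) /= vnorm2E /Wobs !mulmxA.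
rewrite exprS -[A * _]/(A *m _) !mulmxA; ring.
Qed.

Lemma obs_norm_cvg (x : 'cV[CC]_n) :
  series (fun k => vnorm2 (Wobs CP A x k)) @ \oo --> rdot x (Q *m x).
Proof.
apply: (@cvgn_dom _ _ (fun k => nrm (A ^+ k *m x) * nrm (A ^+ k *m x)) _ (nrm Q)) => [k|].
  rewrite /series /= big_mkord obs_norm_partial addrAC subrr add0r normrN.
  apply: le_trans (rdot_le_nrm _ _) _; rewrite mulrCA.
  by apply: ler_wpM2l; rewrite ?nrm_ge0 // nrmM.
by rewrite -(mulr0 0); apply: cvgM; apply: psum_vec_lim0.
Qed.

(* Completing the square along the trajectory [x+ = A x - Gam u] of the
   Kalman-Yakubovich-Popov equations. *)
Lemma factor_norm_cvg N (h : nat -> 'cV[CC]_m) (x : 'cV[CC]_n) : fin N h ->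
  series (fun k => vnorm2 (Wobs CP A x k - toeplitz (rcoef D CP A Gam) h k))
    @ \oo --> rdot x (Q *m x) - J A Gam CF RF x N h.
Proof.
elim: N h x => [|N IH] h x fh.
  rewrite /J /= rdot0l mulr0 !subr0.
  apply: cvg_series_ext (obs_norm_cvg (x := x)) => k.
  by rewrite toeplitz_eq0 // subr0.
set u := fun k => _.
have hs := IH (shift h) (A *m x - Gam *m h 0%N) (fin_shift fh).
have -> : rdot x (Q *m x) - J A Gam CF RF x N.+1 h = u 0%N +
    (rdot (A *m x - Gam *m h 0%N) (Q *m (A *m x - Gam *m h 0%N)) -
     J A Gam CF RF (A *m x - Gam *m h 0%N) N (shift h)).
  rewrite /u toeplitz0 J_rec CF_quad RF_quad (lyap_quad x x) vnorm2E /Wobs expr0 mulmx1.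
  rewrite !mulmxB !rdotlin /= (rdot_herm (A *m x) (Gam *m h 0%N) hQ).
  rewrite (rdotC (CP *m x) (D *m h 0%N)); gen_rdot; ring.
apply/cvg_seriesS; apply: cvg_series_ext hs => k.
rewrite /shift /u toeplitzS /= /Wobs mulmxB opprD addrA !mulmxA exprSr.
by rewrite -[_ * A]/(_ *m A) !mulmxA.
Qed.

Lemma factor_toeplitz_cvg N (h : nat -> 'cV[CC]_m) : fin N h ->
  series (fun k => vnorm2 (toeplitz (rcoef D CP A Gam) h k))
    @ \oo --> tau A Gam CF RF N h.
Proof.
move=> /(factor_norm_cvg (x := 0)); rewrite mulmx0 rdot0r /J rdot0r mulr0 !sub0r opprK.
apply: cvg_series_ext => k.
by rewrite /Wobs mulmx0 sub0r !vnorm2E !rdotlin opprK.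
Qed.

Lemma factor_J_le N (h : nat -> 'cV[CC]_m) (x : 'cV[CC]_n) : fin N h -> J A Gam CF RF x N h <= rdot x (Q *m x).
Proof.
move=> /(factor_norm_cvg (x := x)) h1; rewrite -subr_ge0.
apply: (cvgn_le (N := 0) (u := fun=> 0) _ h1); first exact: cvg_cst.
by move=> k _; apply: sumr_ge0 => i _; apply: vnorm2_ge0.
Qed.

End Factor.

Lemma toeplitz_adjP k l (coef : nat -> 'M[CC]_(k, l)) y u :
  toeplitz_adj_is coef y u <->
  forall j, mxlim (fun K => \sum_(t < K) (coef t)^H *m y (j + t)%N) (u j).
Proof.
split=> [h j|h j a].
  apply: (mxlim_csum (fun t => (coef t)^H *m y (j + t)%N) (u j)).2 => i b.
  by rewrite ord1; apply: h.
exact: (mxlim_csum (fun t => (coef t)^H *m y (j + t)%N) (u j)).1 (h j) a 0.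
Qed.

End Control.

(** * Toeplitz forms and values of the symbol on the circle *)

Section Circle.
Variable R : realType.
Local Notation CC := R[i].

Lemma conj_mul1 (z : CC) : `|z| = 1 -> Num.conj z * z = 1.
Proof. by move=> z1; rewrite mulrC -normCK z1 expr1n. Qed.

Section Resolvent.
Variables (m n : nat) (A : 'M[CC]_n) (Gam : 'M[CC]_(n, m)) (C : 'M[CC]_(m, n))
  (R0 : 'M[CC]_m).

Definition resolve (z : CC) (v : 'cV[CC]_m) : 'cV[CC]_n :=
  z *: (invmx (1%:M - z *: A) *m (Gam *m v)).

(* The quadratic form of [R0 + z C (1 - z A)^-1 Gam + adjoint]. *)
Definition Fq (z : CC) (v : 'cV[CC]_m) : R :=
  rdot v (R0 *m v) + 2 * rdot v (C *m resolve z v).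

Hypothesis pA : psum A.

Lemma resolveE (z : CC) (v : 'cV[CC]_m) : `|z| = 1 ->
  resolve z v = z *: (Gam *m v + A *m resolve z v).
Proof.
move=> z1; apply/eqP; rewrite scalerDr -subr_eq; apply/eqP.
rewrite scalemxAl -[X in X - _]mul1mx -mulBmx /resolve mulmxZ mulmxA.
by rewrite mulmxV ?mul1mx //; apply: resolvent_unit.
Qed.

(* Driving the system by [conj(z)^k v] from its periodic state makes every stage
   payoff equal to [- Fq z v], so [Fq] is recovered from [tau] by averaging. *)
Lemma J_steady (z : CC) (v : 'cV[CC]_m) N (c : CC) : `|z| = 1 -> `|c| = 1 ->
  J A Gam C R0 (- (c *: resolve z v)) N (fun k => (c * Num.conj z ^+ k) *: v) =
  - (N%:R * Fq z v).
Proof.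
move=> z1; elim: N c => [|N IH] c c1.
  by rewrite /J /= rdot0l mulr0 mul0r subr0 oppr0.
rewrite J_rec expr0 mulr1.
have -> : A *m (- (c *: resolve z v)) - Gam *m (c *: v) =
    - ((c * Num.conj z) *: resolve z v).
  have bE : Num.conj z *: resolve z v = Gam *m v + A *m resolve z v.
    by rewrite {1}(resolveE v z1) scalerA (conj_mul1 z1) scale1r.
  by rewrite -scalerA bE mulmxN !mulmxZ scalerDr opprD addrC.
have := IH (c * Num.conj z); rewrite normrM c1 norm_conjC z1 mulr1.
set j1 := J _ _ _ _ _ _ _ => /(_ erefl) IH'.
set j2 := J _ _ _ _ _ _ _.
have -> : j2 = j1.
  by congr (J _ _ _ _ _ _ _); apply/funext => k; rewrite /shift exprS mulrA.
rewrite IH' mulmxO !(mulmxZ c) rdotNr !rdot_unit // /Fq -[N.+1%:R]natr1.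
gen_rdot; ring.
Qed.

Lemma wst_bound : exists2 c : R, 0 <= c & forall N h (b : R), 0 <= b ->
  (forall i, nrm (h i) <= b) -> nrm (wst A C N h) <= c * b.
Proof.
have [S hS] := psum_adj pA; have S0 : 0 <= S.
  by apply: le_trans (hS 0%N); rewrite big_ord0.
exists (S * nrm C); first by rewrite mulr_ge0 ?nrm_ge0.
move=> N h b b0 hb; rewrite wst_sum; apply: le_trans (nrm_sum _ _) _.
apply: (@le_trans _ _ (\sum_(i < N) nrm (A^H ^+ i) * (nrm C * b))).
  apply: ler_sum => i _; rewrite -mulmxA; apply: le_trans (nrmM _ _) _.
  apply: ler_wpM2l; first exact: nrm_ge0.
  apply: le_trans (nrmM _ _) _; rewrite nrm_adj.
  by apply: ler_wpM2l; rewrite ?nrm_ge0.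
rewrite -mulr_suml -mulrA; apply: ler_wpM2r => //.
by rewrite mulr_ge0 ?nrm_ge0.
Qed.

End Resolvent.

Lemma ge0_of_nat_bound (f c : R) : (forall N : nat, - c <= N%:R * f) -> 0 <= f.
Proof.
move=> h; rewrite leNgt; apply/negP => f0.
have := h (Num.Def.archi_bound (`|c| / - f)).
have := archi_boundP (divr_ge0 (normr_ge0 c) (_ : 0 <= - f)).
move=> /(_ _); rewrite oppr_ge0 => /(_ (ltW f0)).
rewrite ltr_pdivrMr ?oppr_gt0 // mulrN => h1 h2.
have := ler_norm c; lra.
Qed.

(** By [J_steady] the difference is a pairing of [wst] with the periodic state, and [wst] of a
    bounded input is bounded independently of the length [N]. *)
Lemma tau_steady m n (A : 'M[CC]_n) (Gam : 'M[CC]_(n, m)) C R0 (z : CC) (v : 'cV[CC]_m) : psum A ->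
  `|z| = 1 -> exists2 c : R, 0 <= c &
   forall N, let h k := Num.conj z ^+ k *: v in
     nrm (wst A C N h) <= c /\
     `|N%:R * Fq A Gam C R0 z v - tau A Gam C R0 N h| <= c.
Proof.
move=> pA z1; have [c c0 hc] := wst_bound C pA.
set x := resolve A Gam z v.
exists (c * nrm v * (1 + 2 * nrm x)).
  by rewrite !mulr_ge0 ?nrm_ge0 // addr_ge0 // mulr_ge0 ?nrm_ge0.
move=> N h.
have hw : nrm (wst A C N h) <= c * nrm v.
  apply: hc; rewrite ?nrm_ge0 // => i; rewrite /h nrmZ nrmc1 ?mul1r //.
  by rewrite normrX norm_conjC z1 expr1n.
have cv0 : 0 <= c * nrm v by rewrite mulr_ge0 ?nrm_ge0.
have x0 := nrm_ge0 x.
have cvx : 0 <= c * nrm v * nrm x by rewrite mulr_ge0.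
split; first by rewrite mulrDr mulr1; lra.
have := J_steady Gam C R0 pA v N z1 (normr1 _); rewrite scale1r.
have -> : (fun k => (1 * Num.conj z ^+ k) *: v) = h.
  by apply/funext => k; rewrite mul1r.
rewrite /J rdotNr -/x => e.
have -> : N%:R * Fq A Gam C R0 z v - tau A Gam C R0 N h =
  2 * rdot (wst A C N h) x by lra.
have := rdot_le_nrm (wst A C N h) x; have := ler_wpM2r x0 hw.
rewrite normrM ger0_norm // mulrDr mulr1; lra.
Qed.

(** Along exponential inputs the error quadratic in [wst] stays bounded while [tau] grows like
    [N * Fq]; a Gramian term therefore cannot affect positivity on the circle. *)
Lemma Fq_ge0_of_tau m n (A : 'M[CC]_n) (Gam : 'M[CC]_(n, m)) C R0 (p : R) (z : CC) (v : 'cV[CC]_m) :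
  psum A -> 0 <= p ->
  (forall N h, - (p * nrm (wst A C N h) ^+ 2) <= tau A Gam C R0 N h) ->
  `|z| = 1 -> 0 <= Fq A Gam C R0 z v.
Proof.
move=> pA p0 ht z1; have [c c0 hc] := tau_steady Gam C R0 v pA z1.
apply: (@ge0_of_nat_bound _ (c + p * c ^+ 2)) => N.
have [hw] := hc N; rewrite ler_norml => /andP[h1 _].
have := ht N (fun k => Num.conj z ^+ k *: v).
set w := nrm _ in hw *; have w0 : 0 <= w by apply: nrm_ge0.
have : w ^+ 2 <= c ^+ 2 by rewrite ler_pXn2r ?nnegrE.
move=> /(ler_wpM2l p0); lra.
Qed.

Lemma Fq_eq_of_tau m n (A : 'M[CC]_n) (Gam Gam' : 'M[CC]_(n, m)) C C' R0 R0' (z : CC) (v : 'cV[CC]_m) :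
  psum A -> (forall N h, tau A Gam C R0 N h = tau A Gam' C' R0' N h) ->
  `|z| = 1 -> Fq A Gam C R0 z v = Fq A Gam' C' R0' z v.
Proof.
move=> pA ht z1; have [c c0 hc] := tau_steady Gam C R0 v pA z1.
have [c' c0' hc'] := tau_steady Gam' C' R0' v pA z1.
have key (x y t a b : R) : `|x - t| <= a -> `|y - t| <= b -> - (a + b) <= x - y.
  by rewrite !ler_norml => /andP[? ?] /andP[? ?]; lra.
apply/eqP; rewrite eq_le; apply/andP; split; rewrite -subr_ge0.
  apply: (@ge0_of_nat_bound _ (c' + c)) => N; rewrite mulrBr.
  apply: (key _ _ (tau A Gam C R0 N (fun k => Num.conj z ^+ k *: v))).
    by rewrite ht; case: (hc' N).
  by case: (hc N).
apply: (@ge0_of_nat_bound _ (c + c')) => N; rewrite mulrBr.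
apply: (key _ _ (tau A Gam C R0 N (fun k => Num.conj z ^+ k *: v))).
  by case: (hc N).
by rewrite ht; case: (hc' N).
Qed.

Section FactorCircle.
Variables (m n r : nat) (A : 'M[CC]_n) (Gam : 'M[CC]_(n, m)) (CP : 'M[CC]_(r, n))
  (D : 'M[CC]_(r, m)) (Q : 'M[CC]_n).
Hypotheses (hQ : herm Q) (lyap : Q = CP^H *m CP + A^H *m Q *m A) (pA : psum A).

(** The periodic state satisfies [b = z (Gam v + A b)] with [z] unimodular, so both sides have the
    same [Q]-form; the Lyapunov equation then accounts for [|CP b|^2]. *)
Lemma factor_circle (z : CC) (v : 'cV[CC]_m) : `|z| = 1 -> vnorm2 (realize D CP A Gam z *m v) =
  Fq A Gam (CF A Gam CP D Q) (RF Gam D Q) z v.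
Proof.
move=> z1; rewrite /realize mulmxDl mulZmx -!mulmxA.
rewrite scalemxAr -/(resolve A Gam z v) /Fq CF_quad // RF_quad // vnorm2E.
have := resolveE Gam pA v z1; move: (resolve _ _ _ _) => b bE.
have e : rdot b (Q *m b) = rdot (Gam *m v + A *m b) (Q *m (Gam *m v + A *m b)).
  by rewrite {1 2}bE (mulmxZ z) rdot_unit.
have := lyap_quad lyap b b; rewrite e mulmxDr !rdotlin.
rewrite (rdot_herm (A *m b) (Gam *m v) hQ) (rdotC (CP *m b) (D *m v)).
gen_rdot; lra.
Qed.

End FactorCircle.

Section CofactorCircle.
Variables (m n b : nat) (A : 'M[CC]_n) (B : 'M[CC]_(n, b)) (C : 'M[CC]_(m, n))
  (D : 'M[CC]_(m, b)) (P : 'M[CC]_n).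
Hypotheses (hP : herm P) (lyap : P = B *m B^H + A *m P *m A^H) (pA : psum A).

(** Dual to [CF] and [RF]: coefficients of [G G^*], expressed with the controllability Gramian
    because the factors stand in the opposite order. *)
Definition GamG := B *m D^H + A *m P *m C^H.
Definition RG := D *m D^H + C *m P *m C^H.

Lemma RG_herm : herm RG.
Proof. by apply: hermD; [apply: herm_sqr | apply: herm_conjr]. Qed.

Lemma colyap_quad (x y : 'cV[CC]_n) : rdot x (P *m y) =
  rdot (B^H *m x) (B^H *m y) + rdot (A^H *m x) (P *m (A^H *m y)).
Proof. by rewrite {1}lyap mulmxDl -!mulmxA rdotDr (rdot_adj B) (rdot_adj A). Qed.

Lemma GamG_quad (u : 'cV[CC]_n) (x : 'cV[CC]_m) : rdot u (GamG *m x) =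
  rdot (B^H *m u) (D^H *m x) + rdot (A^H *m u) (P *m (C^H *m x)).
Proof. by rewrite /GamG mulmxDl -!mulmxA rdotDr (rdot_adj B) (rdot_adj A). Qed.

Lemma RG_quad (u v : 'cV[CC]_m) : rdot u (RG *m v) =
  rdot (D^H *m u) (D^H *m v) + rdot (C^H *m u) (P *m (C^H *m v)).
Proof. by rewrite /RG mulmxDl -!mulmxA rdotDr (rdot_adj D) (rdot_adj C). Qed.

Lemma cofactor_circle (z : CC) (v : 'cV[CC]_m) : `|z| = 1 -> vnorm2 ((realize D C A B z)^H *m v) =
  Fq A GamG C RG z v.
Proof.
move=> z1; set Z := invmx (1%:M - z *: A).
pose a := Num.conj z *: (Z^H *m (C^H *m v)).
have aE : a = Num.conj z *: (C^H *m v + A^H *m a).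
  rewrite -(mxadjK C) -(mxadjK A).
  have := @resolveE _ _ A^H C^H (psum_adj pA) (Num.conj z) v.
  rewrite norm_conjC => /(_ z1); rewrite /resolve.
  by rewrite /a /Z mxadj_inv mxadjB mxadj1 mxadjZ !mxadjK.
have -> : (realize D C A B z)^H *m v = D^H *m v + B^H *m a.
  rewrite /realize mxadjD mxadjZ !mxadjM mulmxDl mulZmx /a -!mulmxA.
  by rewrite !mulmxZ.
have ra : rdot v (C *m resolve A GamG z v) = rdot a (GamG *m v).
  rewrite /resolve mulmxZ mulmxA -mulZmx rdot_adj mxadjZ mxadjM mulZmx.
  by rewrite -mulmxA.
rewrite /Fq ra GamG_quad RG_quad vnorm2E.
move: a aE {ra} => a aE.
have e : rdot a (P *m a) = rdot (C^H *m v + A^H *m a) (P *m (C^H *m v + A^H *m a)).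
  by rewrite {1 2}aE (mulmxZ (Num.conj z)) rdot_unit // norm_conjC.
have := colyap_quad a a; rewrite e mulmxDr !rdotlin.
rewrite (rdot_herm (A^H *m a) (C^H *m v) hP) (rdotC (B^H *m a) (D^H *m v)).
rewrite (rdot_herm (C^H *m v) (A^H *m a) hP).
gen_rdot; lra.
Qed.

(* [(T^* h)_j] for [h] supported in [0, N). *)
Definition tadj N (h : nat -> 'cV[CC]_m) j : 'cV[CC]_b :=
  D^H *m h j + B^H *m wst A C (N - j.+1) (fun i => h (j.+1 + i)%N).

(** Quadratic form of [T_G T_G^* = T_{G G^*} - H H^*] with [H] the Hankel operator of [G], for which
    [H H^* = W_obs P W_obs^*]. *)
Lemma tadj_norm N h : \sum_(j < N) vnorm2 (tadj N h j) =
  tau A GamG C RG N h - rdot (wst A C N h) (P *m wst A C N h).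
Proof.
elim: N h => [|N IH] h; first by rewrite big_ord0 /= rdot0l subrr.
rewrite big_ord_recl /= {1}/tadj subn1 /=.
have -> : \sum_(i < N) vnorm2 (tadj N.+1 h (lift ord0 i)) =
  \sum_(i < N) vnorm2 (tadj N (shift h) i) by [].
rewrite IH.
have -> : (fun i => h (1 + i)%N) = shift h by [].
set w := wst A C N (shift h); set h0 := h 0%N.
rewrite mulmxDr vnorm2E RG_quad !rdotlin GamG_quad (colyap_quad w w).
rewrite (rdot_herm (A^H *m w) (C^H *m h0) hP) (rdotC (B^H *m w) (D^H *m h0)).
rewrite (rdot_herm (C^H *m h0) (A^H *m w) hP).
gen_rdot; lra.
Qed.

Lemma tadj_fin N h : fin N h -> fin N (tadj N h).
Proof.
move=> hh j Nj; rewrite /tadj hh // mulmx0 add0r.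
have -> : (N - j.+1 = 0)%N by apply/eqP; rewrite subn_eq0 leqW.
by rewrite /= mulmx0.
Qed.

Lemma tadj_sum N h K : fin N h -> forall j, (N <= j + K)%N ->
  \sum_(t < K.+1) (rcoef D C A B t)^H *m h (j + t)%N = tadj N h j.
Proof.
move=> hh j NK; rewrite big_ord_recl /= addn0 /tadj; congr (_ + _).
rewrite -(@wst_pad _ _ _ _ _ _ K) ?wst_sum ?mulmx_sumr; first last.
- by rewrite leq_subLR addSn ltnW.
- by move=> i Ni; apply: hh; rewrite -leq_subLR.
apply: eq_bigr => i _.
by rewrite /bump /= ?add1n !mxadjM mxadjX !mulmxA addnS addSn.
Qed.

Lemma tadj_adj N h : fin N h -> toeplitz_adj_is (rcoef D C A B) h (tadj N h).
Proof.
move=> hh; apply/toeplitz_adjP => j; apply/cvgnP => e e0.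
exists N.+1 => -[//|K] NK; have NjK : (N <= j + K)%N.
  by apply: leq_trans (leq_addl _ _).
by rewrite (tadj_sum hh NjK) subrr nrm0 subr0 normr0 ltW.
Qed.

End CofactorCircle.

Lemma tau_sub m n (A : 'M[CC]_n) (G1 G2 : 'M[CC]_(n, m)) C R1 R2 N h :
  tau A (G1 - G2) C (R1 - R2) N h = tau A G1 C R1 N h - tau A G2 C R2 N h.
Proof.
elim: N h => [|N IH] h /=; first by rewrite subrr.
rewrite !mulBmx !rdotlin IH; gen_rdot; ring.
Qed.

Lemma Fq_sub m n (A : 'M[CC]_n) (G1 G2 : 'M[CC]_(n, m)) C R1 R2 (z : CC) (v : 'cV[CC]_m) :
  Fq A (G1 - G2) C (R1 - R2) z v = Fq A G1 C R1 z v - Fq A G2 C R2 z v.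
Proof.
have -> : Fq A (G1 - G2) C (R1 - R2) z v = rdot v (R1 *m v - R2 *m v) +
    2 * rdot v (C *m (resolve A G1 z v - resolve A G2 z v)).
  by rewrite /Fq /resolve !mulBmx -scalerBr -mulmxB.
rewrite /Fq mulmxB !rdotlin; gen_rdot; ring.
Qed.

End Circle.

(** * Sampling at roots of unity *)

Section Fourier.
Variable R : realType.
Local Notation CC := R[i].

Lemma prim_root_exists M : (0 < M)%N -> exists w : CC, M.-primitive_root w.
Proof.
move=> M0; have [r] := closed_field_poly_normal ('X^M - 1 : {poly CC}).
rewrite (monicP (monicXnsubC _ M0)) scale1r => rE.
have unity : all M.-unity_root r.
  by apply/allP => z zr; rewrite /root_of_unity rE root_prod_XsubC.
have uniq_r : uniq r.
  by rewrite -separable_prod_XsubC -rE separable_Xn_sub_1 // pnatr_eq0 -lt0n.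
have size_r : (M < (size r).+1)%N.
  by rewrite -(size_prod_XsubC r id) -rE size_XnsubC.
by have /hasP[w _ pw] := has_prim_root M0 unity uniq_r size_r; exists w.
Qed.

Lemma root_orthogonality M (w : CC) (j k : 'I_M) : M.-primitive_root w ->
  \sum_(a < M) Num.conj ((w ^+ a) ^+ j) * (w ^+ a) ^+ k =
  if j == k then M%:R else 0.
Proof.
move=> pw; have wM := prim_expr_order pw; have M0 := prim_order_gt0 pw.
have w1 : `|w| = 1.
  by apply/eqP; rewrite -(pexpr_eq1 M0) // -normrX wM normr1.
have cw : Num.conj w * w = 1 by apply: conj_mul1.
have cwk i : Num.conj (w ^+ i) * w ^+ i = 1.
  by rewrite rmorphXn -exprMn cw expr1n.
pose q := Num.conj (w ^+ j) * w ^+ k.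
have -> : \sum_(a < M) Num.conj ((w ^+ a) ^+ j) * (w ^+ a) ^+ k =
    \sum_(a < M) q ^+ a.
  by apply: eq_bigr => a _; rewrite /q exprMn -rmorphXn -!exprM ![(a * _)%N]mulnC.
case: (eqVneq j k) => [e|jk].
  rewrite /q e cwk; under eq_bigr do rewrite expr1n.
  by rewrite sumr_const card_ord.
have q1 : q - 1 != 0.
  rewrite subr_eq0; apply: contra jk => /eqP qE.
  have : w ^+ j = w ^+ k.
    by rewrite -[RHS]mul1r -(cwk j) [X in X * _]mulrC -mulrA -/q qE mulr1.
  by move=> /eqP; rewrite (eq_prim_root_expr pw) !modn_small.
apply: (mulfI q1); rewrite mulr0 -subrX1 /q exprMn -rmorphXn -!exprM.
by rewrite ![(_ * M)%N]mulnC !exprM wM !expr1n rmorph1 mulr1 subrr.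
Qed.

(** Plancherel on the cyclic group of order [M]: a finite sum takes the place of integration over
    the circle. *)
Lemma parseval M k (w : CC) (u y : nat -> 'cV[CC]_k) : M.-primitive_root w ->
  \sum_(a < M) rdot (\sum_(j < M) (w ^+ a) ^+ j *: u j)
     (\sum_(j < M) (w ^+ a) ^+ j *: y j) =
  M%:R * \sum_(j < M) rdot (u j) (y j).
Proof.
move=> pw.
have sumadj (F : 'I_M -> 'cV[CC]_k) : (\sum_i F i)^H = \sum_i (F i)^H.
  by elim/big_rec2: _ => [|i ? ? _ <-]; rewrite ?mxadj0 ?mxadjD.
pose g (j l : 'I_M) : CC := ((u j)^H *m y l) 0 0.
have E a : rdot (\sum_(j < M) (w ^+ a) ^+ j *: u j)
     (\sum_(j < M) (w ^+ a) ^+ j *: y j) = complex.Re (\sum_(j < M) \sum_(l < M)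
     (Num.conj ((w ^+ a) ^+ j) * (w ^+ a) ^+ l) * g j l).
  rewrite /rdot sumadj mulmx_suml summxE; congr complex.Re.
  apply: eq_bigr => j _; rewrite mulmx_sumr summxE; apply: eq_bigr => l _.
  by rewrite mxadjZ mulZmx mulmxZ scalerA mxE.
under eq_bigr do rewrite E; rewrite -Re_sum exchange_big /=.
under eq_bigr => j _.
  rewrite exchange_big /=.
  under eq_bigr => l _ do rewrite -mulr_suml root_orthogonality //.
  rewrite (bigD1 j) //= eqxx big1 => [|l lj]; last first.
    by rewrite eq_sym (negPf lj) mul0r.
  rewrite addr0; over.
have nE (x : CC) : complex.Re (M%:R * x) = M%:R * complex.Re x.
  by rewrite -(rmorph_nat (real_complex R)) ReM /= mul0r subr0.
by rewrite -mulr_sumr nE Re_sum.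
Qed.

Fixpoint traj m n (A : 'M[CC]_n) (Gam : 'M[CC]_(n, m)) x (h : nat -> 'cV[CC]_m) k :=
  if k is k'.+1 then A *m traj A Gam x h k' - Gam *m h k' else x.

Section Trajectories.
Variables (m n : nat) (A : 'M[CC]_n) (Gam : 'M[CC]_(n, m)) (C : 'M[CC]_(m, n))
  (R0 : 'M[CC]_m).

Lemma traj_shift x h k :
  traj A Gam x h k.+1 = traj A Gam (A *m x - Gam *m h 0%N) (shift h) k.
Proof. by elim: k => //= k <-. Qed.

Lemma J_traj x M h : J A Gam C R0 x M h = \sum_(k < M)
  (2 * rdot (h k) (C *m traj A Gam x h k) - rdot (h k) (R0 *m h k)).
Proof.
elim: M x h => [|M IH] x h.
  by rewrite big_ord0 /J /= rdot0l mulr0 subr0.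
by rewrite J_rec big_ord_recl IH; congr (_ + _); apply: eq_bigr => k _;
  rewrite -traj_shift.
Qed.

Lemma traj_fin x N h k : fin N h ->
  traj A Gam x h (N + k) = A ^+ k *m traj A Gam x h N.
Proof.
move=> hh; elim: k => [|k IH]; first by rewrite addn0 mul1mx.
rewrite addnS /= IH hh ?leq_addr // mulmx0 subr0 exprS.
by rewrite mulmxA.
Qed.

(** Discrete Fourier transform of the state recursion started at 0; the term in [traj A Gam 0 h M]
    is the defect from closing the time line into a cycle. *)
Lemma traj_dft (z : CC) M h :
  (1%:M - z *: A) *m (\sum_(k < M) z ^+ k *: traj A Gam 0 h k) =
  - (z *: (Gam *m \sum_(k < M) z ^+ k *: h k) + z ^+ M *: traj A Gam 0 h M).
Proof.
elim: M => [|M IH].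
  by rewrite !big_ord0 !mulmx0 !scaler0 addr0 oppr0.
rewrite !big_ord_recr /= mulmxDr IH mulmxDr scalerDr mulBmx mul1mx !mulZmx.
rewrite !mulmxZ scalerBr !scalerA -exprS.
move: (z *: _) (z ^+ M *: _) (z ^+ M.+1 *: _) (z ^+ M.+1 *: _) => a b c d.
by rewrite opprD -addrA addKr [d - c]addrC [a + c + _]addrA addrK opprD.
Qed.

Hypothesis pA : psum A.

(* Averaging [Fq] over the [M]-th roots of unity is the payoff of the first [M]
   stages, up to the state reached at time [M], which tends to 0. *)
Lemma tau_ge0 N h : (forall z v, `|z| = 1 -> 0 <= Fq A Gam C R0 z v) ->
  0 <= tau A Gam C R0 N h.
Proof.
move=> F0.
wlog hh : h / fin N h.
  move=> W; pose g i := if (i < N)%N then h i else 0.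
  rewrite (@tau_ext _ _ _ _ _ _ _ _ _ g) => [|i iN]; last by rewrite /g iN.
  by apply: W => i Ni; rewrite /g ltnNge Ni.
have [b hb] := resolvent_bound pA.
have b0 : 0 <= b by apply: le_trans (nrm_ge0 _) (hb 1 (normr1 _)).
pose x := traj A Gam 0 h; pose H := \sum_(k < N) nrm (h k).
have H0 : 0 <= H by apply: sumr_ge0 => *; apply: nrm_ge0.
have key K : J A Gam C R0 0 N h <= 2 * (H * (nrm C * b)) * nrm (A ^+ K.+1 *m x N).
  (* The input stops at time [N] and the state then decays freely for [K.+1] steps; the successor
     also makes [M] positive. *)
  pose M := (N + K.+1)%N.
  have NM : (N <= M)%N by apply: leq_addr.
  have M0 : (0 < M)%N by rewrite /M addnS.
  have [w pw] := prim_root_exists M0.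
  pose hw a := \sum_(k < M) (w ^+ a) ^+ k *: h k.
  pose xw a := \sum_(k < M) (w ^+ a) ^+ k *: x k.
  have w1 : `|w| = 1.
    by apply/eqP; rewrite -(pexpr_eq1 M0) // -normrX (prim_expr_order pw) normr1.
  have wa a : `|w ^+ a| = 1 by rewrite normrX w1 expr1n.
  have sumM (B : 'M[CC]_m) (y : nat -> 'cV[CC]_m) a :
    B *m \sum_(k < M) (w ^+ a) ^+ k *: y k = \sum_(k < M) (w ^+ a) ^+ k *: (B *m y k).
    by rewrite mulmx_sumr; apply: eq_bigr => k _; rewrite mulmxZ.
  have sumC a : C *m xw a = \sum_(k < M) (w ^+ a) ^+ k *: (C *m x k).
    by rewrite mulmx_sumr; apply: eq_bigr => k _; rewrite mulmxZ.
  have JE : M%:R * J A Gam C R0 0 N h =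
     \sum_(a < M) (2 * rdot (hw a) (C *m xw a) - rdot (hw a) (R0 *m hw a)).
    rewrite sumrB -mulr_sumr -(J_pad A Gam C R0 0 hh NM) J_traj sumrB -mulr_sumr mulrBr.
    rewrite mulrCA; congr (2 * _ - _).
      apply: etrans (esym (parseval h (fun k => C *m x k) pw)) _.
      by apply: eq_bigr => a _; rewrite sumC.
    apply: etrans (esym (parseval h (fun k => R0 *m h k) pw)) _.
    by apply: eq_bigr => a _; rewrite -sumM.
  have hwH a : nrm (hw a) <= H.
    apply: le_trans (nrm_sum _ _) _.
    rewrite /M big_split_ord /= [X in _ + X]big1 => [|i _]; last first.
      by rewrite hh ?leq_addr // scaler0 nrm0.
    rewrite addr0; apply: ler_sum => i _.
    by rewrite nrmZ nrmc1 ?mul1r // normrX wa expr1n.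
  have term a : 2 * rdot (hw a) (C *m xw a) - rdot (hw a) (R0 *m hw a) <=
      2 * (H * (nrm C * b)) * nrm (x M).
    set z := w ^+ a; set Z := invmx (1%:M - z *: A).
    have zM : z ^+ M = 1 by rewrite /z -exprM mulnC exprM (prim_expr_order pw) expr1n.
    (* At an [M]-th root of unity the transformed state is minus the periodic state driven by
       [hw a], up to a multiple of the final state [x M]. *)
    have xE : xw a = - (resolve A Gam z (hw a) + Z *m x M).
      rewrite -[LHS]mul1mx -(mulVmx (resolvent_unit pA (wa a))) -mulmxA.
      by rewrite traj_dft zM scale1r mulmxO mulmxDr mulmxZ.
    rewrite xE mulmxO mulmxDr !rdotlin.
    have := F0 z (hw a) (wa a); rewrite /Fq.
    have : `|rdot (hw a) (C *m (Z *m x M))| <= H * (nrm C * b) * nrm (x M).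
      apply: le_trans (rdot_le_nrm _ _) _; rewrite -mulrA.
      apply: ler_pM; rewrite ?nrm_ge0 //.
      apply: le_trans (nrmM _ _) _; rewrite -mulrA.
      apply: ler_wpM2l; first exact: nrm_ge0.
      apply: le_trans (nrmM _ _) _.
      by apply: ler_wpM2r; [exact: nrm_ge0 | exact: hb (wa a)].
    rewrite ler_norml => /andP[h1 _] h2.
    move: h1 h2; gen_rdot; move: (H * (nrm C * b)) (nrm (x M)) => e f; lra.
  have : M%:R * J A Gam C R0 0 N h <= M%:R * (2 * (H * (nrm C * b)) * nrm (x M)).
    rewrite JE; set t := _ * nrm (x M).
    apply: (@le_trans _ _ (\sum_(a < M) t)).
      by apply: ler_sum => a _; apply: term.
    by rewrite sumr_const card_ord [X in _ <= X]mulr_natl.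
  rewrite ler_pM2l ?ltr0n //.
  by rewrite /x /M traj_fin.
have J0 : J A Gam C R0 0 N h <= 0.
  have h1 := psum_vec_lim0 (x N) pA.
  have h2 : (fun K => 2 * (H * (nrm C * b)) * nrm (A ^+ K.+1 *m x N)) @ \oo --> (0 : R).
    apply: (cvgn_dom (c := 2 * (H * (nrm C * b)))) ((cvgnS _ _).2 h1) => K.
    by rewrite subr0 ger0_norm // !mulr_ge0 ?nrm_ge0.
  apply: (cvgn_le (N := 0%N) (u := fun=> J A Gam C R0 0 N h) _ h2).
    exact: cvg_cst.
  by move=> K _; apply: key.
by move: J0; rewrite /J rdot0r mulr0 sub0r oppr_le0.
Qed.

Lemma nrm_sqr_le k (v : 'cV[CC]_k) : nrm v ^+ 2 <= k%:R * rdot v v.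
Proof.
have -> : nrm v = \sum_i nrmc (v i 0).
  by apply: eq_bigr => i _; rewrite big_ord_recl big_ord0 addr0.
rewrite -vnorm2E /vnorm2; pose f i := nrmc (v i 0).
rewrite -(eq_bigr _ (fun i _ => nrmc_sqr (v i 0))).
rewrite expr2 big_distrlr /=.
apply: (@le_trans _ _ (\sum_i \sum_j (2^-1 * (f i ^+ 2) + 2^-1 * (f j ^+ 2)))).
  apply: ler_sum => i _; apply: ler_sum => j _.
  have := sqr_ge0 (f i - f j); rewrite sqrrB -/(f i) -/(f j) -mulr_natr; lra.
set S := (X in _ <= _ * X).
have SE : S = \sum_i f i ^+ 2 by [].
rewrite (eq_bigr (fun i => (2^-1 * f i ^+ 2) *+ k + 2^-1 * S)) => [|i _].
  rewrite big_split /= sumrMnl -mulr_sumr sumr_const card_ord -SE.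
  rewrite -mulrnDl -mulrDl (_ : 2^-1 + 2^-1 = 1 :> R); last by lra.
  by rewrite mul1r mulr_natl.
by rewrite big_split /= sumr_const card_ord -mulr_sumr SE.
Qed.

End Trajectories.

(** A symbol bounded by [c] on the circle makes the symbol of [c - T_R] nonnegative there, so
    [tau_ge0] applies to the difference. *)
Lemma tau_bound m n (A : 'M[CC]_n) (Gam : 'M[CC]_(n, m)) (C : 'M[CC]_(m, n))
  (R0 : 'M[CC]_m) : psum A -> exists2 c : R, 0 <= c & forall N h,
  tau A Gam C R0 N h <= c * \sum_(i < N) vnorm2 (h i).
Proof.
move=> pA; have [b hb] := resolvent_bound pA.
have b0 : 0 <= b by apply: le_trans (nrm_ge0 _) (hb 1 (normr1 _)).
(* [d] bounds [Fq] relative to [nrm v ^+ 2]; the factor [m] in [c] is the price of [nrm_sqr_le] for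
   passing to the Euclidean norm. *)
pose d := nrm R0 + 2 * (nrm C * (b * nrm Gam)).
have d0 : 0 <= d by rewrite addr_ge0 ?mulr_ge0 ?nrm_ge0.
pose c := d * m%:R; have c0 : 0 <= c by rewrite mulr_ge0.
exists c => // N h.
pose Rc : 'M[CC]_m := (real_complex R c)%:M.
have RcE v : rdot v (Rc *m v) = c * rdot v v.
  by rewrite mul_scalar_mx rdotZr.
have tc : tau A 0 C Rc N h = c * \sum_(i < N) vnorm2 (h i).
  elim: N h => [|N IH] h /=; first by rewrite big_ord0 mulr0.
  by rewrite RcE mul0mx rdot0r mulr0 addr0 IH big_ord_recl mulrDr vnorm2E.
rewrite -tc -subr_ge0 -tau_sub; apply: tau_ge0 => // z v z1.
rewrite Fq_sub subr_ge0 {2}/Fq RcE.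
have -> : resolve A (0 : 'M[CC]_(n, m)) z v = 0.
  by rewrite /resolve mul0mx mulmx0 scaler0.
rewrite mulmx0 rdot0r mulr0 addr0.
apply: (@le_trans _ _ (d * nrm v ^+ 2)); last first.
  by rewrite /c -mulrA; apply: ler_wpM2l => //; apply: nrm_sqr_le.
rewrite /Fq /d [X in _ <= X]mulrDl.
apply: lerD.
  apply: le_trans (ler_norm _) _; apply: le_trans (rdot_le_nrm _ _) _.
  rewrite expr2 mulrCA; apply: ler_wpM2l; first exact: nrm_ge0.
  exact: nrmM.
rewrite -!mulrA; apply: ler_wpM2l => //.
apply: le_trans (ler_norm _) _; apply: le_trans (rdot_le_nrm _ _) _.
rewrite expr2 !mulrA mulrC; apply: ler_wpM2r; first exact: nrm_ge0.
apply: le_trans (nrmM _ _) _; rewrite -!mulrA; apply: ler_wpM2l.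
  exact: nrm_ge0.
rewrite /resolve nrmZ nrmc1 // mul1r; apply: le_trans (nrmM _ _) _.
apply: ler_pM; rewrite ?nrm_ge0 ?hb //; exact: nrmM.
Qed.

End Fourier.

(** * Riccati iteration and outer factors *)

Section Riccati.
Variable R : realType.
Local Notation CC := R[i].
Variables (m n : nat) (A : 'M[CC]_n) (Gam : 'M[CC]_(n, m)) (C : 'M[CC]_(m, n))
  (R0 : 'M[CC]_m).
Hypothesis hR0 : herm R0.

(** Linear and quadratic coefficients in the control [u] of the stage payoff plus the terminal value
    [Q], as [stage_expand] shows. *)
Definition Ksch Q := C - Gam^H *m Q *m A.
Definition dsch Q := R0 - Gam^H *m Q *m Gam.
Definition stage (x : 'cV[CC]_n) (u : 'cV[CC]_m) :=
  2 * rdot u (C *m x) - rdot u (R0 *m u).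

Lemma dsch_herm Q : herm Q -> herm (dsch Q).
Proof. by move=> hQ; apply: hermB => //; apply: herm_conj. Qed.

Lemma stage_expand Q (x : 'cV[CC]_n) (u : 'cV[CC]_m) : herm Q ->
  stage x u + rdot (A *m x - Gam *m u) (Q *m (A *m x - Gam *m u)) =
  rdot (A *m x) (Q *m (A *m x)) + (2 * rdot u (Ksch Q *m x) - rdot u (dsch Q *m u)).
Proof.
move=> hQ.
have -> : rdot u (Ksch Q *m x) = rdot u (C *m x) - rdot (Gam *m u) (Q *m (A *m x)).
  by rewrite mulBmx rdotDr rdotNr -2!mulmxA (rdot_adj Gam^H) mxadjK.
have -> : rdot u (dsch Q *m u) = rdot u (R0 *m u) - rdot (Gam *m u) (Q *m (Gam *m u)).
  by rewrite mulBmx rdotDr rdotNr -2!mulmxA (rdot_adj Gam^H) mxadjK.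
rewrite /stage mulmxB !rdotlin (rdot_herm (A *m x) (Gam *m u) hQ).
gen_rdot; ring.
Qed.

Lemma square_le (d : 'M[CC]_m) (e u : 'cV[CC]_m) : herm d ->
  (forall v, 0 <= rdot v (d *m v)) ->
  2 * rdot u (d *m e) - rdot u (d *m u) <= rdot e (d *m e).
Proof.
move=> hd pd; have := pd (u - e); rewrite mulmxB !rdotlin (rdot_herm e u hd).
gen_rdot; lra.
Qed.

(* A quadratic form in [u] that is bounded above for every [x] has a maximiser
   depending linearly on [x]. *)
Lemma bounded_stage Q : herm Q ->
  (forall x, exists c : R, forall u,
     stage x u + rdot (A *m x - Gam *m u) (Q *m (A *m x - Gam *m u)) <= c) ->
  (forall v, 0 <= rdot v (dsch Q *m v)) /\ exists S, Ksch Q = dsch Q *m S.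
Proof.
move=> hQ bd.
have qb (x : 'cV[CC]_n) : (forall u, 0 <= rdot u (dsch Q *m u)) /\
    exists e, Ksch Q *m x = dsch Q *m e.
  have [c hc] := bd x.
  apply: (@quad_bounded _ _ _ _ (c - rdot (A *m x) (Q *m (A *m x)))).
    exact: dsch_herm.
  by move=> u; have := hc u; rewrite stage_expand // => h; rewrite lerBrDl.
split; first by have [] := qb 0.
by apply: mulmx_choose => x; have [] := qb x.
Qed.

Lemma max_stage Q S (x : 'cV[CC]_n) (u : 'cV[CC]_m) : herm Q -> (forall v, 0 <= rdot v (dsch Q *m v)) ->
  Ksch Q = dsch Q *m S ->
  stage x u + rdot (A *m x - Gam *m u) (Q *m (A *m x - Gam *m u)) <=
  rdot x ((A^H *m Q *m A + S^H *m dsch Q *m S) *m x).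
Proof.
move=> hQ pd KE; rewrite stage_expand // KE mulmxDl rdotDr -!mulmxA.
rewrite (rdot_adj A^H) (rdot_adj S^H) !mxadjK lerD2l.
by apply: square_le => //; apply: dsch_herm.
Qed.

Lemma max_stage_attained Q S (x : 'cV[CC]_n) : herm Q -> Ksch Q = dsch Q *m S ->
  stage x (S *m x) + rdot (A *m x - Gam *m (S *m x)) (Q *m (A *m x - Gam *m (S *m x))) =
  rdot x ((A^H *m Q *m A + S^H *m dsch Q *m S) *m x).
Proof.
move=> hQ KE; rewrite stage_expand // KE mulmxDl rdotDr -!mulmxA.
rewrite (rdot_adj A^H) (rdot_adj S^H) !mxadjK.
gen_rdot; ring.
Qed.

Local Notation Jb := (J A Gam C R0).

Lemma J_stage x N h :
  Jb x N.+1 h = stage x (h 0%N) + Jb (A *m x - Gam *m h 0%N) N (shift h).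
Proof. exact: J_rec. Qed.

Hypothesis bounded : forall x, exists c : R, forall N h, Jb x N h <= c.

(** Value iteration: since the [N]-stage maximum is attained, one stage followed by [Q] is itself a
    payoff of [N.+1] stages, hence bounded, and [bounded_stage] supplies a linear maximiser. *)
Lemma value_function N : exists Q, [/\ herm Q,
  forall x h, Jb x N h <= rdot x (Q *m x) &
  forall x, exists h, Jb x N h = rdot x (Q *m x)].
Proof.
elim: N => [|N [Q [hQ ub att]]].
  exists 0; split; first exact: mxadj0.
    by move=> x h; rewrite /J /= rdot0l mulr0 subrr mul0mx rdot0r.
  by move=> x; exists (fun=> 0); rewrite /J /= rdot0l mulr0 subrr mul0mx rdot0r.
have bd x : exists c : R, forall u,
     stage x u + rdot (A *m x - Gam *m u) (Q *m (A *m x - Gam *m u)) <= c.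
  have [c hc] := bounded x; exists c => u.
  have [h <-] := att (A *m x - Gam *m u).
  by apply: le_trans (hc N.+1 (prepend u h)); rewrite J_stage.
have [pd [S KE]] := bounded_stage hQ bd.
exists (A^H *m Q *m A + S^H *m dsch Q *m S); split.
- by apply: hermD; apply: herm_conj => //; apply: dsch_herm.
- move=> x h; rewrite J_stage; apply: le_trans (max_stage x (h 0%N) hQ pd KE).
  by rewrite lerD2l ub.
- move=> x; have [h hE] := att (A *m x - Gam *m (S *m x)).
  exists (prepend (S *m x) h); rewrite -max_stage_attained // -hE.
  exact: J_stage.
Qed.

(** [dsch] of the limit may be singular, so the Riccati map is not passed to the limit by
    continuity. The Bellman inequality survives the limit and yields [S] through [bounded_stage];
    the reverse inequality follows from each [Qs N] lying below [Q]. *)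
Lemma riccati_limit : exists Q, [/\ herm Q,
  forall x N h, Jb x N h <= rdot x (Q *m x),
  forall x e, 0 < e -> exists N h, fin N h /\ rdot x (Q *m x) - e <= Jb x N h &
  exists S, [/\ forall v, 0 <= rdot v (dsch Q *m v), Ksch Q = dsch Q *m S &
    Q = A^H *m Q *m A + S^H *m dsch Q *m S]].
Proof.
have /choice[Qs hQs] := value_function.
have hQ N : herm (Qs N) by have [] := hQs N.
have ub N x h : Jb x N h <= rdot x (Qs N *m x) by have [] := hQs N.
have att N x : exists2 h, fin N h & Jb x N h = rdot x (Qs N *m x).
  have [_ _ /(_ x) [h hE]] := hQs N.
  exists (fun i => if (i < N)%N then h i else 0).
    by move=> i Ni; rewrite ltnNge Ni.
  rewrite -hE /J; congr (2 * rdot _ _ - _).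
    by apply: wst_ext => i ->.
  by apply: tau_ext => i ->.
have mono N x : rdot x (Qs N *m x) <= rdot x (Qs N.+1 *m x).
  have [h fh <-] := att N x; rewrite -(J_pad _ _ _ _ _ fh (leqnSn N)).
  exact: ub.
have [Q limQ] : exists Q, mxlim Qs Q.
  apply: herm_mono_lim => // x; have [c hc] := bounded x.
  by exists c => N; have [h _ <-] := att N x.
have limq x : (fun N => rdot x (Qs N *m x)) @ \oo --> rdot x (Q *m x).
  exact: mxlim_rdot.
have leQ N x : rdot x (Qs N *m x) <= rdot x (Q *m x).
  exact: (cvgn_mono_le (mono ^~ x) (limq x)).
have hQl : herm Q by apply: mxlim_herm limQ hQ.
have bellman x u :
    stage x u + rdot (A *m x - Gam *m u) (Q *m (A *m x - Gam *m u)) <= rdot x (Q *m x).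
  have h1 : (fun N => stage x u +
     rdot (A *m x - Gam *m u) (Qs N *m (A *m x - Gam *m u))) @ \oo -->
     stage x u + rdot (A *m x - Gam *m u) (Q *m (A *m x - Gam *m u)).
    by apply: cvgD; [exact: cvg_cst | exact: limq].
  apply: (cvgn_le (N := 0%N) h1 (v := fun=> rdot x (Q *m x))); first exact: cvg_cst.
  move=> N _; have [h _ <-] := att N (A *m x - Gam *m u).
  apply: le_trans (leQ N.+1 x); apply: le_trans (ub _ _ (prepend u h)).
  by rewrite J_stage.
have [|pd [S KE]] := @bounded_stage Q hQl.
  by move=> x; exists (rdot x (Q *m x)).
exists Q; split=> //.
- by move=> x N h; apply: le_trans (ub N x h) (leQ N x).
- move=> x e e0; have /cvgnP/(_ e e0) [N hN] := limq x.
  have [h fh hE] := att N x; exists N, h; split=> //; rewrite hE.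
  have := hN N (leqnn N); rewrite ler_norml => /andP[h1 _]; lra.
exists S; split=> //; apply: herm_ext => // [|x].
  by apply: hermD; apply: herm_conj => //; apply: dsch_herm.
apply/eqP; rewrite eq_le; apply/andP; split; last first.
  by rewrite -max_stage_attained //; apply: bellman.
apply: (cvgn_le (N := 1%N) (limq x) (v := fun=> _)); first exact: cvg_cst.
move=> [//|N] _; have [h _ <-] := att N.+1 x; rewrite J_stage.
apply: le_trans (max_stage x (h 0%N) hQl pd KE); rewrite lerD2l.
exact: le_trans (ub _ _ _) (leQ _ _).
Qed.

(* [Q] is the minimal solution of the Kalman-Yakubovich-Popov equations, the limit
   of the Riccati iteration started at 0. *)
Lemma kyp : exists r (D : 'M[CC]_(r, m)) (CP : 'M[CC]_(r, n)) Q,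
  [/\ (r <= m)%N, herm Q & Q = CP^H *m CP + A^H *m Q *m A] /\
  [/\ C = CF A Gam CP D Q, R0 = RF Gam D Q, forall c : 'cV_r, exists v, c = D *m v &
   forall x e, 0 < e -> exists N h, fin N h /\ rdot x (Q *m x) - e <= Jb x N h].
Proof.
have [Q [hQ _ sup [S [pd KE QE]]]] := riccati_limit.
have [r [D [rm DE Donto]]] := psd_factor_onto (dsch_herm hQ) pd.
(* With [CP = D S] one has [CP^H CP = S^H (dsch Q) S], which turns the Riccati equation into a
   Lyapunov equation. *)
exists r, D, (D *m S), Q; split; split=> //.
- by rewrite mxadjM -mulmxA (mulmxA D^H) -DE mulmxA addrC -QE.
- rewrite /CF mulmxA -DE -KE /Ksch; by rewrite subrK.
- by rewrite /RF -DE /dsch subrK.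
Qed.

End Riccati.

(** * Square summable sequences and density from the first column *)

Section L2.
Variable R : realType.
Local Notation CC := R[i].

(** Bounding all partial sums expresses convergence and a norm bound at once, without going through
    [limn]. *)
Definition l2le k (s : nat -> 'cV[CC]_k) (e : R) :=
  forall K, \sum_(i < K) vnorm2 (s i) <= e.

Lemma l2le_ge0 k (s : nat -> 'cV[CC]_k) e : l2le s e -> 0 <= e.
Proof. by move=> /(_ 0%N); rewrite big_ord0. Qed.

Lemma l2leP k (s : nat -> 'cV[CC]_k) e :
  l2le s e -> l2 s /\ l2norm2 s <= e.
Proof.
move=> h; have [l hl] := cvg_series_of_bound (fun i => vnorm2_ge0 (s i)) h.
split; first by apply: cvgP hl.
rewrite /l2norm2 (cvgn_lim hl); apply: (cvgn_le (N := 0%N) hl (v := fun=> e)).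
  exact: cvg_cst.
by move=> K _; rewrite /series /= big_mkord.
Qed.

Lemma series_vnorm2_le k (s : nat -> 'cV[CC]_k) (l : R) :
  series (fun i => vnorm2 (s i)) @ \oo --> l -> l2le s l.
Proof.
move=> hl K; have : series (fun i => vnorm2 (s i)) K <= l.
  apply: (cvgn_mono_le _ hl) => j; by rewrite seriesSr lerDl vnorm2_ge0.
by rewrite /series /= big_mkord.
Qed.

Lemma l2_le k (s : nat -> 'cV[CC]_k) : l2 s -> l2le s (l2norm2 s).
Proof. by move=> h; apply: series_vnorm2_le. Qed.

Lemma vnorm2D_le k (u v : 'cV[CC]_k) :
  vnorm2 (u + v) <= 2 * (vnorm2 u + vnorm2 v).
Proof.
have := rdot_ge0 (u - v); rewrite !vnorm2E !rdotlin (rdotC v u).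
gen_rdot; lra.
Qed.

Lemma l2leD k (s t : nat -> 'cV[CC]_k) a b :
  l2le s a -> l2le t b -> l2le (fun i => s i + t i) (2 * (a + b)).
Proof.
move=> hs ht K; apply: (@le_trans _ _
  (\sum_(i < K) 2 * (vnorm2 (s i) + vnorm2 (t i)))).
  by apply: ler_sum => i _; apply: vnorm2D_le.
rewrite -mulr_sumr big_split; apply: ler_wpM2l => //.
exact: lerD.
Qed.

Lemma l2le_ext k (s t : nat -> 'cV[CC]_k) a :
  (forall i, vnorm2 (s i) = vnorm2 (t i)) -> l2le s a -> l2le t a.
Proof. by move=> e h K; under eq_bigr do rewrite -e; apply: h. Qed.

Definition trunc k N (s : nat -> 'cV[CC]_k) i := if (i < N)%N then s i else 0.

Lemma trunc_fin k N (s : nat -> 'cV[CC]_k) : fin N (trunc N s).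
Proof. by move=> i Ni; rewrite /trunc ltnNge Ni. Qed.

Lemma vnorm20 k : vnorm2 (0 : 'cV[CC]_k) = 0.
Proof. by rewrite vnorm2E rdot0l. Qed.

Lemma fin_sum k N K (s : nat -> 'cV[CC]_k) : fin N s -> (N <= K)%N ->
  \sum_(i < K) vnorm2 (s i) = \sum_(i < N) vnorm2 (s i).
Proof.
move=> fs NK; rewrite -(subnKC NK) big_split_ord /= [X in _ + X]big1 ?addr0 //.
by move=> i _; rewrite fs ?leq_addr // vnorm20.
Qed.

Lemma fin_l2 k N (s : nat -> 'cV[CC]_k) : fin N s ->
  l2 s /\ l2norm2 s = \sum_(i < N) vnorm2 (s i).
Proof.
move=> fs; have hl : series (fun i => vnorm2 (s i)) @ \oo -->
    \sum_(i < N) vnorm2 (s i).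
  apply/cvgnP => e e0; exists N => K NK.
  by rewrite /series /= big_mkord (fin_sum fs NK) subrr normr0 ltW.
by split; [apply: cvgP hl | apply: cvgn_lim].
Qed.

Lemma l2_tail k (s : nat -> 'cV[CC]_k) (e : R) : l2 s -> 0 < e ->
  exists N, forall M, (N <= M)%N -> l2le (fun i => s i - trunc M s i) e.
Proof.
move=> ls e0; have : series (fun i => vnorm2 (s i)) @ \oo --> l2norm2 s by [].
move=> /cvgnP/(_ e e0)[N hN]; exists N => M NM K.
have tE i : vnorm2 (s i - trunc M s i) = if (i < M)%N then 0 else vnorm2 (s i).
  by rewrite /trunc; case: ifP => _; rewrite ?subrr ?subr0 ?vnorm20.
apply: (@le_trans _ _ (\sum_(i < M + K) vnorm2 (s i - trunc M s i))).
  rewrite addnC big_split_ord /= lerDl; apply: sumr_ge0 => *; exact: vnorm2_ge0.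
under eq_bigr do rewrite tE.
rewrite big_split_ord /= big1 ?add0r => [|i _]; last first.
  by rewrite ltn_ord.
have := l2_le ls (M + K)%N; have := hN M NM.
rewrite /series /= big_mkord ler_norml => /andP[h1 _].
rewrite big_split_ord /= => h2.
rewrite (eq_bigr (fun i : 'I_K => vnorm2 (s (M + i)%N))) => [|i _]; first by lra.
by rewrite ltnNge leq_addr.
Qed.

Lemma vnorm2N k (w : 'cV[CC]_k) : vnorm2 (- w) = vnorm2 w.
Proof. by rewrite !vnorm2E !rdotlin opprK. Qed.

Lemma l2le0 k (e : R) : 0 <= e -> l2le (fun=> 0 : 'cV[CC]_k) e.
Proof. by move=> e0 K; rewrite big1 // => i _; rewrite vnorm20. Qed.

Lemma l2le_cons k (s : nat -> 'cV[CC]_k) e : s 0%N = 0 -> l2le (shift s) e ->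
  l2le s e.
Proof.
move=> s0 hs [|K]; first by rewrite big_ord0; apply: l2le_ge0 hs.
by rewrite big_ord_recl s0 vnorm20 add0r; apply: hs.
Qed.

(** By shift invariance it suffices to hit any vector in entry 0 exactly with a small tail: a finite
    target is matched from its last entry backwards, the tail of each new input being a small
    error. *)
Lemma dense_of_first_column r m (coef : nat -> 'M[CC]_(r, m)) :
  (forall (c : 'cV[CC]_r) (e : R), 0 < e -> exists N f, [/\ fin N f,
     toeplitz coef f 0 = c & l2le (shift (toeplitz coef f)) e]) ->
  dense_range coef.
Proof.
move=> hcol.
have dense_fin N (y : nat -> 'cV[CC]_r) : fin N y -> forall e : R, 0 < e ->
    exists M f, fin M f /\ l2le (fun i => toeplitz coef f i - y i) e.
  elim: N y => [|N IH] y fy e e0.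
    exists 0%N, (fun=> 0); split; first by [].
    apply: l2le_ext (l2le0 r (ltW e0)) => i.
    by rewrite toeplitz_eq0 // fy // subrr.
  have e4 : 0 < e / 4 by rewrite divr_gt0.
  have [M [f [ff hf]]] := IH (shift y) (fin_shift fy) _ e4.
  have [M' [g [fg g0 hg]]] := hcol (y 0%N) _ e4.
  exists (maxn M.+1 M'), (fun i => g i + prepend 0 f i); split.
    move=> i; rewrite geq_max => /andP[Mi M'i]; rewrite fg // add0r.
    by case: i Mi M'i => // i Mi _ /=; apply: ff.
  apply: l2le_cons; first by rewrite toeplitzD g0 toeplitz0 /= mulmx0 addr0 subrr.
  have := l2leD hg hf; rewrite (_ : 2 * (e / 4 + e / 4) = e); last by lra.
  apply: l2le_ext => i; congr vnorm2.
  by rewrite /shift toeplitzD (toeplitzS _ (prepend 0 f)) /= mulmx0 add0r addrA.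
(* [dense_range] asks for a strict inequality: two errors [e / 5] add up under [l2leD] to
   [4 e / 5]. *)
move=> y ly e e0; have e5 : 0 < e / 5 by rewrite divr_gt0.
have [N /(_ N (leqnn N)) hN] := l2_tail ly e5.
have [M [f [ff hf]]] := dense_fin N _ (@trunc_fin _ N y) _ e5.
exists f; split; first by have [] := fin_l2 ff.
have hN' : l2le (fun i => trunc N y i - y i) (e / 5).
  by apply: l2le_ext hN => i; rewrite -vnorm2N opprB.
have [_] := l2leP (l2leD hf hN').
have -> : (fun i => toeplitz coef f i - trunc N y i + (trunc N y i - y i))
  = (fun i => toeplitz coef f i - y i).
  by apply/funext => i; rewrite addrA subrK.
move=> h; apply: le_lt_trans h _; lra.
Qed.

End L2.

(** * Bounded states and construction of an outer factor *)

Section Outer.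
Variable R : realType.
Local Notation CC := R[i].
Variables (m n : nat) (A : 'M[CC]_n) (Gam : 'M[CC]_(n, m)) (C : 'M[CC]_(m, n))
  (R0 : 'M[CC]_m).
Hypotheses (hR0 : herm R0) (pA : psum A)
  (tau_pos : forall N h, 0 <= tau A Gam C R0 N h).

Local Notation Jb := (J A Gam C R0).

(* This turns out to be the space [X_Phi] of the outer factor built below. *)
Definition bounded_state (x : 'cV[CC]_n) := exists c : R, forall N h, Jb x N h <= c.

Lemma bounded_subspace : subspace bounded_state.
Proof.
split.
  by exists 0 => N h; rewrite /J rdot0r mulr0 sub0r oppr_le0.
move=> a x y [c hc] [d hd].
(* The estimate is [J(a x + y, h) <= l^-1 J(x, l conj(a) h) + 2 J(y, h / 2)]; it needs [tau >= 0]
   and [l |a|^2 <= 1/2]. *)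
pose l : R := (2 * (cabs2 a + 1))^-1.
have a0 := cabs2_ge0 a.
have l0 : 0 < l by rewrite invr_gt0; lra.
exists (l^-1 * c + 2 * d) => N h.
have := hc N (fun i => (real_complex R l * Num.conj a) *: h i).
have := hd N (fun i => real_complex R 2^-1 *: h i).
rewrite /J !wstZ !tauZ rdotZl -scalerA rdotZl !rdotDr.
have -> : rdot (Num.conj a *: wst A C N h) x = rdot (wst A C N h) (a *: x).
  by rewrite /rdot mxadjZ conjCK -scalemxAl -scalemxAr.
have -> : cabs2 (real_complex R 2^-1) = 4^-1 by rewrite /cabs2 /=; lra.
have -> : cabs2 (real_complex R l * Num.conj a) = l ^+ 2 * cabs2 a.
  by rewrite /cabs2 ReM ImM Re_conj Im_conj /=; ring.
have := tau_pos N h; set t := tau _ _ _ _ _ _; set p := rdot _ y; set q := rdot _ _.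
move=> t0 h1 h2.
have la : l * cabs2 a <= 2^-1.
  rewrite /l invfM -mulrA -[X in _ <= X]mulr1; apply: ler_wpM2l; first by lra.
  rewrite mulrC ler_pdivrMr; lra.
have lt : l * cabs2 a * t <= 2^-1 * t by apply: ler_wpM2r.
have : l^-1 * (2 * (l * q) - l ^+ 2 * cabs2 a * t) <= l^-1 * c.
  by apply: ler_wpM2l => //; rewrite invr_ge0 ltW.
have -> : l^-1 * (2 * (l * q) - l ^+ 2 * cabs2 a * t) = 2 * q - l * cabs2 a * t.
  by field; rewrite gt_eqF.
move=> h3; lra.
Qed.

Lemma bounded_A x : bounded_state x -> bounded_state (A *m x).
Proof.
move=> [c hc]; exists c => N h; apply: le_trans (hc N.+1 (prepend 0 h)).
by rewrite J_rec /= mulmx0 !rdot0l mulr0 subr0 add0r mulmx0 subr0.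
Qed.

(** The input [- v] moves the zero state to [Gam v], and the total payoff from 0 is [- tau <= 0];
    the cost of this first move is the bound. *)
Lemma bounded_Gam v : bounded_state (Gam *m v).
Proof.
exists (rdot v (R0 *m v)) => N h.
have : Jb 0 N.+1 (prepend (- v) h) <= 0.
  by rewrite /J rdot0r mulr0 sub0r oppr_le0 tau_pos.
rewrite J_rec /= !mulmx0 rdot0r !mulmxO !rdotlin opprK mulr0 !sub0r opprK.
set j := J _ _ _ _ _ _ _; gen_rdot; lra.
Qed.

Lemma bounded_AX x k : bounded_state x -> bounded_state (A ^+ k *m x).
Proof.
move=> bx; elim: k => [|k IH]; first by rewrite mul1mx.
by rewrite exprS -mulmxA; apply: bounded_A.
Qed.

(* Compressing the system to the invariant space of bounded states makes all its
   states bounded without changing [tau]. *)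
Lemma outer_factor : exists r (D : 'M[CC]_(r, m)) (CP : 'M[CC]_(r, n)),
  let Q := obs_gram CP A in
  [/\ (r <= m)%N,
      forall N h, tau A Gam C R0 N h = tau A Gam (CF A Gam CP D Q) (RF Gam D Q) N h,
      forall x, bounded_state x -> C *m x = CF A Gam CP D Q *m x &
      dense_range (rcoef D CP A Gam)].
Proof.
have [d [E [_ [EE XE]]]] := orthonormal_basis bounded_subspace.
pose P := E *m E^H.
have hP : herm P by apply: herm_sqr.
have XP x : bounded_state (P *m x) by apply/XE; exists (E^H *m x); rewrite mulmxA.
have PX x : bounded_state x -> P *m x = x.
  by move=> /XE[c ->]; rewrite /P -mulmxA (mulmxA E^H) EE mul1mx.
clearbody P.
have mxext a (M N : 'M[CC]_(n, a)) : (forall v : 'cV_a, M *m v = N *m v) -> M = N.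
  move=> e; apply/matrixP => i j; have /matrixP/(_ i 0) := e (delta_mx j 0).
  by rewrite -!colE !mxE.
have PAX k : P *m (A ^+ k *m P) = A ^+ k *m P.
  by apply: mxext => v; rewrite -!mulmxA PX //; apply: bounded_AX.
have PG : P *m Gam = Gam.
  by apply: mxext => v; rewrite -mulmxA PX //; apply: bounded_Gam.
pose A1 := A *m P; pose C1 := C *m P.
have PA1 : P *m A1 = A1 by have := PAX 1%N; rewrite expr1.
have wst1 N h : wst A1 C1 N h = P *m wst A C N h.
  elim: N h => [|N IH] h /=; first by rewrite mulmx0.
  rewrite IH mulmxDr !mulmxA; congr (_ + _).
    by rewrite mxadjM hP.
  by rewrite -{1}hP -mxadjM PA1 mxadjM hP.
have tau1 N h : tau A1 Gam C1 R0 N h = tau A Gam C R0 N h.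
  elim: N h => [|N IH] h; first by [].
  by rewrite [LHS]/= [RHS]/= IH wst1 rdot_adjl hP (mulmxA P) PG.
have J1 x N h : J A1 Gam C1 R0 x N h = Jb (P *m x) N h.
  by rewrite /J tau1 wst1 rdot_adjl hP.
have A1X k : A1 ^+ k *m P = A ^+ k *m P.
  elim: k => [|k IH]; first by rewrite !expr0.
  by rewrite exprS -[A1 * _]/(A1 *m _) -mulmxA IH /A1 -mulmxA PAX exprS mulmxA.
have pA1 : psum A1.
  have [S hS] := pA; have P0 := nrm_ge0 P.
  (* Powers of [A1] are powers of [A] times [P], except for exponent 0; the [+ 1] covers the
     identity. *)
  exists (S * (nrm P + 1)) => K; apply: (@le_trans _ _
    (\sum_(k < K) nrm (A ^+ k) * (nrm P + 1))); last first.
    by rewrite -mulr_suml; apply: ler_wpM2r; rewrite ?addr_ge0.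
  apply: ler_sum => -[[|k] kK] _ /=.
    by rewrite !expr0 ler_peMr ?nrm_ge0 // lerDr.
  have -> : A1 ^+ k.+1 = A ^+ k.+1 *m P.
    rewrite exprSr -[_ * A1]/(_ *m A1) -[X in _ *m X]PA1 mulmxA A1X -mulmxA PA1 /A1.
    by rewrite exprSr -[_ * A]/(_ *m A) mulmxA.
  apply: le_trans (nrmM _ _) _; apply: ler_wpM2l; first exact: nrm_ge0.
  by rewrite lerDl.
have [|r [D [CP [Q [[rm hQ QE] [C1E R0E Donto sup]]]]]] := @kyp _ _ _ A1 Gam C1 R0 hR0.
  by move=> x; have [c hc] := XP x; exists c => N h; rewrite J1.
have rcE : rcoef D CP A1 Gam = rcoef D CP A Gam.
  apply/funext => -[|j]; [by [] | rewrite /rcoef].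
  by rewrite -{1}PG -(mulmxA CP) (mulmxA _ P) A1X -(mulmxA _ P) PG mulmxA.
have norm1 N h x : fin N h -> bounded_state x ->
   series (fun k => vnorm2 (Wobs CP A x k - toeplitz (rcoef D CP A Gam) h k))
    @ \oo --> rdot x (Q *m x) - Jb x N h.
  move=> fh bx; have := @factor_norm_cvg _ _ _ _ A1 Gam CP D Q hQ QE pA1 N h x fh.
  rewrite -C1E -R0E J1 (PX x bx) rcE; apply: cvg_series_ext => k.
  have -> : Wobs CP A1 x k = Wobs CP A x k; last by [].
  by rewrite /Wobs -(PX x bx) -!(mulmxA CP) (mulmxA _ P) A1X -(mulmxA _ P).
exists r, D, CP => Q'; have hQ' := obs_gram_herm CP pA.
have QE' := obs_gram_lyap CP pA.
pose J' := J A Gam (CF A Gam CP D Q') (RF Gam D Q').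
have sub0N (a b : R) : 0 - - a = 0 - - b -> a = b by lra.
(* [Q] solves the compressed equations and [Q'] is the Gramian on the full space. Both complete the
   square of the same series, so the defects agree at bounded states. *)
have JJ' x N h : fin N h -> bounded_state x ->
    rdot x (Q *m x) - Jb x N h = rdot x (Q' *m x) - J' x N h.
  move=> fh bx; have h2 := @factor_norm_cvg _ _ _ _ A Gam CP D Q' hQ' QE' pA N h x fh.
  exact: cvgn_uniq (norm1 N h x fh bx) h2.
split; first exact: rm.
- move=> N h.
  rewrite -(@tau_ext _ _ _ _ _ _ _ N (trunc N h)) => [|i iN]; last first.
    by rewrite /trunc iN.
  rewrite -[RHS](@tau_ext _ _ _ _ _ _ _ N (trunc N h)) => [|i iN]; last first.
    by rewrite /trunc iN.
  have e := JJ' 0 N (trunc N h) (@trunc_fin _ _ N h) bounded_subspace.1.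
  by rewrite /J' !rdot0l !J0 in e; exact: sub0N e.
(* Inputs of length 0 and 1 at [x], and of length 1 at 0, isolate the linear term [<u, C x>] in the
   equality of defects. *)
- move=> x bx; apply: rdot_inj => u.
  have fu : fin 1 (fun i : nat => if i is 0%N then u else 0 : 'cV[CC]_m) by case.
  have f0 : fin 0 (fun=> 0 : 'cV[CC]_m) by [].
  have ar (a a' w w' t t' : R) : a - 0 = a' - 0 -> t = t' ->
    a - (2 * w - t) = a' - (2 * w' - t') -> w = w' by lra.
  have J00 Gam' C' R0' : J A Gam' C' R0' x 0 (fun=> 0 : 'cV[CC]_m) = 0.
    by rewrite /J /= rdot0l mulr0 subr0.
  have h0 := JJ' x 0%N _ f0 bx; have h1 := JJ' x 1%N _ fu bx.
  have ht := JJ' 0 1%N _ fu bounded_subspace.1.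
  rewrite /J' !rdot0l !J0 in ht; rewrite /J' !J00 in h0.
  have := ar _ _ _ _ _ _ h0 (sub0N _ _ ht) h1.
  by rewrite /= !mulmx0 !addr0 !(rdot_adjl _^H) !mxadjK.
(* With [D v = c], the first input [v] leaves the state [x = - Gam v]; a control within [e] of the
   supremum at [x] makes the remaining output have squared norm at most [e]. *)
apply: dense_of_first_column => c e e0.
have [v vE] := Donto c; pose x := - (Gam *m v).
have bx : bounded_state x by rewrite /x -mulmxO; apply: bounded_Gam.
have [N [g [fg hg]]] := sup x _ e0.
exists N.+1, (prepend v g); split.
- by move=> [//|i] /= Ni; apply: fg.
- by rewrite toeplitz0.
have hn := series_vnorm2_le (norm1 _ _ _ fg bx).
move=> K; apply: (@le_trans _ _ (rdot x (Q *m x) - Jb x N g)); last first.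
  by move: hg; rewrite J1 (PX x bx); lra.
apply: le_trans (hn K); rewrite le_eqVlt; apply/orP; left; apply/eqP.
apply: eq_bigr => i _; rewrite -vnorm2N /shift toeplitzS; congr vnorm2.
rewrite opprD /Wobs /x mulmxO; congr (_ - _).
by rewrite mulmxA.
Qed.

End Outer.

(** * Sufficiency *)

Section Sufficiency.
Variable R : realType.
Local Notation CC := R[i].

Lemma mxlim_vnorm2 k (F : nat -> 'cV[CC]_k) L : mxlim F L ->
  (fun j => vnorm2 (F j)) @ \oo --> vnorm2 L.
Proof.
move=> h; apply: cvgn_sum => i; rewrite /cabs2.
have hre := mxlim_Re (i := i) (j := 0) h; have him := mxlim_Im (i := i) (j := 0) h.
apply: (cvgD (f := fun j => complex.Re (F j i 0) ^+ 2)
             (g := fun j => complex.Im (F j i 0) ^+ 2)).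
  exact: (cvgM hre hre).
exact: (cvgM him him).
Qed.

Lemma mxlimBr a b (M : 'M[CC]_(a, b)) (F : nat -> 'M[CC]_(a, b)) L :
  mxlim F L -> mxlim (fun k => F k - M) (L - M).
Proof.
move=> h; apply: (mxlim_dom (c := 1)) h => k.
by rewrite opprB addrA subrK mul1r.
Qed.

Lemma vnorm2D_approx k (v w : 'cV[CC]_k) (d : R) : 0 < d ->
  vnorm2 (v + w) <= (1 + d) * vnorm2 v + (1 + d^-1) * vnorm2 w.
Proof.
move=> d0; have := rdot_ge0 (real_complex R d *: v - w).
rewrite !vnorm2E !rdotlin !(rdotC w v).
move: (rdot v v) (rdot v w) (rdot w w) => a b c h.
have : 0 <= d^-1 * (d * (d * a) - d * b - (d * b - c)).
  by apply: mulr_ge0; [rewrite invr_ge0 ltW | move: h; lra].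
have -> : d^-1 * (d * (d * a) - d * b - (d * b - c)) = d * a - 2 * b + d^-1 * c.
  by field; rewrite gt_eqF.
lra.
Qed.

Lemma l2le_approx k (s t : nat -> 'cV[CC]_k) (d a b : R) : 0 < d ->
  l2le t a -> l2le (fun i => s i - t i) b ->
  l2le s ((1 + d) * a + (1 + d^-1) * b).
Proof.
move=> d0 ht hs K; apply: (@le_trans _ _ (\sum_(i < K)
   ((1 + d) * vnorm2 (t i) + (1 + d^-1) * vnorm2 (s i - t i)))).
  apply: ler_sum => i _; have := vnorm2D_approx (t i) (s i - t i) d0.
  by rewrite addrC subrK.
rewrite big_split /= -!mulr_sumr; apply: lerD; apply: ler_wpM2l.
- by rewrite addr_ge0 // ltW.
- exact: ht.
- by rewrite addr_ge0 // invr_ge0 ltW.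
- exact: hs.
Qed.

Lemma le_of_eps (a b k : R) : 0 <= k -> (forall e, 0 < e -> a <= b + k * e) -> a <= b.
Proof.
move=> k0 h; apply/ler_addgt0Pr => e e0.
apply: le_trans (h (e / (k + 1)) _) _; first by rewrite divr_gt0 // ltr_wpDl.
rewrite lerD2l mulrA ler_pdivrMr ?ltr_wpDl // mulrC.
by apply: ler_wpM2l; [exact: ltW | rewrite lerDl].
Qed.

(** Young's inequality with parameter [d] replaces square roots: for fixed [d] the error [e] tends
    to 0, and then [d] does. *)
Lemma l2norm2_le_of_approx k l (s : nat -> 'cV[CC]_k) (t : nat -> 'cV[CC]_l) :
  (forall e : R, 0 < e -> exists N s' t', [/\ fin N s', fin N t',
     \sum_(i < N) vnorm2 (s' i) <= \sum_(i < N) vnorm2 (t' i),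
     l2le (fun i => s i - s' i) e & l2le (fun i => t i - t' i) e]) ->
  l2norm2 s <= l2norm2 t.
Proof.
move=> h.
have finle j N (f : nat -> 'cV[CC]_j) : fin N f -> l2le f (\sum_(i < N) vnorm2 (f i)).
  by move=> /fin_l2[lf <-]; apply: l2_le.
have lt : l2 t.
  have [N [s' [t' [_ /finle ft _ _ ht]]]] := h 1 ltr01.
  by have [] := l2leP (l2le_approx ltr01 ft ht).
have t0 : 0 <= l2norm2 t by apply: l2le_ge0 (l2_le lt).
have key (d e : R) : 0 < d -> d <= 1 -> 0 < e ->
    l2norm2 s <= l2norm2 t + 3 * l2norm2 t * d + 3 * (1 + d^-1) * e.
  move=> d0 d1 e0; have [N [s' [t' [fs ft st hs ht]]]] := h e e0.
  have ht' : l2le (fun i => t' i - t i) e.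
    by apply: l2le_ext ht => i; rewrite -vnorm2N opprB.
  have := l2le_approx d0 (l2_le lt) ht' N.
  have [_] := l2leP (l2le_approx d0 (finle _ _ _ fs) hs).
  move: (\sum_(i < N) vnorm2 (s' i)) (\sum_(i < N) vnorm2 (t' i)) st => a b ab.
  set S := l2norm2 s; set T := l2norm2 t in t0 *; set c := d^-1.
  have c0 : 0 <= c by rewrite invr_ge0 ltW.
  move=> h1 h2.
  have : (1 + d) * a <= (1 + d) * ((1 + d) * T + (1 + c) * e).
    by apply: ler_wpM2l; lra.
  have : 0 <= d * (1 - d) * T by rewrite !mulr_ge0; lra.
  have : 0 <= (1 - d) * ((1 + c) * e) by rewrite !mulr_ge0; lra.
  lra.
have step d : 0 < d -> d <= 1 -> l2norm2 s <= l2norm2 t + 3 * l2norm2 t * d.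
  move=> d0 d1; apply: (@le_of_eps _ _ (3 * (1 + d^-1))) => [|e e0].
    by rewrite mulr_ge0 // addr_ge0 // invr_ge0 ltW.
  exact: key.
apply: (@le_of_eps _ _ (3 * l2norm2 t)) => [|e e0]; first by rewrite mulr_ge0.
have [e1|e1] := leP e 1; first exact: step.
apply: le_trans (step 1 ltr01 (lexx _)) _; rewrite lerD2l.
by apply: ler_wpM2l; rewrite ?mulr_ge0 // ltW.
Qed.

Lemma gram_ge0 a n (A Q : 'M[CC]_n) (CP : 'M[CC]_(a, n)) x : psum A ->
  Q = CP^H *m CP + A^H *m Q *m A -> 0 <= rdot x (Q *m x).
Proof.
move=> pA QE; apply: (cvgn_le (N := 0%N) (u := fun=> 0) _ (obs_norm_cvg QE pA (x := x))).
  exact: cvg_cst.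
by move=> k _; apply: sumr_ge0 => i _; apply: vnorm2_ge0.
Qed.

Section Adjoint.
Variables (m n b : nat) (A : 'M[CC]_n) (B : 'M[CC]_(n, b)) (C : 'M[CC]_(m, n))
  (D : 'M[CC]_(m, b)).
Hypothesis pA : psum A.
Local Notation P := (ctrl_gram A B).
Local Notation ta := (tadj A B C D).

(** By [tadj_norm] the left side is [tau] minus a nonnegative Gramian term, and [tau] is bounded. *)
Lemma tadj_bound : exists2 c : R, 0 <= c & forall N h,
  \sum_(j < N) vnorm2 (ta N h j) <= c * \sum_(j < N) vnorm2 (h j).
Proof.
have [c c0 hc] := tau_bound (GamG A B C D P) C (RG C D P) pA.
exists c => // N h; apply: le_trans (hc N h).
rewrite (tadj_norm _ _ (ctrl_gram_herm B pA) (ctrl_gram_lyap B pA)) lerBlDr lerDl.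
rewrite ctrl_gramE; apply: (gram_ge0 _ (psum_adj pA)).
exact: (obs_gram_lyap _ (psum_adj pA)).
Qed.

Lemma tadj_trunc_cvg x u : toeplitz_adj_is (rcoef D C A B) x u ->
  forall j, mxlim (fun M => ta M (trunc M x) j) (u j).
Proof.
(* Truncating at [j.+1 + k] keeps exactly the first [k.+1] terms of the series for entry [j], hence
   the two index shifts. *)
move=> /toeplitz_adjP hx j; rewrite /mxlim; apply: (cvgnDn _ _ j.+1).1.
have := (cvgnS (fun K => nrm (\sum_(t < K) (rcoef D C A B t)^H *m x (j + t)%N - u j))
  0).2 (hx j).
apply: (cvgn_dom (c := 1)) => k; rewrite subr0 mul1r ger0_norm ?nrm_ge0 //.
have NK : (j.+1 + k <= j + k.+1)%N by rewrite addSnnS.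
rewrite -(tadj_sum A B C D (@trunc_fin _ _ (j.+1 + k) x) NK).
rewrite le_eqVlt; apply/orP; left; apply/eqP; congr (nrm (_ - _)).
rewrite [LHS]big_ord_recr /= addSnnS trunc_fin // mulmx0 addr0.
by apply: eq_bigr => t _; rewrite /trunc ltn_add2l ltn_ord.
Qed.

Lemma tadj_sub M N x j : (N <= M)%N ->
  ta M (trunc M x) j - ta N (trunc N x) j =
  ta M (fun i => trunc M x i - trunc N x i) j.
Proof.
move=> NM.
have fN : fin M (trunc N x) by move=> i Mi; apply: trunc_fin; apply: leq_trans Mi.
have fd : fin M (fun i => trunc M x i - trunc N x i).
  by move=> i Mi; rewrite (fN i Mi) (@trunc_fin _ _ M x i Mi) subrr.
have MK : (M <= j + M)%N by apply: leq_addl.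
have NK : (N <= j + M)%N by apply: leq_trans MK.
rewrite -(tadj_sum A B C D (@trunc_fin _ _ M x) MK).
rewrite -(tadj_sum A B C D (@trunc_fin _ _ N x) NK) -(tadj_sum A B C D fd MK).
by rewrite -sumrB; apply: eq_bigr => t _; rewrite mulmxB.
Qed.

(** Entrywise, [u] is the limit over [M] of the images of truncations; their distance to the image
    of the [N]-truncation is bounded by the tail of [x], uniformly in [M]. *)
Lemma tadj_approx x u : l2 x -> toeplitz_adj_is (rcoef D C A B) x u ->
  forall e : R, 0 < e -> exists N0, forall N, (N0 <= N)%N ->
  l2le (fun j => u j - ta N (trunc N x) j) e.
Proof.
move=> lx hu e e0; have [c c0 hc] := tadj_bound.
have ec : 0 < e / (c + 1) by rewrite divr_gt0 // ltr_wpDl.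
have [N0 hN0] := l2_tail lx ec; exists N0 => N NN K.
have lim j := mxlim_vnorm2 (mxlimBr (ta N (trunc N x) j) (tadj_trunc_cvg hu j)).
have := @cvgn_sum _ _ (index_enum 'I_K) (fun j M => vnorm2 (ta M (trunc M x) j
  - ta N (trunc N x) j)) _ (fun j : 'I_K => lim j).
move=> hl; apply: (cvgn_le (N := maxn N K) hl (v := fun=> e)); first exact: cvg_cst.
move=> M; rewrite geq_max => /andP[NM KM].
apply: (@le_trans _ _ (\sum_(j < M) vnorm2 (ta M (fun i => trunc M x i - trunc N x i) j))).
  rewrite (eq_bigr (fun j : 'I_K => vnorm2 (ta M (fun i => trunc M x i - trunc N x i) j))).
    rewrite -(subnKC KM) big_split_ord /= lerDl; apply: sumr_ge0 => *.
    exact: vnorm2_ge0.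
  by move=> j _; rewrite tadj_sub.
apply: le_trans (hc M _) _.
apply: (@le_trans _ _ (c * (e / (c + 1)))); last first.
  rewrite mulrA ler_pdivrMr ?ltr_wpDl // mulrC.
  by apply: ler_wpM2l; [exact: ltW | rewrite lerDl].
apply: ler_wpM2l => //; apply: le_trans (hN0 N NN M).
apply: ler_sum => i _; rewrite /trunc ltn_ord; exact: lexx.
Qed.

End Adjoint.

End Sufficiency.

Section Pairing.
Variable R : realType.
Local Notation CC := R[i].

Lemma toeplitz_pairing k l (coef : nat -> 'M[CC]_(k, l)) (y : nat -> 'cV[CC]_k) u N h :
  toeplitz_adj_is coef y u -> fin N h ->
  (fun K => \sum_(i < K) rdot (toeplitz coef h i) (y i)) @ \oo -->
  \sum_(t < N) rdot (h t) (u t).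
Proof.
move=> /toeplitz_adjP; elim: N y u h => [|N IH] y u h hu fh.
  rewrite big_ord0; apply/cvgnP => e e0; exists 0%N => K _.
  by rewrite big1 ?subrr ?normr0 ?ltW // => i _; rewrite toeplitz_eq0 // rdot0l.
apply/cvgnS; rewrite big_ord_recl /=.
have E K : \sum_(i < K.+1) rdot (toeplitz coef h i) (y i) =
    rdot (h 0%N) ((\sum_(t < K.+1) (coef t)^H *m y (0 + t)%N) *m 1%:M) +
    \sum_(i < K) rdot (toeplitz coef (shift h) i) (shift y i).
  rewrite mulmx1 !big_ord_recl /= toeplitz0 rdotDr -addrA (rdot_adjl (coef 0%N)).
  congr (_ + _).
  have -> : rdot (h 0%N) (\sum_(i < K) (coef (bump 0 i))^H *m y (0 + bump 0 i)%N) =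
      \sum_(i < K) rdot (h 0%N) ((coef i.+1)^H *m y i.+1).
    elim/big_rec2: _ => [|i a b _ <-]; first by rewrite rdot0r.
    by rewrite rdotDr.
  rewrite -big_split; apply: eq_bigr => i _ /=.
  by rewrite toeplitzS rdotDl -(rdot_adjl (coef i.+1)).
under eq_fun do rewrite E.
apply: cvgD.
  have := mxlim_rdot (u := h 0%N) (v := 1%:M) ((mxlimS _ _).2 (hu 0%N)).
  by rewrite mulmx1.
apply: (IH (shift y) (shift u) (shift h)); last exact: fin_shift.
by move=> j; exact: hu j.+1.
Qed.

(** The adjoint series reassembles the Gramian. Thus the requirement on [C_Phi] says that [C] and
    [CF] have the same observability sequences on [X_Phi]. *)
Lemma factor_adj m n r (A : 'M[CC]_n) (Gam : 'M[CC]_(n, m)) (CP : 'M[CC]_(r, n))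
    (D : 'M[CC]_(r, m)) x : psum A ->
  toeplitz_adj_is (rcoef D CP A Gam) (Wobs CP A x)
    (Wobs (CF A Gam CP D (obs_gram CP A)) A x).
Proof.
move=> pA; apply/toeplitz_adjP => j; apply/mxlimS.
have := mxlimDl (D^H *m CP *m A ^+ j *m x) (mxlimMr (A *m A ^+ j *m x)
  (mxlimMl Gam^H (obs_gram_lim CP pA))).
have -> : D^H *m CP *m A ^+ j *m x + Gam^H *m obs_gram CP A *m (A *m A ^+ j *m x) =
    Wobs (CF A Gam CP D (obs_gram CP A)) A x j.
  by rewrite /Wobs /CF !mulmxDl !mulmxA.
congr mxlim; apply/funext => K.
rewrite big_ord_recl /= addn0 /Wobs !mulmxA; congr (_ + _).
rewrite mulmx_sumr !mulmx_suml; apply: eq_bigr => i _.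
rewrite /bump /= ?add1n !mxadjM mxadjX -!mulmxA; do 4 congr (_ *m _).
by rewrite -addSnnS addnC exprD -[_ * A ^+ j.+1]/(_ *m _) exprS -[A * _]/(A *m _) !mulmxA.
Qed.

Lemma mxlim_cst a b (F : nat -> 'M[CC]_(a, b)) L :
  mxlim F L -> (forall k, F k = 0) -> L = 0.
Proof.
move=> h F0; apply: (mxlim_uniq h); apply/cvgnP => e e0; exists 0%N => k _.
by rewrite F0 subrr nrm0 subrr normr0 ltW.
Qed.

End Pairing.

(** * The realization data, [X_Phi] and [Delta] *)

Section Data.
Variable R : realType.
Local Notation CC := R[i].
Variables (m p q n : nat) (A : 'M[CC]_n) (B1 : 'M[CC]_(n, p)) (B2 : 'M[CC]_(n, q))
  (C : 'M[CC]_(m, n)) (D1 : 'M[CC]_(m, p)) (D2 : 'M[CC]_(m, q)).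
Hypothesis pA : psum A.

Local Notation P1 := (P1 A B1).
Local Notation P2 := (P2 A B2).
Local Notation G := (Gamma A B1 B2 C D1 D2).
Local Notation Rf := (Rfun A B1 B2 C D1 D2).

(** The constant coefficient [R_0] of the symbol, grouped by the two factors. *)
Definition Rconst := RG C D1 P1 - RG C D2 P2.

Lemma P1_herm : herm P1. Proof. exact: ctrl_gram_herm. Qed.
Lemma P2_herm : herm P2. Proof. exact: ctrl_gram_herm. Qed.

Lemma Rconst_herm : herm Rconst.
Proof. by apply: hermB; apply: RG_herm; [exact: P1_herm | exact: P2_herm]. Qed.

Lemma GammaE : G = GamG A B1 C D1 P1 - GamG A B2 C D2 P2.
Proof.
by rewrite /Gamma /GamG mulmxBr mulmxBl opprD addrACA.
Qed.

Lemma Rfun_herm z : herm (Rf z).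
Proof. by apply: hermB; apply: herm_sqr. Qed.

Lemma Rfun_quad (z : CC) (v : 'cV[CC]_m) : `|z| = 1 -> rdot v (Rf z *m v) = Fq A G C Rconst z v.
Proof.
move=> z1; rewrite GammaE Fq_sub.
apply: etrans (f_equal2 (fun a b => a - b)
  (cofactor_circle C D1 P1_herm (ctrl_gram_lyap B1 pA) pA v z1)
  (cofactor_circle C D2 P2_herm (ctrl_gram_lyap B2 pA) pA v z1)).
rewrite /Rfun mulBmx rdotDr rdotNr !vnorm2E -!mulmxA.
by rewrite (rdot_adj (Gfun _ _ _ _ _)) (rdot_adj (Kfun _ _ _ _ _)).
Qed.

Lemma tau_split N h : tau A G C Rconst N h =
  tau A (GamG A B1 C D1 P1) C (RG C D1 P1) N h -
  tau A (GamG A B2 C D2 P2) C (RG C D2 P2) N h.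
Proof. by rewrite GammaE tau_sub. Qed.

Lemma tadj_diff N h :
  \sum_(j < N) vnorm2 (tadj A B1 C D1 N h j) - \sum_(j < N) vnorm2 (tadj A B2 C D2 N h j)
  = tau A G C Rconst N h - rdot (wst A C N h) ((P1 - P2) *m wst A C N h).
Proof.
rewrite tau_split mulBmx rdotDr rdotNr.
apply: etrans (f_equal2 (fun a b => a - b)
  (tadj_norm C D1 P1_herm (ctrl_gram_lyap B1 pA) N h)
  (tadj_norm C D2 P2_herm (ctrl_gram_lyap B2 pA) N h)) _.
have ar (a b c d : R) : a - c - (b - d) = a - b - (c - d) by ring.
exact: ar.
Qed.

Lemma toeplitz_diff_nonnegP : toeplitz_diff_nonneg A B1 B2 C D1 D2 <->
  forall N h, rdot (wst A C N h) ((P1 - P2) *m wst A C N h) <= tau A G C Rconst N h.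
Proof.
split=> [T N h|T].
  have e i : (i < N)%N -> h i = trunc N h i by move=> iN; rewrite /trunc iN.
  rewrite (wst_ext A C e) (tau_ext A G C Rconst e) -subr_ge0 -tadj_diff subr_ge0.
  have fh := @trunc_fin _ _ N h.
  have [lh _] := fin_l2 fh.
  have := T _ lh _ _ (tadj_adj A B1 C D1 fh) (tadj_adj A B2 C D2 fh).
  have [_ ->] := fin_l2 (tadj_fin A B1 C D1 fh).
  by have [_ ->] := fin_l2 (tadj_fin A B2 C D2 fh).
move=> x lx u v hu hv; apply: l2norm2_le_of_approx => e e0.
have [N1 h1] := tadj_approx pA lx hu e0; have [N2 h2] := tadj_approx pA lx hv e0.
pose N := maxn N1 N2; have fh := @trunc_fin _ _ N x.
exists N, (tadj A B2 C D2 N (trunc N x)), (tadj A B1 C D1 N (trunc N x)); split.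
- exact: tadj_fin.
- exact: tadj_fin.
- by rewrite -subr_ge0 tadj_diff subr_ge0 T.
- by apply: h2; apply: leq_maxr.
- by apply: h1; apply: leq_maxl.
Qed.

Lemma wst_tau_factor r (D : 'M[CC]_(r, m)) (CP : 'M[CC]_(r, n)) x N h :
  let C' := CF A G CP D (obs_gram CP A) in
  (forall j, Wobs C A x j = Wobs C' A x j) ->
  rdot (wst A C N h) x = rdot (wst A C' N h) x.
Proof. by move=> C' e; rewrite !rdot_wst; apply: eq_bigr => t _; rewrite e. Qed.

Section Factor.
Variables (r : nat) (D : 'M[CC]_(r, m)) (CP : 'M[CC]_(r, n)).
Local Notation Q := (obs_gram CP A).
Local Notation C' := (CF A G CP D Q).
Local Notation R0' := (RF G D Q).
Hypothesis tauE : forall N h, tau A G C Rconst N h = tau A G C' R0' N h.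

(** If [W_obs x = T_Phi^* y], then [J(x, h) = 2 Re <T_Phi h, y> - |T_Phi h|^2 <= |y|^2]. *)
Lemma XPhi_bounded x : XPhi A B1 B2 C D1 D2 D CP x ->
  bounded_state A G C Rconst x.
Proof.
move=> [y [ly hy]]; exists (l2norm2 y) => N h.
pose g := trunc N h; have fg := @trunc_fin _ _ N h : fin N g.
have e i : (i < N)%N -> h i = g i by move=> iN; rewrite /g /trunc iN.
have -> : J A G C Rconst x N h = J A G C Rconst x N g.
  by rewrite /J (wst_ext A C e) (tau_ext A G C Rconst e).
have h1 := toeplitz_pairing hy fg; rewrite -rdot_wst in h1.
have h2 := @factor_toeplitz_cvg _ _ _ _ A G CP D Q (obs_gram_herm CP pA)
  (obs_gram_lyap CP pA) pA N g fg.
rewrite -tauE in h2.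
have h3 : (fun K => 2 * \sum_(i < K) rdot (toeplitz (Phicoef A B1 B2 C D1 D2 D CP) g i) (y i)
   - series (fun i => vnorm2 (toeplitz (rcoef D CP A G) g i)) K) @ \oo -->
   J A G C Rconst x N g.
  by apply: cvgB => //; apply: cvgM => //; exact: cvg_cst.
apply: (cvgn_le (N := 0%N) h3 (v := fun=> l2norm2 y)); first exact: cvg_cst.
move=> K _; apply: le_trans (l2_le ly K).
rewrite /series /= big_mkord mulr_sumr -sumrB; apply: ler_sum => i _.
rewrite !vnorm2E lerBlDl; apply: rdot_sub_sqr.
Qed.

Lemma Wobs_factor x : (toeplitz_adj_is (rcoef D CP A G) (Wobs CP A x) (Wobs C A x)) ->
  forall j, Wobs C A x j = Wobs C' A x j.
Proof.
move=> /toeplitz_adjP h j; apply: (mxlim_uniq (h j)).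
by have /toeplitz_adjP := factor_adj G CP D x pA; apply.
Qed.

Lemma J_factor x N h : (forall j, Wobs C A x j = Wobs C' A x j) ->
  J A G C Rconst x N h = J A G C' R0' x N h.
Proof. by move=> e; rewrite /J tauE (wst_tau_factor _ _ e). Qed.

Hypothesis obsC : observable C A.

(** A kernel vector gives a state with zero [CP]-output; applying [T_Phi^*] its [C]-output vanishes
    too, and observability finishes. *)
Lemma gram_unit d (E : 'M[CC]_(n, d)) : E^H *m E = 1%:M ->
  (forall c : 'cV_d, toeplitz_adj_is (rcoef D CP A G) (Wobs CP A (E *m c))
     (Wobs C A (E *m c))) ->
  E^H *m Q *m E \in unitmx.
Proof.
move=> EE adjE; apply: inj_unitmx => c Oc.
have q0 : rdot (E *m c) (Q *m (E *m c)) = 0.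
  by rewrite rdot_adjl !mulmxA Oc rdot0r.
have W0 k : Wobs CP A (E *m c) k = 0.
  apply: rdot_eq0; rewrite -vnorm2E; apply/eqP; rewrite eq_le vnorm2_ge0 andbT.
  have h := series_vnorm2_le (obs_norm_cvg (obs_gram_lyap CP pA) pA (x := E *m c)).
  rewrite q0 in h; apply: le_trans (h k.+1).
  by rewrite big_ord_recr /= lerDr; apply: sumr_ge0 => *; apply: vnorm2_ge0.
have Ec : E *m c = 0.
  apply: obsC => j; have /toeplitz_adjP/(_ j) := adjE c.
  by move=> /mxlim_cst; apply => K; rewrite big1 // => t _; rewrite W0 mulmx0.
by rewrite -[c]mul1mx -EE -mulmxA Ec mulmx0.
Qed.

Section Delta.
Variables (d : nat) (E : 'M[CC]_(n, d)).
Hypothesis uO : E^H *m Q *m E \in unitmx.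
Local Notation Dl := (Delta A CP E).

Lemma Delta_herm : herm Dl.
Proof.
rewrite /Delta; apply: herm_conjr; rewrite /herm mxadj_inv; congr invmx.
exact: (herm_conj _ (obs_gram_herm CP pA)).
Qed.

(** This is [Delta Q Delta = Delta]: the inner [E^H Q E] cancels one of the two inverses. *)
Lemma Delta_quad w : rdot (Dl *m w) (Q *m (Dl *m w)) = rdot w (Dl *m w).
Proof.
rewrite rdot_adjl Delta_herm; congr rdot; rewrite [LHS]mulmxA [LHS]mulmxA.
congr (_ *m _); rewrite /Delta [LHS]mulmxA [X in X *m E^H]mulmxA -(mulmxA _ E^H Q) -(mulmxA _ (E^H *m Q) E).
by rewrite mulmxKV.
Qed.

End Delta.
End Factor.
End Data.

Section Sufficient.
Variable R : realType.
Local Notation CC := R[i].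
Variables (m p q n : nat) (A : 'M[CC]_n) (B1 : 'M[CC]_(n, p)) (B2 : 'M[CC]_(n, q))
  (C : 'M[CC]_(m, n)) (D1 : 'M[CC]_(m, p)) (D2 : 'M[CC]_(m, q)).
Hypotheses (pA : psum A) (obsC : observable C A).

Local Notation P1 := (P1 A B1).
Local Notation P2 := (P2 A B2).
Local Notation G := (Gamma A B1 B2 C D1 D2).
Local Notation Rc := (Rconst A B1 B2 C D1 D2).
Local Notation XP := (XPhi A B1 B2 C D1 D2).

Lemma quadD k (M N : 'M[CC]_k) (w : 'cV[CC]_k) :
  rdot w ((M + N) *m w) = rdot w (M *m w) + rdot w (N *m w).
Proof. by rewrite mulmxDl rdotDr. Qed.

Lemma quadB k (M N : 'M[CC]_k) (w : 'cV[CC]_k) :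
  rdot w ((M - N) *m w) = rdot w (M *m w) - rdot w (N *m w).
Proof. by rewrite mulBmx rdotDr rdotNr. Qed.

Lemma Delta_lower_bound r (D : 'M[CC]_(r, m)) (CP : 'M[CC]_(r, n)) d (E : 'M[CC]_(n, d))
    N h : let Q := obs_gram CP A in
  (forall N h, tau A G C Rc N h = tau A G (CF A G CP D Q) (RF G D Q) N h) ->
  (forall x j, XP D CP x -> Wobs C A x j = Wobs (CF A G CP D Q) A x j) ->
  E^H *m Q *m E \in unitmx -> onb_of E (XP D CP) ->
  rdot (wst A C N h) (Delta A CP E *m wst A C N h) <= tau A G C Rc N h.
Proof.
move=> Q tauE WE uO [EE XE].
have e i : (i < N)%N -> h i = trunc N h i by move=> iN; rewrite /trunc iN.
rewrite (wst_ext A C e) (tau_ext A G C Rc e).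
have fh := @trunc_fin _ _ N h; move: (trunc N h) fh => g fg {e}.
set w := wst A C N g; pose x := Delta A CP E *m w.
have Xx : XP D CP x.
  by apply/XE; exists (invmx (E^H *m Q *m E) *m (E^H *m w)); rewrite /x /Delta !mulmxA.
have := @factor_J_le _ _ _ _ A G CP D Q (obs_gram_herm CP pA) (obs_gram_lyap CP pA)
  pA N g x fg.
rewrite -(J_factor tauE N g (fun j => WE x j Xx)) /J -/w {2 3}/x.
rewrite (Delta_quad pA uO w) /x.
have ar (a t : R) : 2 * a - t <= a -> a <= t by lra.
exact: ar.
Qed.

Lemma sufficient : cond_i A B1 B2 C D1 D2 -> cond_ii A B1 B2 C D1 D2 ->
  toeplitz_diff_nonneg A B1 B2 C D1 D2.
Proof.
move=> ci [cz cnz]; apply/(toeplitz_diff_nonnegP B1 B2 C D1 D2 pA).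
have tpos N h : 0 <= tau A G C Rc N h.
  apply: tau_ge0 => // z v z1; rewrite -(Rfun_quad B1 B2 C D1 D2 pA v z1).
  by apply: (psdP (Rfun_herm A B1 B2 C D1 D2 z)).1 => //; apply: ci.
have hP1 := P1_herm B1 pA; have hP2 := P2_herm B2 pA.
have ar (x y a b : R) : x = b - a -> y = a - b -> 0 <= x -> y <= 0 by lra.
have [/cz rz|/cnz rnz] := pselect (R_zero A B1 B2 C D1 D2).
  move=> N h; apply: le_trans (tpos N h).
  have h0 := (psdP (hermB hP2 hP1)).1 rz (wst A C N h).
  exact: ar (quadB _ _ _) (quadB _ _ _) h0.
have hRc := Rconst_herm B1 B2 C D1 D2 pA.
have [r [D [CP [rm tauE CE dense]]]] := outer_factor hRc pA tpos.
have WE x : bounded_state A G C Rc x -> forall j, Wobs C A x j =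
    Wobs (CF A G CP D (obs_gram CP A)) A x j.
  move=> bx j; rewrite /Wobs -!mulmxA; apply: CE.
  exact: bounded_AX.
have adjX x : bounded_state A G C Rc x ->
    toeplitz_adj_is (rcoef D CP A G) (Wobs CP A x) (Wobs C A x).
  by move=> /WE /funext ->; apply: factor_adj.
have XB x : XP D CP x <-> bounded_state A G C Rc x.
  split; first exact: XPhi_bounded.
  move=> bx; exists (Wobs CP A x); split; last exact: adjX.
  by have [] := l2leP (series_vnorm2_le (obs_norm_cvg (obs_gram_lyap CP pA) pA (x := x))).
have adm : admissible A B1 B2 C D1 D2 D CP.
  split=> [|z z1||x /XB bx]; [exact: rm| |exact: dense|exact: adjX].
  (* [R = Phi^* Phi] on the circle is recovered from equality of the Toeplitz forms by averaging
     along exponential inputs. *)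
  apply: herm_ext; [exact: Rfun_herm|exact: herm_sq|move=> v].
  rewrite (Rfun_quad B1 B2 C D1 D2 pA v z1) (Fq_eq_of_tau v pA tauE z1).
  apply: etrans (esym (@factor_circle _ _ _ _ A G CP D _ (obs_gram_herm CP pA)
    (obs_gram_lyap CP pA) pA z v z1)) _.
  by rewrite vnorm2E -mulmxA (rdot_adj _^H) mxadjK.
have [d [E [_ [EE XE]]]] := orthonormal_basis (bounded_subspace tpos).
have onb : onb_of E (XP D CP).
  by split=> // x; split=> [/XB/XE|/XE/XB].
have uO : E^H *m obs_gram CP A *m E \in unitmx.
  by apply: (gram_unit pA obsC EE) => c; apply: adjX; apply/XE; exists c.
have pD := rnz r D CP adm d E onb => N h.
have := Delta_lower_bound N h tauE (fun x j Xx => WE x ((XB x).1 Xx) j) uO onb.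
apply: le_trans; have hD := Delta_herm pA CP E.
have h0 := (psdP (hermB (hermD hD hP2) hP1)).1 pD (wst A C N h).
have ar2 (x y z a b c : R) : x = z - c -> z = a + b -> y = c - b -> 0 <= x -> y <= a.
  by lra.
exact: ar2 (quadB _ _ _) (quadD _ _ _) (quadB _ _ _) h0.
Qed.

End Sufficient.

(** * Necessity *)

Section InnerProduct.
Variable R : realType.
Local Notation CC := R[i].

Definition ip k (s t : nat -> 'cV[CC]_k) : R :=
  limn (series (fun i => rdot (s i) (t i))).

Lemma rdot_abs k (u v : 'cV[CC]_k) : `|rdot u v| <= vnorm2 u + vnorm2 v.
Proof.
have h1 := rdot_sub_sqr u v; have h2 := rdot_sub_sqr (- u) v.
have h3 := rdot_ge0 u; have h4 := rdot_ge0 v.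
move: h1 h2 h3 h4; rewrite !vnorm2E !rdotlin opprK ler_norml; gen_rdot => *.
by apply/andP; split; lra.
Qed.

Lemma ip_cvg k (s t : nat -> 'cV[CC]_k) : l2 s -> l2 t ->
  series (fun i => rdot (s i) (t i)) @ \oo --> ip s t.
Proof.
move=> ls lt.
have [l hl] : exists l : R, series (fun i => rdot (s i) (t i)) @ \oo --> l.
  apply: (@cvg_series_abs _ _ (fun i => vnorm2 (s i) + vnorm2 (t i))
    (l2norm2 s + l2norm2 t)) => [i|K]; first exact: rdot_abs.
  by rewrite big_split; apply: lerD; apply: l2_le.
by rewrite /ip (cvgn_lim hl).
Qed.

Lemma l2D k (s t : nat -> 'cV[CC]_k) : l2 s -> l2 t -> l2 (fun i => s i + t i).
Proof. by move=> ls lt; have [] := l2leP (l2leD (l2_le ls) (l2_le lt)). Qed.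

Lemma l2Z k (c : R) (s : nat -> 'cV[CC]_k) : l2 s ->
  l2 (fun i => real_complex R c *: s i).
Proof.
move=> ls.
have h : l2le (fun i => real_complex R c *: s i) (c ^+ 2 * l2norm2 s).
  move=> K; under eq_bigr do rewrite vnorm2E !rdotlin mulrA -expr2 -vnorm2E.
  by rewrite -mulr_sumr; apply: ler_wpM2l; [exact: sqr_ge0 | exact: l2_le].
by have [] := l2leP h.
Qed.

Lemma ipC k (s t : nat -> 'cV[CC]_k) : ip s t = ip t s.
Proof. by rewrite /ip; congr (limn (series _)); apply/funext => i; rewrite rdotC. Qed.

Lemma l2norm2E k (s : nat -> 'cV[CC]_k) : l2norm2 s = ip s s.
Proof.
by rewrite /ip /l2norm2; congr (limn (series _)); apply/funext => i; rewrite vnorm2E.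
Qed.

Lemma ip_lin k (c : R) (s t z : nat -> 'cV[CC]_k) : l2 s -> l2 t -> l2 z ->
  ip (fun i => real_complex R c *: s i + t i) z = c * ip s z + ip t z.
Proof.
move=> ls lt lz.
apply: (@cvgn_uniq _ (series (fun i => rdot (real_complex R c *: s i + t i) (z i)))).
  by apply: ip_cvg => //; apply: l2D => //; apply: l2Z.
have -> : series (fun i => rdot (real_complex R c *: s i + t i) (z i)) =
  (fun K => c * series (fun i => rdot (s i) (z i)) K +
     series (fun i => rdot (t i) (z i)) K).
  apply/funext => K; rewrite /series /= mulr_sumr -big_split.
  by apply: eq_bigr => i _; rewrite !rdotlin.
apply: cvgD; last exact: ip_cvg.
by apply: cvgM; [exact: cvg_cst | exact: ip_cvg].
Qed.

Lemma norm_lin k (c : R) (s t : nat -> 'cV[CC]_k) : l2 s -> l2 t ->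
  l2norm2 (fun i => real_complex R c *: s i + t i) =
  c ^+ 2 * l2norm2 s + 2 * c * ip s t + l2norm2 t.
Proof.
move=> ls lt; rewrite !l2norm2E.
have lst : l2 (fun i => real_complex R c *: s i + t i) by apply: l2D => //; apply: l2Z.
rewrite (ip_lin c ls lt lst) (ipC s) (ipC t) (ip_lin c ls lt ls) (ip_lin c ls lt lt).
by rewrite (ipC t s); move: (ip s s) (ip s t) (ip t t) => x y z; ring.
Qed.

Lemma l2norm2_ge0 k (s : nat -> 'cV[CC]_k) : l2 s -> 0 <= l2norm2 s.
Proof. by move=> ls; apply: l2le_ge0 (l2_le ls). Qed.

Lemma ip_le k (s t : nat -> 'cV[CC]_k) : l2 s -> l2 t ->
  2 * ip s t <= l2norm2 s + l2norm2 t.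
Proof.
move=> ls lt; have := l2norm2_ge0 (l2D (l2Z (c := -1) ls) lt).
by rewrite norm_lin //; lra.
Qed.

Lemma cauchy_real (x : nat -> R) (e : nat -> R) : e @ \oo --> (0 : R) ->
  (forall k l, `|x k - x l| ^+ 2 <= e k + e l) -> exists L : R, x @ \oo --> L.
Proof.
move=> /cvgnP he hx; exists (limn x); apply/cauchy_cvgP; apply: cauchy_exP => eps eps0.
have e2 : 0 < eps ^+ 2 / 4 by rewrite divr_gt0 // exprn_gt0.
have [N hN] := he _ e2; exists (x N); exists N => // k /= Nk.
rewrite /ball /=; have := hx N k; have := hN N (leqnn N); have := hN k Nk.
rewrite !subr0 !ler_norml => /andP[_ h1] /andP[_ h2] h3.
rewrite -(@ltr_pXn2r _ 2) ?nnegrE ?normr_ge0 ?ltW //.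
have : 0 < eps ^+ 2 by rewrite exprn_gt0.
lra.
Qed.

(** Completeness with a rate: letting [l] tend to infinity in each partial sum turns the bound
    [e j + e l] into [e j]. *)
Lemma l2_complete k (f : nat -> nat -> 'cV[CC]_k) (e : nat -> R) :
  e @ \oo --> (0 : R) -> (forall j l, l2le (fun i => f j i - f l i) (e j + e l)) ->
  exists z, forall j, l2le (fun i => f j i - z i) (e j).
Proof.
move=> he hf.
have ent i j l (a : 'I_k) : cabs2 (f j i a 0 - f l i a 0) <= e j + e l.
  apply: le_trans (hf j l i.+1); rewrite big_ord_recr /=.
  apply: (@le_trans _ _ (vnorm2 (f j i - f l i))); last first.
    by rewrite lerDr; apply: sumr_ge0 => *; apply: vnorm2_ge0.
  rewrite /vnorm2 (bigD1 a) //= !mxE lerDl.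
  by apply: sumr_ge0 => *; apply: cabs2_ge0.
have /choice[zr hr] : forall ia : nat * 'I_k, exists L : R,
    (fun j => complex.Re (f j ia.1 ia.2 0)) @ \oo --> L.
  move=> [i a]; apply: (cauchy_real he) => j l; apply: le_trans (ent i j l a).
  by rewrite -ReN -ReD real_normK ?num_real // lerDl sqr_ge0.
have /choice[zi hi] : forall ia : nat * 'I_k, exists L : R,
    (fun j => complex.Im (f j ia.1 ia.2 0)) @ \oo --> L.
  move=> [i a]; apply: (cauchy_real he) => j l; apply: le_trans (ent i j l a).
  by rewrite -ImN -ImD real_normK ?num_real // lerDr sqr_ge0.
pose z i : 'cV[CC]_k := \col_a Complex (zr (i, a)) (zi (i, a)).
have zlim i : mxlim (fun j => f j i) (z i).
  apply: mxlim_entries => a b; rewrite mxE ord1 /=.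
    exact: (hr (i, a)).
  exact: (hi (i, a)).
have vE j i : mxlim (fun l => f l i - f j i) (z i - f j i) by apply: mxlimBr.
exists z => j K.
have := @cvgn_sum _ _ (index_enum 'I_K) (fun i l => vnorm2 (f l i - f j i)) _
  (fun i : 'I_K => mxlim_vnorm2 (vE j i)).
move=> h.
have -> : \sum_(i < K) vnorm2 (f j i - z i) = \sum_(i < K) vnorm2 (z i - f j i).
  by apply: eq_bigr => i _; rewrite -vnorm2N opprB.
have he' : (fun l => e l + e j) @ \oo --> e j.
  by rewrite -{2}[e j]add0r; apply: cvgD => //; exact: cvg_cst.
by apply: (cvgn_le (N := 0%N) h he') => l _; apply: hf.
Qed.

Lemma approx_norm k (f : nat -> nat -> 'cV[CC]_k) (e : nat -> R) z :
  e @ \oo --> (0 : R) -> (forall j, l2 (f j)) ->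
  (forall j, l2le (fun i => f j i - z i) (e j)) ->
  l2 z /\ forall s, l2 s -> (fun j => ip s (f j)) @ \oo --> ip s z.
Proof.
move=> he lf hz.
have lz : l2 z.
  have h1 : l2le (fun i => z i - f 0%N i) (e 0%N).
    by apply: l2le_ext (hz 0%N) => i; rewrite -vnorm2N opprB.
  by have [] := l2leP (l2le_approx ltr01 (l2_le (lf 0%N)) h1).
split=> // s ls; apply/cvgnP => eps eps0.
pose S := l2norm2 s; have S0 : 0 <= S by apply: l2norm2_ge0.
pose d := eps / (S + 1); have d0 : 0 < d by rewrite divr_gt0 // ltr_wpDl.
have /cvgnP/(_ (d * eps)) [|N hN] := he; first by rewrite mulr_gt0.
exists N => j Nj.
have [ld le] := l2leP (hz j).
have eN := hN j Nj; rewrite subr0 ler_norml in eN; move/andP: eN => [_ eN].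
have -> : ip s (f j) - ip s z = ip s (fun i => f j i - z i).
  have -> : (fun i => f j i - z i) = (fun i => real_complex R (-1) *: z i + f j i).
    apply/funext => i; rewrite (_ : real_complex R (-1) = -1) ?scaleN1r 1?addrC //.
    by rewrite rmorphN1.
  rewrite [RHS]ipC (ip_lin (-1) lz (lf j) ls) (ipC s (f j)) (ipC s z).
  by move: (ip z s) (ip (f j) s) => a b; ring.
set t := fun i => _; rewrite -/t in ld le.
(* Nonnegativity of the norm of [c s + t] at [c = d] and [c = - d] is a weighted Cauchy-Schwarz
   inequality; [d] is chosen so that both squared terms are at most [d * eps]. *)
have b c : 0 <= c ^+ 2 * S + 2 * c * ip s t + l2norm2 t.
  by rewrite -norm_lin //; apply: l2norm2_ge0; apply: l2D => //; apply: l2Z.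
have h1 := b d; have h2 := b (- d).
have SS : d * (S + 1) = eps by rewrite /d mulfVK // gt_eqF // ltr_wpDl.
have dS : d * S <= eps by rewrite -SS; lra.
have h3 : d ^+ 2 * S <= d * eps by rewrite expr2 -mulrA ler_wpM2l // ltW.
have h4 : l2norm2 t <= d * eps by apply: le_trans le eN.
rewrite ler_norml; apply/andP; split; rewrite -(ler_pM2l d0); lra.
Qed.

End InnerProduct.

(** * Weak limits, a real Riesz representation and bounded Toeplitz operators *)

Section ToeplitzBound.
Variable R : realType.
Local Notation CC := R[i].

Lemma mxlim_weak k (F : nat -> 'cV[CC]_k) L :
  (forall u, (fun j => rdot u (F j)) @ \oo --> rdot u L) -> mxlim F L.
Proof.
move=> h.
have dE (c : CC) a (v : 'cV[CC]_k) :
    rdot (c *: delta_mx a 0) v = complex.Re (Num.conj c * v a 0).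
  rewrite rdotE (bigD1 a) //= big1 => [|l la].
    by rewrite addr0 !mxE !eqxx mulr1.
  by rewrite !mxE (negPf la) mulr0 conjC0 mul0r.
have rE a (v : 'cV[CC]_k) : rdot (1 *: delta_mx a 0) v = complex.Re (v a 0).
  by rewrite dE conjC1 mul1r.
have iE a (v : 'cV[CC]_k) : rdot (Complex 0 1 *: delta_mx a 0) v = complex.Im (v a 0).
  by rewrite dE ReM Re_conj Im_conj /= mul0r sub0r mulN1r opprK.
apply: mxlim_entries => a b; rewrite ord1.
  by have := h (1 *: delta_mx a 0); rewrite rE; under eq_fun do rewrite rE.
by have := h (Complex 0 1 *: delta_mx a 0); rewrite iE; under eq_fun do rewrite iE.
Qed.

(** Riesz representation on [C^n] as a real space: the test vectors [i * delta_mx] supply the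
    imaginary parts, so real linearity is enough. *)
Lemma real_linear_rep n (f : 'cV[CC]_n -> R) :
  (forall (c : R) w w', f (real_complex R c *: w + w') = c * f w + f w') ->
  exists x, forall w, f w = rdot w x.
Proof.
move=> lin.
have f0 : f 0 = 0 by have := lin 1 0 0; rewrite scaler0 addr0; lra.
have fD w w' : f (w + w') = f w + f w'.
  by have := lin 1 w w'; rewrite (_ : real_complex R 1 = 1) // scale1r mul1r.
have fZ (c : R) w : f (real_complex R c *: w) = c * f w.
  by have := lin c w 0; rewrite !addr0 f0 addr0.
exists (\col_i Complex (f (delta_mx i 0)) (f (Complex 0 1 *: delta_mx i 0))) => w.
have wE : w = \sum_i (real_complex R (complex.Re (w i 0)) *: delta_mx i 0 +
    real_complex R (complex.Im (w i 0)) *: (Complex 0 1 *: delta_mx i 0)).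
  apply/matrixP => a b; rewrite ord1 summxE (bigD1 a) //= big1 => [|l la].
    rewrite addr0 !mxE !eqxx !mulr1; case: (w a 0) => u v.
    by apply: eqC; rewrite ?ReD ?ImD ?ReM ?ImM /=; ring.
  by rewrite !mxE eq_sym (negPf la) !mulr0 addr0.
rewrite {1}wE (big_morph f fD f0) rdotE; apply: eq_bigr => i _.
by rewrite fD !fZ mxE ReM Re_conj Im_conj /= mulNr opprK.
Qed.

Section Bound.
Variables (r m : nat) (coef : nat -> 'M[CC]_(r, m)) (c : R).
Hypotheses (c0 : 0 <= c) (bound : forall N h, fin N h ->
  l2le (toeplitz coef h) (c * \sum_(i < N) vnorm2 (h i))).

(** By causality the first [K] outputs depend only on the first [K] inputs, so the bound for finite
    inputs extends. *)
Lemma toeplitz_l2le f e : l2le f e -> l2le (toeplitz coef f) (c * e).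
Proof.
move=> hf K; apply: (@le_trans _ _ (\sum_(i < K) vnorm2 (toeplitz coef (trunc K f) i))).
  rewrite le_eqVlt; apply/orP; left; apply/eqP; apply: eq_bigr => i _.
  congr vnorm2; apply: eq_bigr => j _; rewrite /trunc.
  by rewrite (leq_ltn_trans _ (ltn_ord i)) // -ltnS.
apply: le_trans (bound (@trunc_fin _ _ K f) K) _; apply: ler_wpM2l => //.
apply: le_trans (hf K); apply: ler_sum => i _; rewrite /trunc ltn_ord; exact: lexx.
Qed.

(** Outerness speaks of square summable inputs, whereas [tau] and [J] take finite ones; boundedness
    allows truncating the input. *)
Lemma dense_range_fin y (e : R) : dense_range coef -> l2 y -> 0 < e ->
  exists N h, fin N h /\ l2le (fun i => toeplitz coef h i - y i) e.
Proof.
move=> dr ly e0; have e4 : 0 < e / 4 by rewrite divr_gt0.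
have [f [lf hf]] := dr y ly _ e4.
have lTf : l2 (toeplitz coef f) by have [] := l2leP (toeplitz_l2le (l2_le lf)).
have lN : l2 (fun i => - y i).
  have [] := @l2leP _ _ (fun i => - y i) (l2norm2 y) => //.
  by apply: l2le_ext (l2_le ly) => i; rewrite vnorm2N.
have h1 : l2le (fun i => toeplitz coef f i - y i) (e / 4).
  by move=> K; apply: le_trans (l2_le (l2D lTf lN) K) (ltW hf).
have ec : 0 < e / (4 * (c + 1)) by rewrite divr_gt0 // mulr_gt0 // ltr_wpDl.
have [N /(_ N (leqnn N)) /toeplitz_l2le hN] := l2_tail lf ec.
exists N, (trunc N f); split; first exact: trunc_fin.
have h2 : l2le (fun i => toeplitz coef (trunc N f) i - toeplitz coef f i) (e / 4).
  have ce : c * (e / (4 * (c + 1))) <= e / 4.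
    rewrite invfM (mulrA e) mulrCA -[X in _ <= X]mulr1; apply: ler_wpM2l; first exact: ltW.
    by rewrite ler_pdivrMr ?ltr_wpDl // mul1r lerDl.
  move=> K; apply: le_trans ce; apply: le_trans (hN K).
  apply: ler_sum => i _; rewrite -[X in _ <= X]vnorm2N toeplitzB opprB; exact: lexx.
have := l2leD h2 h1; rewrite (_ : 2 * (e / 4 + e / 4) = e); last by lra.
by apply: l2le_ext => i; rewrite addrA subrK.
Qed.

End Bound.
End ToeplitzBound.

Section Necessary.
Variable R : realType.
Local Notation CC := R[i].

Lemma wst_subC m n (A : 'M[CC]_n) (C C' : 'M[CC]_(m, n)) N h :
  wst A (C - C') N h = wst A C N h - wst A C' N h.
Proof.
rewrite !wst_sum -sumrB; apply: eq_bigr => t _.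
by rewrite mxadjB mulmxB mulBmx.
Qed.

Lemma tau_subC m n (A : 'M[CC]_n) (G : 'M[CC]_(n, m)) (C C' : 'M[CC]_(m, n)) R0 R0' N h :
  tau A G (C - C') (R0 - R0') N h = tau A G C R0 N h - tau A G C' R0' N h.
Proof.
elim: N h => [|N IH] h; first by rewrite /= subrr.
rewrite [LHS]/= [tau A G C R0 _ _]/= [tau A G C' R0' _ _]/=.
rewrite IH wst_subC mulBmx rdotDl rdotNl rdotDr rdotNr.
by move: (tau _ _ _ _ _ _) (tau _ _ _ _ _ _) => a b; gen_rdot; ring.
Qed.

(** The form is linear in the pair [(C, R0)] for fixed [G], and the difference has zero symbol;
    [tau_ge0] applies to it with either sign. *)
Lemma tau_eq_of_Fq m n (A : 'M[CC]_n) (G : 'M[CC]_(n, m)) (C C' : 'M[CC]_(m, n)) R0 R0' :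
  psum A -> (forall z v, `|z| = 1 -> Fq A G C R0 z v = Fq A G C' R0' z v) ->
  forall N h, tau A G C R0 N h = tau A G C' R0' N h.
Proof.
move=> pA FE N h.
have le (K K' : 'M[CC]_(m, n)) S S' :
    (forall z v, `|z| = 1 -> Fq A G K S z v = Fq A G K' S' z v) ->
    0 <= tau A G K S N h - tau A G K' S' N h.
  move=> E; rewrite -tau_subC; apply: tau_ge0 => // z v z1.
  have -> : Fq A G (K - K') (S - S') z v = Fq A G K S z v - Fq A G K' S' z v.
    by rewrite /Fq (mulBmx K) (mulBmx S) !rdotDr !rdotNr; gen_rdot; ring.
  by rewrite E // subrr.
apply/eqP; rewrite eq_le; apply/andP; split; rewrite -subr_ge0; apply: le => //.
by move=> z v z1; rewrite FE.
Qed.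

Definition single k (j : nat) (u : 'cV[CC]_k) (i : nat) : 'cV[CC]_k := if i == j then u else 0.

Lemma single_fin k j (u : 'cV[CC]_k) : fin j.+1 (single j u).
Proof. by move=> i ij; rewrite /single gtn_eqF. Qed.

Lemma rdot_wst_single m n (A : 'M[CC]_n) (C : 'M[CC]_(m, n)) j u x :
  rdot (wst A C j.+1 (single j u)) x = rdot u (Wobs C A x j).
Proof.
rewrite rdot_wst big_ord_recr /= big1 ?add0r => [|i _]; first by rewrite /single eqxx.
by rewrite /single ltn_eqF // rdot0l.
Qed.

Lemma toeplitz_single r m (coef : nat -> 'M[CC]_(r, m)) j u t :
  toeplitz coef (single j u) (j + t) = coef t *m u.
Proof.
elim: j => [|j IH].
  case: t => [|t]; first by rewrite toeplitz0.
  by rewrite toeplitzS toeplitz_eq0 ?addr0 // => i _.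
by rewrite addSn toeplitzS /= mulmx0 add0r -IH.
Qed.

Lemma toeplitz_single_lt r m (coef : nat -> 'M[CC]_(r, m)) j u i :
  (i < j)%N -> toeplitz coef (single j u) i = 0.
Proof.
move=> ij; rewrite /toeplitz big1 // => l _.
by rewrite /single ltn_eqF ?mulmx0 // (leq_ltn_trans _ ij) // -ltnS.
Qed.

(** Duality: by [rdot_wst_single], a vector orthogonal to the range of [W_obs^*] has zero output, so
    observability makes it 0. *)
Lemma wst_surj m n (A : 'M[CC]_n) (C : 'M[CC]_(m, n)) (w : 'cV[CC]_n) :
  observable C A -> exists N h, fin N h /\ wst A C N h = w.
Proof.
move=> obs.
have sub : subspace (fun v => exists N h, fin N h /\ wst A C N h = v).
  split; first by exists 0%N, (fun=> 0); split.
  move=> a _ _ [N [h [fh <-]]] [M [g [fg <-]]].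
  exists (maxn N M), (fun i => a *: h i + g i); split.
    move=> i; rewrite geq_max => /andP[Ni Mi].
    by rewrite fh // fg // scaler0 addr0.
  by rewrite wst_lin (wst_pad A C fh (leq_maxl N M)) (wst_pad A C fg (leq_maxr N M)).
have [e [N [h [fh hE]]] eo] := ortho_decomp w sub.
suff d0 : w - e = 0 by exists N, h; split=> //; rewrite hE; apply/esym/subr0_eq.
apply: obs => j; apply: rdot_inj => u; rewrite rdot0r -[_ *m _]/(Wobs C A (w - e) j).
rewrite -rdot_wst_single; apply: eo; exists j.+1, (single j u); split=> //.
exact: single_fin.
Qed.

End Necessary.

(** * Minimal norm under the constraint [W_obs^* h = y] *)

Section Projection.
Variable R : realType.
Local Notation CC := R[i].
Variables (m n r : nat) (A : 'M[CC]_n) (G : 'M[CC]_(n, m)) (C : 'M[CC]_(m, n))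
  (R0 : 'M[CC]_m) (coef : nat -> 'M[CC]_(r, m)).
Hypothesis obsC : observable C A.
Hypothesis norm_tau : forall N h, fin N h ->
  series (fun k => vnorm2 (toeplitz coef h k)) @ \oo --> tau A G C R0 N h.

Local Notation T := (toeplitz coef).
Local Notation ta := (tau A G C R0).
Local Notation w := (wst A C).

Lemma toeplitz_fin_l2 N h : fin N h -> l2 (T h) /\ l2norm2 (T h) = ta N h.
Proof.
move=> fh; split; last exact: cvgn_lim (norm_tau fh).
by have [] := l2leP (series_vnorm2_le (norm_tau fh)).
Qed.

Lemma sub_fin k N M (h g : nat -> 'cV[CC]_k) : fin N h -> fin M g ->
  fin (maxn N M) (fun i => h i - g i).
Proof.
move=> fh fg i; rewrite geq_max => /andP[Ni Mi].
by rewrite fh // fg // subrr.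
Qed.

Lemma lin_fin k (c : CC) N M (h g : nat -> 'cV[CC]_k) : fin N h -> fin M g ->
  fin (maxn N M) (fun i => c *: h i + g i).
Proof.
move=> fh fg i; rewrite geq_max => /andP[Ni Mi].
by rewrite fh // fg // scaler0 addr0.
Qed.

Lemma wst_lin_fin (c : CC) N M (h g : nat -> 'cV[CC]_m) : fin N h -> fin M g ->
  w (maxn N M) (fun i => c *: h i + g i) = c *: w N h + w M g.
Proof.
move=> fh fg; rewrite wst_lin.
by rewrite (wst_pad A C fh (leq_maxl N M)) (wst_pad A C fg (leq_maxr N M)).
Qed.

(** Parallelogram law: the midpoint of two admissible inputs is again admissible, so its form is at
    least [s]. *)
Lemma cauchy_minimizers (y : 'cV[CC]_n) (s : R) N h M g :
  (forall N h, fin N h -> w N h = y -> s <= ta N h) ->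
  fin N h -> w N h = y -> fin M g -> w M g = y ->
  l2le (fun i => T h i - T g i) (2 * (ta N h - s) + 2 * (ta M g - s)).
Proof.
move=> lb fh wh fg wg; pose L := maxn N M.
have NL : (N <= L)%N by apply: leq_maxl.
have ML : (M <= L)%N by apply: leq_maxr.
have fd := sub_fin fh fg; rewrite -/L in fd.
have hs := series_vnorm2_le (norm_tau fd).
have := tau_par A G C R0 L h g.
rewrite (tau_pad A G C R0 fh NL) (tau_pad A G C R0 fg ML).
have half : real_complex R 2^-1 *: (y + y) = y.
  rewrite scalerDr -scalerDl (_ : _ + _ = 1) ?scale1r //.
  by apply: eqC; rewrite ?ReD ?ImD /=; lra.
have fm : fin L (fun i => real_complex R 2^-1 *: (h i + g i)).
  move=> i Li; rewrite fh ?fg ?addr0 ?scaler0 //.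
    exact: leq_trans ML Li.
  exact: leq_trans NL Li.
have wm : w L (fun i => real_complex R 2^-1 *: (h i + g i)) = y.
  rewrite (wstZ A C L _ (fun i => h i + g i)) wstD.
  by rewrite (wst_pad A C fh NL) (wst_pad A C fg ML) wh wg half.
have := lb _ _ fm wm; rewrite (tauZ A G C R0 L _ (fun i => h i + g i)).
have -> : cabs2 (real_complex R 2^-1) = 4^-1 by rewrite /cabs2 /=; lra.
have ar (a b c d : R) : s <= 4^-1 * a -> a + b = 2 * c + 2 * d ->
  b <= 2 * (c - s) + 2 * (d - s) by lra.
move=> h1 h2 K; apply: le_trans (ar _ _ _ _ h1 h2); apply: le_trans (hs K).
by apply: ler_sum => i _; rewrite toeplitzB; exact: lexx.
Qed.

(* The minimal-norm element of the closure of [T h], [w h = y], is orthogonal to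
   [T g] for [w g = 0], hence pairs with every [T g] through a vector [x]. *)
Lemma minimal_element (y : 'cV[CC]_n) : exists (s : R) z x,
  [/\ l2 z, l2norm2 z = s, (forall N h, fin N h -> w N h = y -> s <= ta N h),
     (forall N g, fin N g -> ip (T g) z = rdot (w N g) x) &
     [/\ rdot y x = s & forall b : R, (forall N h, fin N h -> w N h = y -> b <= ta N h) ->
       b <= s]].
Proof.
pose V : set R := [set t | exists N h, [/\ fin N h, w N h = y & t = ta N h]].
have V0 : V !=set0.
  by have [N [h [fh wh]]] := wst_surj y obsC; exists (ta N h), N, h.
have lV : has_lbound V.
  exists 0 => _ [N [h [fh _ ->]]]; have [lT <-] := toeplitz_fin_l2 fh.
  exact: l2norm2_ge0.
pose s := inf V.
have lb N h : fin N h -> w N h = y -> s <= ta N h.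
  by move=> fh wh; apply: (ge_inf lV); exists N, h.
have /choice[Nh hNh] : forall k : nat, exists Nh : nat * (nat -> 'cV[CC]_m),
    [/\ fin Nh.1 Nh.2, w Nh.1 Nh.2 = y & ta Nh.1 Nh.2 <= s + harmonic k].
  move=> k; have [|_ [N [h [fh wh ->]]] hlt] := @inf_adherent _ V (harmonic k) _ (conj V0 lV).
    exact: harmonic_gt0.
  by exists (N, h); split=> //; apply: ltW.
pose f k := T (Nh k).2; pose e k : R := 2 * harmonic k.
have he : e @ \oo --> (0 : R).
  apply: (cvgn_dom (c := 2)) (@cvg_harmonic R) => k.
  by rewrite subr0 ger0_norm // mulr_ge0 // harmonic_ge0.
have fN k : fin (Nh k).1 (Nh k).2 by have [] := hNh k.
have wN k : w (Nh k).1 (Nh k).2 = y by have [] := hNh k.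
have tN k : ta (Nh k).1 (Nh k).2 <= s + harmonic k by have [] := hNh k.
have lf k : l2 (f k) by have [] := toeplitz_fin_l2 (fN k).
have cau j l : l2le (fun i => f j i - f l i) (e j + e l).
  move=> K; apply: le_trans (cauchy_minimizers lb (fN j) (wN j) (fN l) (wN l) K) _.
  have := tN j; have := tN l; rewrite /e.
  by move: (ta _ _) (ta _ _) (harmonic j) (harmonic l) => a b c d; lra.
have [z hz] := l2_complete he cau.
have [lz ipz] := approx_norm he lf hz.
have tlim : (fun k => ta (Nh k).1 (Nh k).2) @ \oo --> s.
  apply: (cvgn_dom (c := 1)) (@cvg_harmonic R) => k; rewrite mul1r ler_norml.
  have := tN k; have := lb _ _ (fN k) (wN k); have := @harmonic_ge0 R k.
  by move: (ta _ _) (harmonic k) => a b h1 h2 h3; apply/andP; split; lra.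
(* Adding [t g] to a minimizing sequence preserves the constraint, so the first variation at [z]
   vanishes. *)
have orth N g : fin N g -> w N g = 0 -> ip (T g) z = 0.
  move=> fg wg; have [lg gE] := toeplitz_fin_l2 fg.
  have key (t : R) : 0 <= t ^+ 2 * ta N g + 2 * t * ip (T g) z.
    have h1 k : s <= t ^+ 2 * ta N g + 2 * t * ip (T g) (f k) + ta (Nh k).1 (Nh k).2.
      have fl := lin_fin (real_complex R t) fg (fN k).
      have wl := wst_lin_fin (real_complex R t) fg (fN k).
      rewrite wg scaler0 add0r wN in wl.
      have := lb _ _ fl wl; have [_ <-] := toeplitz_fin_l2 fl.
      have [_ <-] := toeplitz_fin_l2 (fN k); rewrite -gE -(norm_lin t lg (lf k)).
      congr (_ <= l2norm2 _); apply/funext => i.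
      exact: toeplitz_lin.
    have h2 : (fun k => t ^+ 2 * ta N g + 2 * t * ip (T g) (f k) + ta (Nh k).1 (Nh k).2)
        @ \oo --> t ^+ 2 * ta N g + 2 * t * ip (T g) z + s.
      apply: cvgD => //; apply: cvgD; first exact: cvg_cst.
      by apply: cvgM; [exact: cvg_cst | exact: ipz].
    have : s <= t ^+ 2 * ta N g + 2 * t * ip (T g) z + s.
      apply: (cvgn_le (N := 0%N) (u := fun=> s) _ h2); first exact: cvg_cst.
      by move=> k _; apply: h1.
    by move: (t ^+ 2 * _) (2 * t * _) => a b; lra.
  have b0 : 0 <= ta N g by rewrite -gE; apply: l2norm2_ge0.
  move: (ta N g) (ip (T g) z) b0 key => b a b0 key.
  apply/eqP; rewrite -sqrf_eq0 eq_le sqr_ge0 andbT.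
  (* Nearly the minimizer [- a / b], shifted to avoid division by 0; the value is then negative
     unless [a = 0]. *)
  have := key (- a / (b + 1)).
  have -> : (- a / (b + 1)) ^+ 2 * b + 2 * (- a / (b + 1)) * a =
      - a ^+ 2 * ((b + 2) / (b + 1) ^+ 2).
    by field; rewrite gt_eqF // ltr_wpDl.
  rewrite mulNr oppr_ge0 pmulr_lle0 // divr_gt0 ?exprn_gt0 ?ltr_wpDl //.
have /choice[gw hgw] : forall v : 'cV[CC]_n, exists Ng : nat * (nat -> 'cV[CC]_m),
    fin Ng.1 Ng.2 /\ w Ng.1 Ng.2 = v.
  by move=> v; have [N [h hh]] := wst_surj v obsC; exists (N, h).
(* By [orth] the pairing of [z] with [T g] depends only on [w g], so [lam] is well defined and real
   linear. *)
pose lam v := ip (T (gw v).2) z.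
have lamE N g v : fin N g -> w N g = v -> ip (T g) z = lam v.
  move=> fg wg; have [fv wv] := hgw v.
  have fl := lin_fin (-1) fg fv; have wl := wst_lin_fin (-1) fg fv.
  have := orth _ _ fl; rewrite wl wg wv scaleN1r addNr => /(_ erefl).
  have [lg _] := toeplitz_fin_l2 fg; have [lv _] := toeplitz_fin_l2 fv.
  have -> : T (fun i => -1 *: g i + (gw v).2 i) =
      (fun i => real_complex R (-1) *: T g i + T (gw v).2 i).
    by apply/funext => i; rewrite toeplitz_lin rmorphN1.
  rewrite (ip_lin (-1) lg lv lz) /lam; move: (ip _ _) (ip _ _) => a b; lra.
have [x xE] : exists x, forall v, lam v = rdot v x.
  apply: real_linear_rep => c v v'.
  have [fv wv] := hgw v; have [fv' wv'] := hgw v'.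
  have [lv _] := toeplitz_fin_l2 fv; have [lv' _] := toeplitz_fin_l2 fv'.
  have fl := lin_fin (real_complex R c) fv fv'.
  have wl := wst_lin_fin (real_complex R c) fv fv'; rewrite wv wv' in wl.
  rewrite -(lamE _ _ _ fl wl) -(ip_lin c lv lv' lz); congr (ip _ z).
  by apply/funext => i; rewrite toeplitz_lin.
have pair N g : fin N g -> ip (T g) z = rdot (w N g) x.
  by move=> fg; rewrite (lamE N g _ fg erefl) xE.
have zy : l2norm2 z = rdot y x.
  rewrite l2norm2E; apply: (cvgn_uniq (ipz z lz)).
  have -> : (fun k => ip z (f k)) = fun=> rdot y x.
    by apply/funext => k; rewrite ipC (pair _ _ (fN k)) wN.
  exact: cvg_cst.
have zs : l2norm2 z = s.
  have h1 k : ta (Nh k).1 (Nh k).2 - l2norm2 z <= e k.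
    have [_ <-] := toeplitz_fin_l2 (fN k); rewrite -/(f k).
    have [_] := l2leP (hz k).
    have -> : (fun i => f k i - z i) = (fun i => real_complex R (-1) *: z i + f k i).
      by apply/funext => i; rewrite rmorphN1 scaleN1r addrC.
    rewrite (norm_lin (-1) lz (lf k)) (ipC z) (pair _ _ (fN k)) wN -zy.
    by move: (l2norm2 z) (l2norm2 (f k)) => a b; lra.
  have h2 k : 0 <= ta (Nh k).1 (Nh k).2 - l2norm2 z.
    have [_ <-] := toeplitz_fin_l2 (fN k); rewrite -/(f k).
    have := l2norm2_ge0 (l2D (l2Z (c := -1) lz) (lf k)).
    rewrite (norm_lin (-1) lz (lf k)) (ipC z) (pair _ _ (fN k)) wN -zy.
    by move: (l2norm2 z) (l2norm2 (f k)) => a b; lra.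
  apply: cvgn_uniq tlim; apply: (cvgn_dom (c := 1)) he => k.
  by rewrite mul1r ger0_norm.
exists s, z, x; split=> //; split; first by rewrite -zy.
move=> b hb; apply: lb_le_inf => // _ [N [h [fh wh ->]]]; exact: hb.
Qed.

End Projection.

(** * Conditions (i) and (ii) from the operator inequality *)

Section NecessaryMain.
Variable R : realType.
Local Notation CC := R[i].
Variables (m p q n : nat) (A : 'M[CC]_n) (B1 : 'M[CC]_(n, p)) (B2 : 'M[CC]_(n, q))
  (C : 'M[CC]_(m, n)) (D1 : 'M[CC]_(m, p)) (D2 : 'M[CC]_(m, q)).
Hypotheses (pA : psum A) (obsC : observable C A).

Local Notation P1 := (P1 A B1).
Local Notation P2 := (P2 A B2).
Local Notation G := (Gamma A B1 B2 C D1 D2).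
Local Notation Rc := (Rconst A B1 B2 C D1 D2).
Local Notation XP := (XPhi A B1 B2 C D1 D2).

Hypothesis T : forall N h,
  rdot (wst A C N h) ((P1 - P2) *m wst A C N h) <= tau A G C Rc N h.

Lemma necessary_i : cond_i A B1 B2 C D1 D2.
Proof.
move=> z z1; apply: (psdP (Rfun_herm A B1 B2 C D1 D2 z)).2 => v.
rewrite (Rfun_quad B1 B2 C D1 D2 pA v z1).
apply: (@Fq_ge0_of_tau _ _ _ A G C Rc (nrm (P1 - P2)) z v pA (nrm_ge0 _) _ z1) => N h.
apply: le_trans (T N h).
have := le_trans (rdot_le_nrm (wst A C N h) ((P1 - P2) *m wst A C N h))
  (ler_wpM2l (nrm_ge0 _) (nrmM (P1 - P2) (wst A C N h))).
rewrite ler_norml => /andP[h1 _]; apply: le_trans h1.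
by rewrite lerN2 expr2 mulrCA; exact: lexx.
Qed.

(** A zero symbol forces [tau = 0], and by surjectivity of [wst] the inequality [T] is then tested
    on every vector. *)
Lemma necessary_zero : R_zero A B1 B2 C D1 D2 -> psd (P2 - P1).
Proof.
have ar (x y a b : R) : x = b - a -> y = a - b -> y <= 0 -> 0 <= x by lra.
move=> rz; have hP1 := P1_herm B1 pA; have hP2 := P2_herm B2 pA.
apply: (psdP (hermB hP2 hP1)).2 => v.
have [N [h [_ wh]]] := wst_surj v obsC.
have tE : tau A G C Rc N h = tau A G (0 : 'M[CC]_(m, n)) (0 : 'M[CC]_m) N h.
  apply: tau_eq_of_Fq => // z u z1.
  rewrite -(Rfun_quad B1 B2 C D1 D2 pA u z1) rz // mul0mx rdot0r.
  by rewrite /Fq !mul0mx !rdot0r mulr0 addr0.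
have t0 : tau A G (0 : 'M[CC]_(m, n)) (0 : 'M[CC]_m) N h = 0.
  have := tau_subC A G C C Rc Rc N h; rewrite !subrr; exact.
have := T N h; rewrite tE t0 wh => h0.
exact: ar (quadB _ _ _) (quadB _ _ _) h0.
Qed.

Section Admissible.
Variables (r : nat) (D : 'M[CC]_(r, m)) (CP : 'M[CC]_(r, n)) (d : nat)
  (E : 'M[CC]_(n, d)).
Hypotheses (adm : admissible A B1 B2 C D1 D2 D CP) (onb : onb_of E (XP D CP)).
Local Notation Q := (obs_gram CP A).

Lemma admissible_tau N h :
  tau A G C Rc N h = tau A G (CF A G CP D Q) (RF G D Q) N h.
Proof.
have [_ RE _ _] := adm; apply: tau_eq_of_Fq => // z v z1.
apply: etrans (@factor_circle _ _ _ _ A G CP D _ (obs_gram_herm CP pA)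
    (obs_gram_lyap CP pA) pA z v z1).
rewrite -(Rfun_quad B1 B2 C D1 D2 pA v z1) RE // vnorm2E -mulmxA.
by rewrite (rdot_adj _^H) mxadjK.
Qed.

Lemma toeplitz_norm_tau N h : fin N h ->
  series (fun k => vnorm2 (toeplitz (rcoef D CP A G) h k)) @ \oo --> tau A G C Rc N h.
Proof.
move=> fh; have := @factor_toeplitz_cvg _ _ _ _ A G CP D Q (obs_gram_herm CP pA)
  (obs_gram_lyap CP pA) pA N h fh.
by rewrite -admissible_tau.
Qed.

(** Outerness enters here: some [T_Phi g] is close to the output [W_{Phi,obs} x], so [J(x, g)] comes
    within [e] of [x^* Q x], while [J(x, g) = 2 Re <T_Phi g, z> - |T_Phi g|^2 <= |z|^2]. *)
Lemma gram_le_norm x z : l2 z -> XP D CP x ->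
  (forall N g, fin N g -> ip (toeplitz (rcoef D CP A G) g) z = rdot (wst A C N g) x) ->
  rdot x (Q *m x) <= l2norm2 z.
Proof.
move=> lz Xx pair; have [_ _ dense adjX] := adm.
have WE := Wobs_factor pA (adjX x Xx).
have [c c0 hc] := tau_bound G C Rc pA.
have bound N h : fin N h -> l2le (toeplitz (rcoef D CP A G) h)
    (c * \sum_(i < N) vnorm2 (h i)).
  by move=> fh K; apply: le_trans (series_vnorm2_le (toeplitz_norm_tau fh) K) (hc N h).
have lW : l2 (Wobs CP A x).
  by have [] := l2leP (series_vnorm2_le (obs_norm_cvg (obs_gram_lyap CP pA) pA (x := x))).
apply: (@le_of_eps _ _ _ 1) => // e e0; rewrite mul1r.
have [N [g [fg hg]]] := dense_range_fin c0 bound dense lW e0.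
have hg' : l2le (fun k => Wobs CP A x k - toeplitz (rcoef D CP A G) g k) e.
  by apply: l2le_ext hg => i; rewrite -vnorm2N opprB.
have := @factor_norm_cvg _ _ _ _ A G CP D Q (obs_gram_herm CP pA)
  (obs_gram_lyap CP pA) pA N g x fg.
rewrite -(J_factor admissible_tau N g WE) => hl.
have h1 : rdot x (Q *m x) - J A G C Rc x N g <= e.
  by have [_] := l2leP hg'; rewrite /l2norm2 (cvgn_lim hl).
have [lT TE] := toeplitz_fin_l2 toeplitz_norm_tau fg.
have := ip_le lT lz; rewrite (pair N g fg) TE; move: h1; rewrite /J.
by move: (tau _ _ _ _ _ _) (l2norm2 z) => a b; gen_rdot; lra.
Qed.

Lemma admissible_psd : psd (Delta A CP E + P2 - P1).
Proof.
have ar (s u v t a b e f : R) : u = v - e -> v = a + b -> t = e - b ->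
    t <= s -> f <= s -> 0 <= f - s - (s - a) -> 0 <= u by lra.
have [_ _ _ adjX] := adm; have [EE XE] := onb.
have hP1 := P1_herm B1 pA; have hP2 := P2_herm B2 pA.
have uO : E^H *m Q *m E \in unitmx.
  by apply: (gram_unit pA obsC EE) => c; apply: adjX; apply/XE; exists c.
have hD := Delta_herm pA CP E; have hQ := obs_gram_herm CP pA.
apply: (psdP (hermB (hermD hD hP2) hP1)).2 => y.
have [s [z [x [lz zs lb pair [yx smax]]]]] :=
  minimal_element obsC toeplitz_norm_tau y.
(* Testing the pairing on impulses at time [j] identifies [W_obs x] with [T_Phi^* z] entry by
   entry. *)
have Xx : XP D CP x.
  exists z; split=> //; apply/toeplitz_adjP => j; apply: mxlim_weak => u.
  rewrite -rdot_wst_single -(pair _ _ (@single_fin _ _ j u)).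
  have [lT _] := toeplitz_fin_l2 toeplitz_norm_tau (@single_fin _ _ j u).
  have := (cvgnDn _ _ j).2 (ip_cvg lT lz).
  have E1 K : series (fun i => rdot (toeplitz (rcoef D CP A G) (single j u) i) (z i))
      (j + K)%N = rdot u (\sum_(t < K) (rcoef D CP A G t)^H *m z (j + t)%N).
    rewrite /series /= big_mkord big_split_ord /= big1 ?add0r => [|i _]; last first.
      by rewrite toeplitz_single_lt // rdot0l.
    elim/big_rec2: _ => [|i a b _ ->]; first by rewrite rdot0r.
    by rewrite rdotDr toeplitz_single rdot_adjl.
  by under eq_fun do rewrite E1.
have [c xc] := (XE x).1 Xx.
have h1 := gram_le_norm lz Xx pair; rewrite zs in h1.
have h2 : rdot y ((P1 - P2) *m y) <= s.
  by apply: smax => N h fh wh; have := T N h; rewrite wh.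
(* Expanding [Q >= 0] at [x - Delta y] gives [x^* Q x - 2 Re y^* x + y^* Delta y >= 0]; with
   [Re y^* x = s] and [x^* Q x <= s] this yields [s <= y^* Delta y]. *)
have pos := gram_ge0 (x - Delta A CP E *m y) pA (obs_gram_lyap CP pA).
have cross : rdot (Delta A CP E *m y) (Q *m x) = rdot y x.
  rewrite rdot_adjl hD; congr rdot; rewrite xc /Delta -!mulmxA.
  by rewrite (mulmxA Q E c) (mulmxA E^H (Q *m E) c) (mulmxA E^H Q E) mulKmx.
rewrite mulmxB rdotDl rdotNl 2!rdotDr 2!rdotNr (rdot_herm x _ hQ) cross yx
  (Delta_quad pA uO y) in pos.
exact: ar (quadB _ _ _) (quadD _ _ _) (quadB _ _ _) h2 h1 pos.
Qed.

End Admissible.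
End NecessaryMain.

Theorem theorem3p2 (R : realType) (m p q n : nat) (A : 'M[R[i]]_n)
  (B1 : 'M[R[i]]_(n, p)) (B2 : 'M[R[i]]_(n, q)) (C : 'M[R[i]]_(m, n))
  (D1 : 'M[R[i]]_(m, p)) (D2 : 'M[R[i]]_(m, q)) :
  stable A ->
  observable C A ->
  controllable A (row_mx B1 B2) ->
  toeplitz_diff_nonneg A B1 B2 C D1 D2 <->
  (cond_i A B1 B2 C D1 D2 /\ cond_ii A B1 B2 C D1 D2).
Proof.
move=> /stable_psum pA obsC _; split=> [|[ci cii]]; last exact: sufficient.
move=> /(toeplitz_diff_nonnegP B1 B2 C D1 D2 pA) T.
split; first exact: necessary_i.
split; first exact: necessary_zero.
by move=> _ r D CP adm d E onb; apply: (admissible_psd pA obsC T adm onb).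
Qed.
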